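(* Let $\mathcal{T}$ be a spherically homogeneous rooted tree. Then the following hold: (i) If $G$ is an infinitely iterated wreath product of finite transitive permutation groups of degree at least $2$, then $\mathrm{L}(G)=1$. This applies in particular to the whole group $\mathrm{Aut}\,\mathcal{T}$ of automorphisms of $\mathcal{T}$, and also to its Sylow pro-$p$ subgroups if $\mathcal{T}$ is a $p$-adic tree, where $p$ is a prime. (ii) If $\mathcal{F}$ is the group of finitary automorphisms of $\mathcal{T}$, and there are infinitely many levels of $\mathcal{T}$ in which the number of (immediate) descendants of a vertex is greater than $2$, then $\mathrm{L}(\mathcal{F})=1$. If $\mathcal{T}$ is a $p$-adic tree, $p$ a prime, and $\mathcal{F}_p$ is the group of $p$-finitary automorphisms of $\mathcal{T}$, then $\overline{\mathrm{L}}(\mathcal{F}_p)=1$. (iii) If $\mathcal{H}$ is the Hanoi Tower group then $\mathrm{L}(\mathcal{H})=1$. (iv) If $G$ is a multi-GGS group then $\mathrm{R}(G)=1$, and if $G$ is furthermore non-periodic then $\mathrm{L}(G)=1$.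
   Context: Engel elements. For $g,x$ in a group $G$ put $[g,_0 x]=g$ and $[g,_n x]=[[g,_{n-1}x],x]$ for $n\ge 1$. $x\in G$ is a left Engel element if for every $g\in G$ there is $n\in\mathbb{N}$ with $[g,_n x]=1$, and a bounded left Engel element if a single $n$ works for all $g\in G$. $g\in G$ is a right Engel element if for every $x\in G$ there is $n\in\mathbb{N}$ with $[g,_n x]=1$. The sets of left, bounded left, and right Engel elements are $\mathrm{L}(G)$, $\overline{\mathrm{L}}(G)$, $\mathrm{R}(G)$. Trees. Let $(d_n)_{n\ge 1}$ be a sequence of integers greater than $1$. The corresponding spherically homogeneous rooted tree $\mathcal{T}$ is the rooted tree in which every vertex at level $n$ (distance $n$ from the root) has exactly $d_{n+1}$ immediate descendants. If $d_n=d$ for all $n$ it is the $d$-adic tree $\mathcal{T}_d$. $\mathrm{Aut}\,\mathcal{T}$ is the group of bijections of the vertex set preserving root and incidence. Composition is written left to right: $fg$ means first $f$, then $g$. The immediate descendants of each vertex at level $n$ are numbered $1,\ldots,d_{n+1}$, so each $f\in\mathrm{Aut}\,\mathcal{T}$ has, at each vertex $v$ at level $n$, a label $f_{(v)}\in S_{d_{n+1}}$ describing how $f$ sends the immediate descendants of $v$ onto those of $f(v)$; $f$ is determined by its labels. The automorphism $f$ is finitary if only finitely many labels are non-trivial; finitary automorphisms form the group $\mathcal{F}$. If $p$ is a prime, $\mathcal{T}=\mathcal{T}_p$, and $\sigma\in S_p$ is a fixed $p$-cycle, then $\mathcal{F}_p$ (the group of $p$-finitary automorphisms) consists of the finitary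 automorphisms all of whose labels are powers of $\sigma$, and the set $\Gamma_p$ of all automorphisms with all labels in $\langle\sigma\rangle$ is a (standard) Sylow pro-$p$ subgroup of the profinite group $\mathrm{Aut}\,\mathcal{T}_p$. Infinitely iterated wreath product: given finite transitive permutation groups $K_n\le S_{d_n}$ of degree $d_n\ge 2$ ($n\ge 1$), it is (up to isomorphism) the group of all automorphisms of the tree defined by $(d_n)_{n\ge1}$ whose labels at level $n$ lie in $K_{n+1}$ for all $n\ge 0$. Recursive notation: on the $d$-adic tree, $f=(g_1,\ldots,g_d)\sigma$ with $g_i\in\mathrm{Aut}\,\mathcal{T}_d$ and $\sigma\in S_d$ means $f=gh$, where $g$ fixes every first-level vertex and acts on the subtree hanging from the $i$th first-level vertex (identified with $\mathcal{T}_d$) as $g_i$, and $h$ is the rooted automorphism corresponding to $\sigma$, i.e. it permutes rigidly the subtrees hanging from the first level according to $\sigma$. If $\sigma=1$ it is omitted. Hanoi Tower group: $\mathcal{H}=\langle a,b,c\rangle\le\mathrm{Aut}\,\mathcal{T}_3$, where $a=(1,1,a)(1\ 2)$, $b=(1,b,1)(1\ 3)$, $c=(c,1,1)(2\ 3)$. Multi-GGS groups: for an odd prime $p$ and a non-trivial subspace $\mathbf{E}$ of $\mathbb{F}_p^{p-1}$, the multi-GGS group $G_{\mathbf{E}}\le\mathrm{Aut}\,\mathcal{T}_p$ is generated by the rooted automorphism $a$ corresponding to the $p$-cycle $(1\ 2\ \ldots\ p)$ and by all automorphisms $b_{\mathbf{e}}$, $\mathbf{e}=(e_1,\ldots,e_{p-1})\in\mathbf{E}$,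 defined recursively by $b_{\mathbf{e}}=(a^{e_1},\ldots,a^{e_{p-1}},b_{\mathbf{e}})$. A group is periodic if all its elements have finite order. *)

(* Defs.v *)
From HB Require Import structures.
From mathcomp Require Import all_boot all_order all_algebra all_fingroup.
From mathcomp Require Import all_solvable all_classical.

Set Implicit Arguments.
Unset Strict Implicit.
Unset Printing Implicit Defensive.

Local Open Scope classical_set_scope.
Local Open Scope group_scope.

(* The groups considered are infinite, so a subgroup is a classical set in a
   [groupType].  In the library [~ x, y] is x^-1 * y^-1 * x * y. *)

Definition is_subgroup (gT : groupType) (G : set gT) : Prop :=
  group_closed (mem G).

Definition subgroup_generated (gT : groupType) (A : set gT) : set gT :=
  smallest (@is_subgroup gT) A.

Definition engel (gT : groupType) (g x : gT) (n : nat) : gT :=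
  iter n (fun y => [~ y, x]) g.

Definition left_engel (gT : groupType) (G : set gT) : set gT :=
  [set x | G x /\ forall g, G g -> exists n, engel g x n = 1].

Definition bounded_left_engel (gT : groupType) (G : set gT) : set gT :=
  [set x | G x /\ exists n, forall g, G g -> engel g x n = 1].

Definition right_engel (gT : groupType) (G : set gT) : set gT :=
  [set g | G g /\ forall x, G x -> exists n, engel g x n = 1].

Definition periodic (gT : groupType) (G : set gT) : Prop :=
  forall x, G x -> exists2 n, (0 < n)%N & x ^+ n = 1.

Definition isomorphic (gT hT : groupType) (G : set gT) (H : set hT) : Prop :=
  exists2 phi : gT -> hT,
    {in G &, {morph phi : x y / x * y}} & set_bij G H phi.

(* A vertex of level [n] is a word [:: x_0; ...; x_(n-1)] with [x_i < d i].
   Thus [d n] is the number of immediate descendants of the vertices of level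
   [n] (it is usually written d_(n+1)), and descendants are numbered from 0. *)

Definition is_vertex (d : nat -> nat) (w : seq nat) : bool :=
  all (fun i => nth 0 w i < d i)%N (iota 0 (size w)).

Record vertex (d : nat -> nat) :=
  Vertex { vword :> seq nat; vertexP : is_vertex d vword }.

HB.instance Definition _ d := [isSub for @vword d].
HB.instance Definition _ d := [Countable of vertex d by <:].

Definition level (d : nat -> nat) (v : vertex d) : nat := size v.

Definition troot (d : nat -> nat) : vertex d := @Vertex d [::] isT.

Definition descendant (d : nat -> nat) (u v : vertex d) : bool :=
  prefix u v && (level v == (level u).+1).

Definition incident (d : nat -> nat) (u v : vertex d) : bool :=
  descendant u v || descendant v u.

Lemma is_vertex_rcons d w i :
  is_vertex d (rcons w i) = is_vertex d w && (i < d (size w))%N.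
Proof.
rewrite /is_vertex size_rcons -addn1 iotaD all_cat add0n /= andbT.
rewrite nth_rcons ltnn eqxx; congr (_ && _).
apply: eq_in_all => k; rewrite mem_iota /= add0n => kw.
by rewrite nth_rcons kw.
Qed.

Lemma child_subproof d (v : vertex d) (i : 'I_(d (level v))) :
  is_vertex d (rcons v i).
Proof. by rewrite is_vertex_rcons vertexP ltn_ord. Qed.

Definition child d (v : vertex d) (i : 'I_(d (level v))) : vertex d :=
  Vertex (child_subproof i).

Lemma descendantP d (u v : vertex d) :
  reflect (exists i : 'I_(d (level u)), v = child i) (descendant u v).
Proof.
apply: (iffP andP) => [[/prefixP [w vE]]|[i ->]]; last first.
  by rewrite prefix_rcons /level size_rcons.
rewrite /level vE size_cat -addn1 eqn_add2l => sw.
case: w sw vE => [|x [|//]] //= _; rewrite cats1 => vE.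
have /andP[_ xu]: is_vertex d u && (x < d (size u))%N.
  by rewrite -is_vertex_rcons -vE vertexP.
by exists (Ordinal xu); apply: val_inj.
Qed.

Lemma descendant_inj d (u u' v : vertex d) :
  descendant u v -> descendant u' v -> u = u'.
Proof.
move=> /descendantP [i ->] /descendantP [j] /(congr1 val) /= /rcons_inj [e _].
exact: val_inj.
Qed.

Lemma level0 d (v : vertex d) : level v = 0%N -> v = troot d.
Proof. by move=> v0; apply/val_inj/size0nil. Qed.

Record treeAut (d : nat -> nat) := TreeAut {
  treeAut_fun :> vertex d -> vertex d;
  treeAut_bij : bijective treeAut_fun;
  treeAut_root : treeAut_fun (troot d) = troot d;
  treeAut_incident : forall u v,
    incident (treeAut_fun u) (treeAut_fun v) = incident u v }.

Lemma treeAutP d (f g : treeAut d) : (forall v, f v = g v) -> f = g.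
Proof.
case: f g => [f f1 f2 f3] [g g1 g2 g3] /= /funext fg; rewrite -fg in g1 g2 g3 *.
by congr TreeAut; exact: Prop_irrelevance.
Qed.

Lemma treeAut_descendant d (f : treeAut d) u v :
  descendant (f u) (f v) = descendant u v.
Proof.
have D (w : vertex d) : forall t, level w = t ->
    forall x, descendant w x -> descendant (f w) (f x).
  move=> t; elim: t w => [|t IH] w wt x wx.
    have := treeAut_incident f w x; rewrite /incident wx /=.
    rewrite (level0 wt) treeAut_root => /orP [//|/andP[_]].
    by rewrite /level /=.
  have := treeAut_incident f w x; rewrite /incident wx /= => /orP [//|fxw].
  have [y yw]: exists y, descendant y w.
    case: (w) wt => s; rewrite /level /=; case/lastP: s => [//|s k] /=.
    rewrite size_rcons => sP _; have s1 : is_vertex d s.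
      by move: (sP); rewrite is_vertex_rcons => /andP[].
    exists (Vertex s1).
    by rewrite /descendant /level /= prefix_rcons size_rcons eqxx.
  have yt : level y = t.
    by move: yw => /andP [_ /eqP]; rewrite wt => -[].
  have xy := bij_inj (treeAut_bij f) (descendant_inj fxw (IH _ yt _ yw)).
  move: wx => /andP [_]; rewrite xy yt wt => /eqP e.
  by have := leqnSn t.+1; rewrite -e ltnn.
apply/idP/idP => [fuv|/D]; last exact.
have := treeAut_incident f u v; rewrite /incident fuv /= => /esym /orP [//|/(D _ _ erefl)].
move: fuv => /andP [_ /eqP e1] /andP [_ /eqP e2].
by have := leqnSn (level (f u)).+1; rewrite -e1 -e2 {1}e1 ltnn.
Qed.

Lemma level_treeAut d (f : treeAut d) v : level (f v) = level v.
Proof.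
case: v => s; elim/last_ind: s => [|s k IH] sP.
  by rewrite (_ : Vertex sP = troot d) ?treeAut_root //; apply: val_inj.
have s1 : is_vertex d s by move: (sP); rewrite is_vertex_rcons => /andP [].
have: descendant (Vertex s1) (Vertex sP).
  by rewrite /descendant /level /= prefix_rcons size_rcons eqxx.
rewrite -(treeAut_descendant f) => /andP [_ /eqP ->].
by rewrite IH /level /= size_rcons.
Qed.

HB.instance Definition _ d := gen_eqMixin (treeAut d).
HB.instance Definition _ d := gen_choiceMixin (treeAut d).

Section AutGroup.
Variable d : nat -> nat.
Implicit Types f g h : treeAut d.

Definition treeAut1 : treeAut d := @TreeAut d id (Bijective (frefl _) (frefl _)) erefl
  (fun u v => erefl).

(* As for permutations, [f * g] is first [f], then [g]. *)
Lemma treeAut_mul_subproof f g : [/\ bijective (g \o f), (g \o f) (troot d) = troot d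
  & forall u v, incident ((g \o f) u) ((g \o f) v) = incident u v].
Proof.
split=> [||u v]; first exact: bij_comp (treeAut_bij g) (treeAut_bij f).
  by rewrite /= !treeAut_root.
by rewrite /= !treeAut_incident.
Qed.

Definition treeAut_mul f g : treeAut d :=
  let: And3 b r i := treeAut_mul_subproof f g in TreeAut b r i.

Lemma treeAut_inv_subproof f : exists h : treeAut d, cancel f h /\ cancel h f.
Proof.
have [g fK gK] := treeAut_bij f.
have gr : g (troot d) = troot d by rewrite -[in LHS](treeAut_root f) fK.
have gi u v : incident (g u) (g v) = incident u v.
  by rewrite -(treeAut_incident f) !gK.
by exists (@TreeAut d g (Bijective gK fK) gr gi).
Qed.

Definition treeAut_inv f : treeAut d := sval (cid (treeAut_inv_subproof f)).

Lemma treeAut_mulE f g v : treeAut_mul f g v = g (f v).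
Proof. by rewrite /treeAut_mul; case: treeAut_mul_subproof. Qed.

Lemma treeAut_invK f : cancel f (treeAut_inv f).
Proof. by rewrite /treeAut_inv; case: cid => h []. Qed.

Lemma treeAut_invKV f : cancel (treeAut_inv f) f.
Proof. by rewrite /treeAut_inv; case: cid => h []. Qed.

Lemma treeAut_mulA : associative treeAut_mul.
Proof. by move=> f g h; apply: treeAutP => v; rewrite !treeAut_mulE. Qed.

Lemma treeAut_mul1 : left_id treeAut1 treeAut_mul.
Proof. by move=> f; apply: treeAutP => v; rewrite !treeAut_mulE. Qed.

Lemma treeAut_mulr1 : right_id treeAut1 treeAut_mul.
Proof. by move=> f; apply: treeAutP => v; rewrite !treeAut_mulE. Qed.

Lemma treeAut_mulV : left_inverse treeAut1 treeAut_inv treeAut_mul.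
Proof. by move=> f; apply: treeAutP => v; rewrite !treeAut_mulE /= treeAut_invKV. Qed.

Lemma treeAut_mulrV : right_inverse treeAut1 treeAut_inv treeAut_mul.
Proof. by move=> f; apply: treeAutP => v; rewrite !treeAut_mulE /= treeAut_invK. Qed.

End AutGroup.

HB.instance Definition _ d := isGroup.Build (treeAut d)
  (@treeAut_mulA d) (@treeAut_mul1 d) (@treeAut_mulr1 d) (@treeAut_mulV d) (@treeAut_mulrV d).

Lemma treeAutM d (f g : treeAut d) v : (f * g) v = g (f v).
Proof. exact: treeAut_mulE. Qed.

Lemma treeAut1E d v : (1 : treeAut d) v = v. Proof. by []. Qed.

Lemma treeAutVK d (f : treeAut d) : cancel f (f^-1)%g. Proof. exact: treeAut_invK. Qed.
Lemma treeAutKV d (f : treeAut d) : cancel (f^-1)%g f. Proof. exact: treeAut_invKV. Qed.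

(* The default value 1 of [odflt] is never used, see [labelP]. *)
Definition label d (f : treeAut d) (v : vertex d) : 'S_(d (level v)) :=
  odflt 1 [pick s : 'S_(d (level v)) |
    [forall i, f (child i) == rcons (f v) (s i) :> seq nat]].

Lemma labelP d (f : treeAut d) (v : vertex d) (i : 'I_(d (level v))) :
  f (child i) = rcons (f v) (label f v i) :> seq nat.
Proof.
rewrite /label; case: pickP => [s /forallP /(_ i) /eqP //|no].
have lab (j : 'I_(d (level v))) : exists k : 'I_(d (level v)),
    f (child j) = rcons (f v) k :> seq nat.
  have: descendant v (child j) by apply/descendantP; exists j.
  rewrite -(treeAut_descendant f) => /descendantP [k ->].
  by exists (cast_ord (congr1 d (level_treeAut f v)) k).
pose l j := sval (cid (lab j)).
have lP j : f (child j) = rcons (f v) (l j) :> seq nat.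
  exact: svalP (cid (lab j)).
have l_inj : injective l.
  move=> j k jk; have: f (child j) = f (child k) by apply: val_inj; rewrite /= !lP jk.
  move=> /(bij_inj (treeAut_bij f)) /(congr1 val) /= /rcons_inj [e].
  exact: ord_inj.
have /negP[] := no (perm l_inj).
by apply/forallP => j; rewrite permE lP.
Qed.

Definition iterated_wreath d (K : forall n, {group 'S_(d n)}) : set (treeAut d) :=
  [set f | forall v, label f v \in K (level v)].

Definition is_iterated_wreath_product (d : nat -> nat) (gT : groupType)
    (G : set gT) : Prop :=
  is_subgroup G /\
  exists2 K : forall n, {group 'S_(d n)},
    forall n, [transitive K n, on finset.setTfor 'I_(d n) | 'P] &
    isomorphic G (iterated_wreath K).

Definition finitary d : set (treeAut d) :=
  [set f | finite_set [set v | label f v != 1]].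

Record level_type d n :=
  LevelVertex { level_vertex :> vertex d; level_vertexP : level level_vertex == n }.

HB.instance Definition _ d n := [isSub for @level_vertex d n].
HB.instance Definition _ d n := [Countable of level_type d n by <:].

Section LevelFinite.
Variables (d : nat -> nat) (n : nat).

Let bound := (\max_(i < n) d i)%N.

Definition level_code (v : level_type d n) : {ffun 'I_n -> 'I_bound.+1} :=
  [ffun i : 'I_n => inord (nth 0%N (val v) i)].

Definition level_decode (c : {ffun 'I_n -> 'I_bound.+1}) :
    option (level_type d n) :=
  obind (fun v : vertex d => insub v)
    (insub [seq nat_of_ord (c i) | i <- enum 'I_n]).

Lemma level_codeK : pcancel level_code level_decode.
Proof.
move=> v; rewrite /level_decode.
have -> : [seq nat_of_ord (level_code v i) | i <- enum 'I_n] = val (val v).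
  have sv : size (val v) = n by exact: (eqP (valP v)).
  apply: (@eq_from_nth _ 0%N); first by rewrite size_map size_enum_ord sv.
  move=> i; rewrite size_map size_enum_ord => i_n.
  rewrite (nth_map (Ordinal i_n)) ?size_enum_ord // ffunE nth_enum_ord //.
  rewrite inordK //; apply: leq_trans (leq_bigmax (Ordinal i_n)) => /=.
  apply: ltnW; have /allP := vertexP (val v); apply.
  by rewrite mem_iota sv.
by rewrite valK /= valK.
Qed.

HB.instance Definition _ : isFinite (level_type d n) := PCanIsFinite level_codeK.
End LevelFinite.

Lemma level_act_subproof d n (f : treeAut d) (v : level_type d n) :
  level (f (val v)) == n.
Proof. by rewrite level_treeAut (valP v). Qed.

Definition level_act d n (f : treeAut d) (v : level_type d n) : level_type d n :=
  LevelVertex (level_act_subproof f v).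

Lemma level_act_inj d n (f : treeAut d) : injective (@level_act d n f).
Proof.
move=> u v /(congr1 val) /= /(bij_inj (treeAut_bij f)) uv; exact: val_inj.
Qed.

Definition level_perm d n (f : treeAut d) : {perm level_type d n} :=
  perm (@level_act_inj d n f).

Definition level_image d (G : set (treeAut d)) n : {set {perm level_type d n}} :=
  finset (fun s => `[< exists2 f, G f & s = level_perm n f >]).

(* [treeAut d] is a profinite group in which the stabilizers of the levels are a
   base of open normal subgroups; the quotient by the stabilizer of level [n] is
   the group of permutations induced on that level.  A Sylow pro-p subgroup is a
   closed subgroup whose image in each of these finite quotients is a Sylow
   p-subgroup, that is, a pro-p group whose index is prime to p. *)
Definition congruence_closed d (G : set (treeAut d)) : Prop :=
  forall f : treeAut d,
    (forall n, exists2 g : treeAut d, G g & level_perm n g = level_perm n f) -> G f.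

Definition sylow_pro_p d (p : nat) (S : set (treeAut d)) : Prop :=
  [/\ is_subgroup S, congruence_closed S &
      forall n, p.-Sylow(level_image [set: treeAut d] n) (level_image S n)].

Definition adic (m : nat) : nat -> nat := fun _ => m.

Definition is_p_cycle p (s : 'S_p) : Prop :=
  forall i, porbit s i = finset.setTfor 'I_p.

Definition p_finitary p (s : 'S_p) : set (treeAut (adic p)) :=
  [set f | finitary f /\ forall v, label f v \in <[s]> ].

Lemma is_vertex_adic m w : is_vertex (adic m) w = all (fun x => x < m)%N w.
Proof.
elim/last_ind: w => // w x IH.
by rewrite is_vertex_rcons IH all_rcons andbC.
Qed.

Lemma vcons_subproof m (i : 'I_m) (v : vertex (adic m)) :
  is_vertex (adic m) (nat_of_ord i :: v).
Proof. by rewrite is_vertex_adic /= ltn_ord -is_vertex_adic vertexP. Qed.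

Definition vcons m (i : 'I_m) (v : vertex (adic m)) : vertex (adic m) :=
  Vertex (vcons_subproof i v).

Definition vuncons m (v : vertex (adic m)) : option ('I_m * vertex (adic m)) :=
  if vword v is x :: w then
    obind (fun i => omap (fun u => (i, u)) (insub w)) (insub x)
  else None.

Lemma vuncons_cons m (i : 'I_m) v : vuncons (vcons i v) = Some (i, v).
Proof. by rewrite /vuncons /= valK /= valK. Qed.

Lemma vcons_inj m (i j : 'I_m) u v : vcons i u = vcons j v -> i = j /\ u = v.
Proof. by move=> /(congr1 (@vuncons m)); rewrite !vuncons_cons => -[-> ->]. Qed.

Variant vertex_adic_spec m : vertex (adic m) -> Type :=
  | VertexRoot : vertex_adic_spec (troot (adic m))
  | VertexCons i v : vertex_adic_spec (@vcons m i v).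

Lemma vertex_adicP m (v : vertex (adic m)) : vertex_adic_spec v.
Proof.
case: v => [[|x w] wP].
  rewrite (_ : Vertex wP = troot (adic m)); first by constructor.
  exact: val_inj.
have := wP; rewrite is_vertex_adic /= => /andP [xm]; rewrite -is_vertex_adic => wm.
rewrite (_ : Vertex wP = vcons (Ordinal xm) (Vertex wm)); first by constructor.
exact: val_inj.
Qed.

Lemma level_vcons m (i : 'I_m) v : level (vcons i v) = (level v).+1.
Proof. by []. Qed.

Lemma incident_vcons m (i j : 'I_m) u v :
  incident (vcons i u) (vcons j v) = (i == j) && incident u v.
Proof.
rewrite /incident /descendant !level_vcons !eqSS /= (eq_sym (j : nat)).
by rewrite -!andbA -andb_orr.
Qed.

Lemma incident_root_vcons m (i : 'I_m) u :
  incident (troot _) (vcons i u) = (level u == 0%N).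
Proof. by rewrite /incident /descendant /= orbF. Qed.

Lemma incidentC d (u v : vertex d) : incident u v = incident v u.
Proof. exact: orbC. Qed.

Section WreathRecursion.
Variables (m : nat) (g : 'I_m -> treeAut (adic m)) (s : 'S_m).

Definition wr_fun (v : vertex (adic m)) : vertex (adic m) :=
  if vuncons v is Some (i, u) then vcons (s i) (g i u) else troot _.

Definition wr_inv (v : vertex (adic m)) : vertex (adic m) :=
  if vuncons v is Some (i, u) then vcons (s^-1 i) ((g (s^-1 i))^-1 u)
  else troot _.

Lemma wr_subproof : [/\ bijective wr_fun, wr_fun (troot _) = troot _
  & forall u v, incident (wr_fun u) (wr_fun v) = incident u v].
Proof.
split=> [||u v] //.
- exists wr_inv => v; case: (vertex_adicP v) => [//|i u]; rewrite /wr_fun /wr_inv.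
    by rewrite !vuncons_cons permK treeAutVK.
  by rewrite !vuncons_cons permKV treeAutKV.
- case: (vertex_adicP u) => [|i {}u]; case: (vertex_adicP v) => [//|j {}v];
    rewrite /wr_fun ?vuncons_cons.
  + by rewrite /= !incident_root_vcons level_treeAut.
  + by rewrite /= ![incident (vcons _ _) _]incidentC !incident_root_vcons level_treeAut.
  + rewrite !incident_vcons (inj_eq perm_inj).
    by case: eqP => // ->; rewrite treeAut_incident.
Qed.

(* The automorphism (g_1, ..., g_m)s: [wr g 1] acts as [g i] on the subtree
   hanging from the [i]th vertex of the first level, and is followed by the
   rooted automorphism of [s]; see [wrE]. *)
Definition wr : treeAut (adic m) := let: And3 b r i := wr_subproof in TreeAut b r i.

Lemma wr_root : wr (troot _) = troot _.
Proof. exact: treeAut_root. Qed.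

Lemma wr_vcons i v : wr (vcons i v) = vcons (s i) (g i v).
Proof. by rewrite /wr; case: wr_subproof => * /=; rewrite /wr_fun vuncons_cons. Qed.

End WreathRecursion.

Definition rooted m (s : 'S_m) : treeAut (adic m) := wr (fun=> 1) s.

Lemma wrE m (g : 'I_m -> treeAut (adic m)) s : wr g s = wr g 1 * rooted s.
Proof.
apply: treeAutP => v; rewrite treeAutM /rooted.
by case: (vertex_adicP v) => [|i u]; rewrite ?wr_root // !wr_vcons perm1.
Qed.

(* [rec_aut g s] is the automorphism [f] defined recursively by
   f = (g_1, ..., g_m)s, where the components equal to [None] stand for [f]
   itself; see [rec_autE] and [rec_aut_unique].  It is computed at the vertex
   [v] by unfolding the equation [level v] times. *)
Section RecursiveAutomorphism.
Variables (m : nat) (g : 'I_m -> option (treeAut (adic m))) (s : 'S_m).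

Definition unfold_rec (f : treeAut (adic m)) : treeAut (adic m) :=
  wr (fun i => odflt f (g i)) s.

Definition approx_rec n : treeAut (adic m) := iter n unfold_rec 1.

Lemma approx_rec_stable n k v : (level v <= n)%N -> (level v <= k)%N ->
  approx_rec n v = approx_rec k v.
Proof.
elim: n k v => [|n IH] [|k] v //; case: (vertex_adicP v) => [|i u];
  rewrite ?treeAut_root // ?level_vcons // => un uk.
rewrite /= /unfold_rec !wr_vcons; congr vcons.
by case: (g i) => //=; apply: IH.
Qed.

Lemma rec_aut_subproof : let f v := approx_rec (level v) v in
  [/\ bijective f, f (troot _) = troot _
    & forall u v, incident (f u) (f v) = incident u v].
Proof.
move=> f; split=> [||u v]; last 1 first.
- rewrite -(treeAut_incident (approx_rec (maxn (level u) (level v))) u v).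
  by congr incident; apply: approx_rec_stable; rewrite ?leq_maxl ?leq_maxr.
- exists (fun v => (approx_rec (level v))^-1 v) => v; rewrite /f.
    by rewrite level_treeAut treeAutVK.
  by rewrite level_treeAut treeAutKV.
- by rewrite /f treeAut_root.
Qed.

Definition rec_aut : treeAut (adic m) :=
  let: And3 b r i := rec_aut_subproof in TreeAut b r i.

Lemma rec_autE : rec_aut = wr (fun i => odflt rec_aut (g i)) s.
Proof.
have E v : rec_aut v = approx_rec (level v) v.
  by rewrite /rec_aut; case: rec_aut_subproof.
apply: treeAutP => v; case: (vertex_adicP v) => [|i u]; rewrite ?treeAut_root //.
rewrite E level_vcons /= /unfold_rec !wr_vcons; congr vcons.
by case: (g i) => //=; rewrite E.
Qed.

Lemma rec_aut_unique f : f = wr (fun i => odflt f (g i)) s -> f = rec_aut.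
Proof.
move=> fE; suff E n v : level v = n -> f v = rec_aut v by apply: treeAutP => v; exact: E.
elim: n v => [|n IH] v; case: (vertex_adicP v) => [|i u]; rewrite ?treeAut_root //.
rewrite level_vcons => -[un]; rewrite fE rec_autE !wr_vcons; congr vcons.
by case: (g i) => //=; apply: IH.
Qed.

End RecursiveAutomorphism.

Section Hanoi.
Let x1 : 'I_3 := @Ordinal 3 0 isT.
Let x2 : 'I_3 := @Ordinal 3 1 isT.
Let x3 : 'I_3 := @Ordinal 3 2 isT.

Definition hanoi_a : treeAut (adic 3) :=
  rec_aut (tnth [tuple Some 1; Some 1; None]) (tperm x1 x2).
Definition hanoi_b : treeAut (adic 3) :=
  rec_aut (tnth [tuple Some 1; None; Some 1]) (tperm x1 x3).
Definition hanoi_c : treeAut (adic 3) :=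
  rec_aut (tnth [tuple None; Some 1; Some 1]) (tperm x2 x3).

Lemma hanoiE : [/\
  hanoi_a = wr (tnth [tuple 1; 1; hanoi_a]) (tperm x1 x2),
  hanoi_b = wr (tnth [tuple 1; hanoi_b; 1]) (tperm x1 x3) &
  hanoi_c = wr (tnth [tuple hanoi_c; 1; 1]) (tperm x2 x3)].
Proof.
by split; rewrite [LHS]rec_autE; congr wr; apply: funext => -[[|[|[|//]]] h];
  rewrite !(tnth_nth None) (tnth_nth 1).
Qed.

End Hanoi.

Definition hanoi : set (treeAut (adic 3)) :=
  subgroup_generated [set hanoi_a; hanoi_b; hanoi_c].

Section MultiGGS.
Variable p : nat.

Definition GGS_a : treeAut (adic p) := rooted (perm (@ordS_inj p)).

(* b_e = (a^e_1, ..., a^e_(p-1), b_e): the component [i] is given by [e] when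
   [i < p.-1], and is [b_e] itself when [i = p.-1]. *)
Definition GGS_b (e : 'rV['F_p]_p.-1) : treeAut (adic p) :=
  rec_aut (fun i : 'I_p =>
    omap (fun k : 'I_p.-1 => GGS_a ^+ nat_of_ord (e ord0 k)) (insub (val i))) 1.

Definition multi_GGS (E : {vspace 'rV['F_p]_p.-1}) : set (treeAut (adic p)) :=
  subgroup_generated (GGS_a |` [set GGS_b e | e in [set e | e \in E]]).

Lemma GGS_bE (e : 'rV['F_p]_p.-1) : GGS_b e =
  wr (fun i : 'I_p => if insub (val i) is Some k
                      then GGS_a ^+ nat_of_ord (e ord0 (k : 'I_p.-1))
                      else GGS_b e) 1.
Proof.
rewrite [LHS]rec_autE; congr wr; apply: funext => i.
by case: (insub (val i)).
Qed.

End MultiGGS.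

(* Main.v *)
Require Import Defs.
From HB Require Import structures.
From mathcomp Require Import all_boot all_order all_algebra all_fingroup.
From mathcomp Require Import all_solvable all_classical.
From mathcomp Require Import zify ring.

(** Let x be an automorphism moving the vertex u, let k be the length of the orbit of u,
    and let g be supported on the subtree at u and commute with x^k. The conjugates of g by
    the powers of x commute, so in additive notation [g,_n x] = (x - 1)^n g; as x^k fixes
    all the vectors involved, a telescoping argument shows that (x - 1)^(n+1) g = 0 forces
    k^n (x - 1) g = 0, whence g has finite order dividing k^n, and q^n for any divisor
    q > 1 of k. So x is not left Engel as soon as a suitable g of infinite order, or of order
    coprime to q, exists: if x^k acts on the subtree with infinite order, g is taken to be
    a power of this action, and otherwise one goes down to a vertex whose return map is
    trivial. This covers iterated wreath products, finitary automorphisms and the Hanoi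
    group, where the squares lie in the derived subgroup, over which the group branches.

    For a multi-GGS group, if f has label j on the first level then [f, b_e] has, at the
    vertex where b_e has section b_e, a section of the form f' b_e with f' conjugate to
    a^(-e_(-j)). Scaling e so that -e_(-j) = j, the argument repeats forever and
    [f,_n b_e] is never trivial; a variant for arbitrary labels shows that there are no
    right Engel elements. For left Engel elements, a non-periodic group has elements with
    nonzero label sums on all levels ("odometers"), and branches over its second derived
    subgroup, which has elements of infinite order. By contraction every x has a vertex
    whose return map is trivial, and then the first argument applies, or an odometer z.
    In the latter case, if [h, z] commutes with z then h acts on the boundary, identified
    with Z_p by z, as t |-> eta t + c; but the elements of the group have a bounded number
    of non-trivial sections on each level, so eta = 1 and [h, z] = 1. *)

Set Implicit Arguments.
Unset Strict Implicit.
Unset Printing Implicit Defensive.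

Local Open Scope classical_set_scope.
Local Open Scope group_scope.

(** * Engel words *)

(** Finitary automorphisms have finite order, and this is why q is kept apart from k. With q a prime
    divisor of the return time only one prime must be avoided, and a level of degree at least 3
    offers labels of order 2 and of order 3. When all labels are powers of a p-cycle every order is
    a power of p; the exponent q^n can then only be outgrown by an element chosen after n, so the
    statement concerns bounded left Engel elements. A Sylow pro-p subgroup is not assumed to be the
    standard one: it is conjugated to it by renumbering the descendants of each vertex. In multi-GGS
    groups copies at arbitrary vertices are provided for elements of the second derived subgroup,
    whereas return maps are arbitrary elements, so an odometer cannot simply be copied; its rigidity
    takes the place of the copy. Oddness of p enters through the valuation of (1 + n)^(p^k) - 1 and
    through the invertibility of 2. *)

Section EngelWords.
Variable gT : groupType.
Implicit Types g h x y : gT.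

Lemma engelS g x n : engel g x n.+1 = [~ engel g x n, x].
Proof. by []. Qed.

Lemma engelSr g x n : engel g x n.+1 = engel [~ g, x] x n.
Proof. by rewrite /engel iterSr. Qed.

Lemma engel1g x n : engel 1 x n = 1.
Proof. by elim: n => //= n; rewrite -/(engel _ _ _) => ->; rewrite comm1g. Qed.

Lemma engelJ g x y n : engel (g ^ y) (x ^ y) n = engel g x n ^ y.
Proof. by elim: n => // n IH; rewrite !engelS IH conjRg. Qed.

Lemma commgMl g h x : [~ g * h, x] = [~ g, x] ^ h * [~ h, x].
Proof. by rewrite !commgEl !conjgE !invMg !mulgA !mulgK. Qed.

Lemma commgXr g x r : [~ g, x ^+ r.+1] = [~ g, x ^+ r] * [~ g, x] ^ (x ^+ r).
Proof.
by rewrite !commgEl conjMg conjVg expgS conjgM -mulgA mulVKg.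
Qed.

Lemma commgXr_commute g x r :
  commute [~ g, x] x -> [~ g, x ^+ r] = [~ g, x] ^+ r.
Proof.
move=> c; elim: r => [|r IH]; first by rewrite commg1.
rewrite commgXr IH expgSr; congr (_ * _).
by apply/conjg_fixP/commgP/commuteX.
Qed.

End EngelWords.

(** * Engel identities inside an abelian set stable under conjugation by x *)

Section EngelAbelian.
Variables (gT : groupType) (x : gT) (A : set gT).
Hypothesis A1 : A 1.
Hypothesis AM : forall y z, A y -> A z -> A (y * z).
Hypothesis AV : forall y, A y -> A y^-1.
Hypothesis AJ : forall y, A y -> A (y ^ x).
Hypothesis Aab : forall y z, A y -> A z -> commute y z.

Let AR y : A y -> A [~ y, x].
Proof. by move=> Ay; rewrite commgEl; apply: AM; [apply: AV|apply: AJ]. Qed.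

Lemma engel_abelian_closed g n : A g -> A (engel g x n).
Proof. by move=> Ag; elim: n => // n IH; apply: AR. Qed.
Let AE := engel_abelian_closed.

Lemma engelM_abelian g h n : A g -> A h ->
  engel (g * h) x n = engel g x n * engel h x n.
Proof.
move=> Ag Ah; elim: n => // n IH; rewrite !engelS IH.
move: (engel g x n) (engel h x n) (AE n Ag) (AE n Ah) => y z Ay Az.
have c : commute z^-1 [~ y, x] by apply: Aab; [apply: AV|apply: AR].
by rewrite [in LHS]commgEl conjMg invMg -mulgA (mulgA y^-1) -commgEl mulgA c -mulgA.
Qed.

Lemma engelX_abelian g n k : A g -> engel (g ^+ k) x n = engel g x n ^+ k.
Proof.
move=> Ag; suff H : A (g ^+ k) /\ engel (g ^+ k) x n = engel g x n ^+ k by case: H.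
elim: k => [|k [Ak IH]]; first by rewrite !expg0 engel1g.
by rewrite !expgS engelM_abelian // IH; split=> //; apply: AM.
Qed.

(** In additive notation conjugation by [x] is an operator on [A], and x^r - 1 is a multiple of x -
    1. *)
Lemma engel_pow_abelian g n r : A g -> engel g x n = 1 -> engel g (x ^+ r) n = 1.
Proof.
elim: n g => // n IH g Ag gn; rewrite engelSr.
have AX s : A (g ^ (x ^+ s)).
  elim: s => [|s IHs]; first by rewrite conjg1.
  by rewrite expgSr conjgM; apply: AJ.
apply: IH; first by rewrite commgEl; apply: AM; [apply: AV|apply: AX].
elim: r => [|r IHr]; first by rewrite commg1 engel1g.
have AJX s h : A h -> A (h ^ (x ^+ s)).
  move=> Ah; elim: s => [|s IHs]; first by rewrite conjg1.
  by rewrite expgSr conjgM; apply: AJ.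
have AgX : A [~ g, x ^+ r] by rewrite commgEl; apply: AM; [apply: AV|apply: AX].
rewrite commgXr engelM_abelian ?IHr ?mul1g //; last exact/AJX/AR.
have xJ : x ^ (x ^+ r) = x by apply/conjg_fixP/commgP/commuteX.
by rewrite -[x in engel _ x]xJ engelJ -engelSr gn conj1g.
Qed.

(* If [h'] = engel g x n and h = [h', x] commutes with x, then the product of the
   h ^ x^i telescopes to [h', x^k] = 1, so that h^k = 1: thus replacing g by g^k
   decreases the exponent in the Engel identity. *)
Lemma engel_abelian_exponent g k n :
    (forall y, A y -> commute y (x ^+ k)) -> A g ->
  engel g x n.+1 = 1 -> [~ g ^+ (k ^ n), x] = 1.
Proof.
move=> Ak; elim: n g => [|n IH] g Ag gn //.
rewrite expnS expgnA; apply: IH; first by elim: k {Ak} => // k IH; rewrite expgS; apply: AM.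
rewrite engelX_abelian // engelS -commgXr_commute; last exact/commgP/eqP.
by apply/eqP/commgP/Ak/AE.
Qed.

End EngelAbelian.

(* The first hypothesis makes the bicommutant of the conjugates of g abelian. *)
Lemma engel_commuting_conjugates (gT : groupType) (x g : gT) k q n :
    (forall i, commute g (g ^ (x ^+ i))) -> commute g (x ^+ k) ->
    (0 < k)%N -> (q %| k)%N -> engel g x n = 1 ->
  commute (g ^+ (q ^ n)) (x ^+ (k %/ q)).
Proof.
move=> gg gk k0 qk gn.
pose Z : set gT := [set z | forall i, commute z (g ^ (x ^+ i))].
pose A : set gT := [set y | (forall z, Z z -> commute y z) /\ commute y (x ^+ k)].
have gZ i : Z (g ^ (x ^+ i)).
  have le m l : (m <= l)%N -> commute (g ^ (x ^+ m)) (g ^ (x ^+ l)).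
    move=> /subnKC <-; rewrite addnC expgnDr conjgM.
    by rewrite /commute -!conjMg gg.
  by move=> j; case: (leqP i j) => [/le|/ltnW /le /commute_sym].
have Ag : A g by split=> // z /(_ 0); rewrite conjg1 => /commute_sym.
have A1 : A 1 by split=> *; apply/commute_sym/commute1.
have AM y z : A y -> A z -> A (y * z).
  move=> [yZ yk] [zZ zk]; split=> [w wZ|]; apply/commute_sym/commuteM;
    by apply/commute_sym; auto.
have AV y : A y -> A y^-1.
  by move=> [yZ yk]; split=> [w wZ|]; apply/commute_sym/commuteV/commute_sym; auto.
have AJ y : A y -> A (y ^ x).
  move=> [yZ yk]; split=> [z zZ|]; last first.
    have xk : (x ^+ k) ^ x = x ^+ k.
      by apply/conjg_fixP/commgP/commute_sym/commuteX.
    by rewrite /commute -[x ^+ k]xk -!conjMg yk.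
  rewrite -[z](conjgKV x) /commute -!conjMg; congr (_ ^ _).
  apply: yZ => i; rewrite -[g ^ _](conjgK x) /commute -!conjMg; congr (_ ^ _).
  by rewrite -conjgM -expgSr; apply: zZ.
have Aab y z : A y -> A z -> commute y z.
  move=> [yZ _] [zZ _]; apply: yZ => i; exact: zZ.
have qk' : (x ^+ (k %/ q)) ^+ q = x ^+ k by rewrite -expgnA divnK.
have q0 : (0 < q)%N by rewrite lt0n; apply: contraTneq qk => ->; rewrite dvd0n -lt0n.
have AJX y : A y -> A (y ^ (x ^+ (k %/ q))).
  move=> Ay; elim: (k %/ q)%N => [|s IHs]; first by rewrite conjg1.
  by rewrite expgSr conjgM; apply: AJ.
case: n gn => [|n] gn; first by rewrite /engel /= in gn; rewrite gn expg1n; apply/commute_sym/commute1.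
apply/commgP/eqP; rewrite expnSr expgnA.
(* The exponent identity is applied to [x ^+ (k %/ q)]: its [q]-th power [x ^+ k] centralizes [A],
   so [q] takes the place of [k]. *)
have := @engel_abelian_exponent gT (x ^+ (k %/ q)) A A1 AM AV AJX Aab g q n.
rewrite qk' => /(_ (fun y Ay => Ay.2) Ag) H.
apply/eqP/commgP; apply/commute_sym/commuteX/commute_sym/commgP/eqP/H.
exact: (@engel_pow_abelian gT x A).
Qed.

(** * Automorphisms of spherically homogeneous rooted trees *)

Section Tree.
Variable d : nat -> nat.
Implicit Types (f g x : treeAut d) (u v w : vertex d).

Lemma prefix_eq_size (T : eqType) (s t : seq T) : prefix s t -> size s = size t -> s = t.
Proof. by move=> /prefixP [r ->]; rewrite size_cat; case: r => [|? ?] /=; rewrite ?cats0 //; lia. Qed.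

Lemma prefix_treeAut f u w : prefix (f u) (f w) = prefix u w.
Proof.
have P (h : treeAut d) : forall u' w', prefix u' w' -> prefix (h u') (h w').
  move=> u' [s]; elim/last_ind: s => [|s i IH] sP.
    rewrite [vword (Vertex _)]/= prefixs0 => /eqP u0.
    suff -> : u' = Vertex sP by exact: prefix_refl.
    exact: val_inj.
  rewrite [vword (Vertex _)]/= => us; have [e|ne] := eqVneq (vword u') (rcons s i).
    suff -> : u' = Vertex sP by exact: prefix_refl.
    exact: val_inj.
  have s1 : is_vertex d s by move: (sP); rewrite is_vertex_rcons => /andP [].
  have us' : prefix u' s.
    have /prefixP [r] := us; case/lastP: r => [|r j].
      by rewrite cats0 => e; rewrite e eqxx in ne.
    by rewrite -rcons_cat => /rcons_inj [-> _]; exact: prefix_prefix.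
  apply: prefix_trans (IH s1 us') _.
  have : descendant (Vertex s1) (Vertex sP).
    by rewrite /descendant /level /= prefix_rcons size_rcons eqxx.
  by rewrite -(treeAut_descendant h) => /andP [].
apply/idP/idP => [/(P f^-1)|/P //]; by rewrite !treeAutVK.
Qed.

Lemma treeAut_X f n v : (f ^+ n) v = iter n f v.
Proof. by elim: n => [|n IH]; rewrite ?expg0 // expgSr treeAutM IH. Qed.

Lemma treeAut_fixX f n v : f v = v -> (f ^+ n) v = v.
Proof. by move=> fv; rewrite treeAut_X; elim: n => //= n ->. Qed.

Lemma treeAutJ f g v : (f ^ g) (g v) = g (f v).
Proof. by rewrite conjgE !treeAutM treeAutVK. Qed.

(** The rigid stabilizer of [u] in the full automorphism group. *)
Definition rist u : set (treeAut d) := [set g | forall w, ~~ prefix u w -> g w = w].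

Lemma rist_fix u g : rist u g -> g u = u.
Proof.
move=> gu; apply/eqP; apply/negPn/negP => /eqP ne.
have : ~~ prefix u (g u).
  apply/negP => /prefix_eq_size e; apply: ne.
  apply/val_inj; apply/esym/e; exact/esym/(level_treeAut g u).
by move=> /gu /(bij_inj (treeAut_bij g)).
Qed.

Lemma rist_prefix u g w : rist u g -> prefix u (g w) = prefix u w.
Proof. by move=> gu; rewrite -[in LHS](rist_fix gu) prefix_treeAut. Qed.

Lemma ristM u g h : rist u g -> rist u h -> rist u (g * h).
Proof. by move=> gu hu w uw; rewrite treeAutM gu // hu. Qed.

Lemma ristX u g n : rist u g -> rist u (g ^+ n).
Proof. by move=> gu; elim: n => // n IH; rewrite expgS; apply: ristM. Qed.

Lemma ristJ u g x : rist u g -> rist (x u) (g ^ x).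
Proof.
move=> gu w; rewrite -[w](treeAutKV x) prefix_treeAut => /gu gw.
by rewrite treeAutJ gw.
Qed.

Lemma prefix_comparable (s t r : seq nat) :
  prefix s r -> prefix t r -> (size s <= size t)%N -> prefix s t.
Proof.
rewrite !prefixE => /eqP sr /eqP tr le; rewrite -tr take_takel //.
by rewrite sr.
Qed.

Lemma rist_incomparable u v g h : ~~ prefix u v -> ~~ prefix v u ->
  rist u g -> rist v h -> commute g h.
Proof.
move=> uv vu gu hv; apply: treeAutP => w; rewrite !treeAutM.
have disj (t : seq nat) : prefix u t -> ~~ prefix v t.
  move=> ut; apply/negP => vt.
  case: (leqP (size u) (size v)) => [|/ltnW] le.
    by rewrite (prefix_comparable ut vt le) in uv.
  by rewrite (prefix_comparable vt ut le) in vu.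
have [uw|uw] := boolP (prefix u w).
  by rewrite (hv _ (disj _ uw)) hv // disj // rist_prefix.
rewrite (gu _ uw) gu //; apply/negP => uhw.
have [vw|vw] := boolP (prefix v w); last by rewrite hv // (negPf uw) in uhw.
by have /negP := disj _ uhw; rewrite rist_prefix.
Qed.

Lemma prefix_same_level u v : level u = level v -> prefix u v -> u = v.
Proof. by move=> e /prefix_eq_size p; apply/val_inj/p. Qed.

Lemma rist_disjoint u v g : level u = level v -> u <> v ->
  rist u g -> rist v g -> g = 1.
Proof.
move=> e ne gu gv; apply: treeAutP => w.
have [uw|/gu //] := boolP (prefix u w).
have [vw|/gv //] := boolP (prefix v w).
case: ne; apply: prefix_same_level => //.
by apply: (prefix_comparable uw vw); rewrite -/(level u) e.
Qed.

Lemma level_permX n f k (v : level_type d n) :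
  val ((level_perm n f ^+ k)%g v) = (f ^+ k) (val v).
Proof.
elim: k v => [|k IH] v; first by rewrite expg0 perm1.
by rewrite expgSr permM expgSr treeAutM -IH permE.
Qed.

Lemma period_exists f u : exists2 k, (0 < k)%N &
  (f ^+ k) u = u /\ forall i, (f ^+ i) u = u -> (k %| i)%N.
Proof.
have ex : exists k, (0 < k)%N && ((f ^+ k) u == u).
  exists #[level_perm (level u) f]; rewrite order_gt0 /=.
  have lu : level u == level u by [].
  by have := level_permX f #[level_perm (level u) f] (LevelVertex lu);
    rewrite expg_order perm1 /= => <-.
case: (ex_minnP ex) => k /andP [k0 /eqP ku] kmin; exists k => //; split=> // i iu.
rewrite /dvdn; apply/eqP/eqP/negPn/negP; rewrite -lt0n => r0.
have : (0 < i %% k)%N && ((f ^+ (i %% k)) u == u).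
  rewrite r0 /=; apply/eqP; move: iu.
  rewrite {1}(divn_eq i k) expgnDr treeAutM mulnC expgnA.
  by rewrite (treeAut_fixX _ ku).
by move=> /kmin; rewrite leqNgt ltn_pmod.
Qed.

(** Conjugates of [g] by powers of [x] live on the subtrees at the orbit of [u]: their supports are
    disjoint from that of [g], unless the exponent is a multiple of [k] and the conjugate is [g]. So
    they commute, [g ^+ (q ^ n)] commutes with [x ^+ (k %/ q)], and since the latter moves [u], that
    power of [g] lives on two disjoint subtrees. *)
Lemma engel_rist x g u k q n :
    (0 < k)%N -> (forall i, (x ^+ i) u = u -> (k %| i)%N) ->
    commute g (x ^+ k) -> rist u g -> engel g x n = 1 ->
    (q %| k)%N -> (1 < q)%N ->
  g ^+ (q ^ n) = 1.
Proof.
move=> k0 kmin gk gu gn qk q1.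
have cJ i : commute g (g ^ (x ^+ i)).
  have [iu|iu] := pselect ((x ^+ i) u = u); last first.
    apply: (@rist_incomparable u ((x ^+ i) u)) => //; last exact: ristJ.
      by apply/negP => /prefix_same_level; rewrite level_treeAut => /(_ erefl) /esym.
    by apply/negP => /prefix_same_level; rewrite level_treeAut => /(_ erefl).
  have /dvdnP [j ->] := kmin _ iu.
  suff -> : g ^ (x ^+ (j * k)) = g by exact: commute_refl.
  by apply/conjg_fixP/commgP; rewrite mulnC expgnA; apply: commuteX.
have c := engel_commuting_conjugates cJ gk k0 qk gn.
apply: (@rist_disjoint u ((x ^+ (k %/ q)) u)).
- by rewrite level_treeAut.
- move=> /esym /kmin /dvdn_leq; rewrite divn_gt0 ?(ltnW q1) // dvdn_leq // => /(_ isT).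
  by rewrite leqNgt ltn_Pdiv.
- exact: ristX.
have <- : (g ^+ (q ^ n)) ^ (x ^+ (k %/ q)) = g ^+ (q ^ n) by apply/conjg_fixP/commgP.
exact/ristJ/ristX.
Qed.

End Tree.

(** * Return times and a criterion for the absence of left Engel elements *)

Section TreeAction.
Variable d : nat -> nat.
Implicit Types (f g x : treeAut d) (u v : vertex d).

Lemma size_treeAut f v : size (f v) = size v.
Proof. exact: level_treeAut. Qed.

Lemma fix_prefix f v (w : vertex d) : prefix v w -> f w = w -> f v = v.
Proof.
move=> vw fw; apply: prefix_same_level; first exact: level_treeAut.
apply: (@prefix_comparable _ _ w) => //; first by rewrite -fw prefix_treeAut.
by rewrite size_treeAut.
Qed.

Lemma rist_commute u g f : rist u g -> f u = u ->
  (forall w : vertex d, prefix u w -> g (f w) = f (g w)) -> commute g f.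
Proof.
move=> gu fu gf; apply: treeAutP => w; rewrite !treeAutM.
have [/gf //|uw] := boolP (prefix u w).
by rewrite gu // gu // -fu prefix_treeAut.
Qed.

Lemma engel_rist_torsion x g u k n : x u <> u -> (0 < k)%N -> (x ^+ k) u = u ->
    (forall i, (x ^+ i) u = u -> (k %| i)%N) -> commute g (x ^+ k) -> rist u g ->
  engel g x n = 1 -> exists2 m, (0 < m)%N & g ^+ m = 1.
Proof.
move=> xu k0 ku kmin gk gu gn; exists (k ^ n)%N; first by rewrite expn_gt0 k0.
apply: (engel_rist k0 kmin gk gu gn (dvdnn k)).
by case: k k0 ku {kmin gk gn} => // -[|//] _; rewrite expg1.
Qed.

(** If [x] moves [v], with return time [k], some [g] acts below [v] as a power of [x ^+ k] and
    commutes with it; the Engel identity makes [g] torsion, so the return times below [v] are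
    bounded. Where the return time is maximal the return map is trivial, and it commutes with the
    element of infinite order supported there. The exponent [N] leaves room for groups in which only
    certain powers can be copied. *)
Lemma left_engel_rist_trivial (G : set (treeAut d)) :
    (forall y k, G y -> G (y ^+ k)) ->
    (forall y u, G y -> y u = u -> exists N g, [/\ (0 < N)%N, G g, rist u g
       & forall w : vertex d, prefix u w -> g w = (y ^+ N) w]) ->
    (forall u, exists g, [/\ G g, rist u g & forall n, (0 < n)%N -> g ^+ n <> 1]) ->
  forall x, G x -> (forall g, G g -> exists n, engel g x n = 1) -> x = 1.
Proof.
move=> GX H1 H2 x Gx xE; apply: treeAutP => v; rewrite treeAut1E.
apply: contrapT => xv.
have [k k0 [kv kmin]] := period_exists x v.
have [N [g [N0 Gg gv gx]]] := H1 _ v (GX _ k Gx) kv.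
have gk : commute g (x ^+ k).
  apply: (rist_commute gv kv) => w vw.
  rewrite !gx //; last by rewrite -kv prefix_treeAut.
  by rewrite -!treeAutM -expgS -expgSr.
have [n gn] := xE _ Gg.
have [m m0 gm] := engel_rist_torsion xv k0 kv kmin gk gv gn.
have triv (w : vertex d) : prefix v w -> (x ^+ (k * (N * m))) w = w.
  move=> vw; rewrite expgnA expgnA -[RHS](treeAut1E w) -gm !treeAut_X.
  elim: m {m0 gm} => //= m ->; rewrite -!treeAut_X gx //.
  by rewrite (rist_prefix _ (ristX m gv)).
pose Q j := `[< exists u, [/\ prefix v u, (0 < j)%N, (x ^+ j) u = u
                 & forall i, (x ^+ i) u = u -> (j %| i)%N] >].
have Qk : exists j, Q j by exists k; apply/asboolP; exists v; split=> //; apply: prefix_refl.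
have Qle j : Q j -> (j <= k * (N * m))%N.
  move=> /asboolP [u [vu j0 ju jmin]]; apply: dvdn_leq; first by rewrite !muln_gt0 k0 N0 m0.
  exact/jmin/triv.
case: (ex_maxnP Qk Qle) => j /asboolP [u [vu j0 ju jmin]] jmax.
(* The return time of a vertex below [u] is a multiple of [j], hence equal to [j] by maximality. *)
have trivu (w : vertex d) : prefix u w -> (x ^+ j) w = w.
  move=> uw; have [i i0 [iw imin]] := period_exists x w.
  have ji : (j %| i)%N by apply: jmin; apply: fix_prefix iw.
  suff -> : j = i by [].
  apply/eqP; rewrite eqn_leq (dvdn_leq i0 ji) /=; apply: jmax.
  by apply/asboolP; exists w; split=> //; apply: prefix_trans uw.
have [h [Gh hu hinf]] := H2 u; have [n' hn] := xE _ Gh.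
have xu : x u <> u by move=> /(fix_prefix vu).
have hk : commute h (x ^+ j).
  by apply: (rist_commute hu ju) => w uw; rewrite !trivu // rist_prefix.
by have [i /hinf] := engel_rist_torsion xu j0 ju jmin hk hu hn.
Qed.

(** * Automorphisms with prescribed labels *)

(** Working with plain numbers, fixed outside ['I_m], avoids letters whose type depends on the
    level. *)
Definition perm_nat m (s : 'S_m) (i : nat) : nat :=
  if insub i is Some j then s j : nat else i.

Lemma perm_nat_ord m (s : 'S_m) (i : 'I_m) : perm_nat s i = s i.
Proof. by rewrite /perm_nat valK. Qed.

Lemma perm_nat_lt m (s : 'S_m) i : (i < m)%N -> (perm_nat s i < m)%N.
Proof. by move=> im; rewrite (perm_nat_ord s (Ordinal im)). Qed.

Lemma perm_natK m (s : 'S_m) i : perm_nat s^-1 (perm_nat s i) = i.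
Proof.
rewrite {2}/perm_nat; case: insubP => [j _ <-|im]; first by rewrite perm_nat_ord permK.
by rewrite /perm_nat insubN.
Qed.

Lemma perm_natKV m (s : 'S_m) i : perm_nat s (perm_nat s^-1 i) = i.
Proof. by rewrite -{1}[s]invgK perm_natK. Qed.

Lemma label_uniq f v (s : 'S_(d (level v))) :
  (forall i, f (child i) = rcons (f v) (s i) :> seq nat) -> label f v = s.
Proof.
move=> fs; apply/permP => i; apply: val_inj => /=.
by have := labelP f i; rewrite fs => /rcons_inj [].
Qed.

Section Portrait.
Variable l : forall w : seq nat, 'S_(d (size w)).

(** The label at a word moves the letter that follows it, so the recursion is on the last letter;
    reversed words make it structural. Labels are indexed by the source word, not by its image. *)
Fixpoint portrait_rev (w : seq nat) : seq nat :=
  if w is i :: w' then perm_nat (l (rev w')) i :: portrait_rev w' else [::].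

Definition portrait_word w := rev (portrait_rev (rev w)).

Lemma portrait_word_rcons w i :
  portrait_word (rcons w i) = rcons (portrait_word w) (perm_nat (l w) i).
Proof. by rewrite /portrait_word rev_rcons /= rev_cons revK. Qed.

Lemma size_portrait w : size (portrait_word w) = size w.
Proof. by elim/last_ind: w => // w i IH; rewrite portrait_word_rcons !size_rcons IH. Qed.

Lemma portrait_is_vertex w : is_vertex d w -> is_vertex d (portrait_word w).
Proof.
elim/last_ind: w => // w i IH; rewrite portrait_word_rcons !is_vertex_rcons.
by move=> /andP [/IH -> iw]; rewrite size_portrait perm_nat_lt.
Qed.

Lemma portrait_inj : injective portrait_word.
Proof.
move=> w; elim/last_ind: w => [|w i IH] w'; case/lastP: w' => [|w' i'] //.
- by move/(congr1 size); rewrite !size_portrait size_rcons.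
- by move/(congr1 size); rewrite !size_portrait size_rcons.
rewrite !portrait_word_rcons => /rcons_inj [/IH e]; subst w'.
by move/(congr1 (perm_nat (l w)^-1)); rewrite !perm_natK => ->.
Qed.

Lemma portrait_surj w : is_vertex d w ->
  exists2 w', is_vertex d w' & portrait_word w' = w.
Proof.
elim/last_ind: w => [|w i IH]; first by exists [::].
rewrite is_vertex_rcons => /andP [/IH [w' w'd <-] iw].
exists (rcons w' (perm_nat (l w')^-1 i)).
  by rewrite is_vertex_rcons w'd perm_nat_lt // -size_portrait.
by rewrite portrait_word_rcons perm_natKV.
Qed.

Lemma portrait_take n w : portrait_word (take n w) = take n (portrait_word w).
Proof.
elim/last_ind: w => // w i IH.
have [le|lt] := leqP n (size w).
  rewrite portrait_word_rcons -!cats1 !takel_cat ?IH //.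
  by rewrite size_portrait.
by rewrite !take_oversize // ?size_portrait size_rcons.
Qed.

Lemma portrait_prefix w w' : prefix (portrait_word w) (portrait_word w') = prefix w w'.
Proof.
rewrite !prefixE size_portrait -portrait_take.
by apply/eqP/eqP => [/portrait_inj|->].
Qed.

Definition portrait_fun (v : vertex d) : vertex d :=
  Vertex (portrait_is_vertex (vertexP v)).

Lemma portrait_subproof : [/\ bijective portrait_fun, portrait_fun (troot d) = troot d
  & forall u v, incident (portrait_fun u) (portrait_fun v) = incident u v].
Proof.
split; last 2 first.
- exact: val_inj.
- by move=> u v; rewrite /incident /descendant !portrait_prefix /level /= !size_portrait.
have inv v : exists w, portrait_fun w = v.
  by have [w wd e] := portrait_surj (vertexP v); exists (Vertex wd); apply: val_inj.
exists (fun v => sval (cid (inv v))) => v; last exact: (svalP (cid (inv v))).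
apply/val_inj/portrait_inj.
exact: (congr1 val (svalP (cid (inv (portrait_fun v))))).
Qed.

Definition portrait : treeAut d :=
  let: And3 b r i := portrait_subproof in TreeAut b r i.

Lemma portraitE v : portrait v = portrait_word v :> seq nat.
Proof. by rewrite /portrait; case: portrait_subproof. Qed.

Lemma label_portrait v : label portrait v = l v.
Proof.
apply: label_uniq => i.
by rewrite !portraitE /= portrait_word_rcons perm_nat_ord.
Qed.

Lemma portrait_rist u : (forall w, ~~ prefix u w -> l w = 1) -> rist u portrait.
Proof.
move=> lu [w wd] /= uw; apply: val_inj; rewrite /= portraitE /=.
elim/last_ind: w wd uw => // w k IH wd uw.
have uw' : ~~ prefix u w.
  by apply: contra uw => uw; apply: prefix_trans uw _; rewrite prefix_rcons.
move: wd; rewrite is_vertex_rcons => /andP [wd kd].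
by rewrite portrait_word_rcons IH // lu // (perm_nat_ord 1 (Ordinal kd)) perm1.
Qed.

End Portrait.

Section PathElement.
Variables (u : vertex d) (s : forall n, 'S_(d n)) (i : forall n, 'I_(d n)).
Variable bnd : pred nat.
Hypothesis si : forall n, bnd n -> s n (i n) != i n.

Definition path_word n : seq nat :=
  vword u ++ [seq nat_of_ord (i k) | k <- iota (size u) (n - size u)].

Lemma path_wordS n : (size u <= n)%N -> path_word n.+1 = rcons (path_word n) (i n).
Proof.
move=> un; rewrite /path_word subSn // -addn1 iotaD map_cat catA /=.
by rewrite subnKC // cats1.
Qed.

Lemma size_path n : (size u <= n)%N -> size (path_word n) = n.
Proof. by move=> un; rewrite size_cat size_map size_iota subnKC. Qed.

Lemma path_is_vertex n : is_vertex d (path_word n).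
Proof.
have [/ltnW le|] := ltnP n (size u).
  by rewrite /path_word (eqP le) /= cats0 vertexP.
move=> /subnKC <-; elim: (n - size u)%N => [|k IH].
  by rewrite addn0 /path_word subnn cats0 vertexP.
by rewrite addnS path_wordS ?leq_addr // is_vertex_rcons IH size_path ?leq_addr /=.
Qed.

Definition path_vertex n : vertex d := Vertex (path_is_vertex n).

Definition path_label (w : seq nat) : 'S_(d (size w)) :=
  if [&& (size u <= size w)%N, bnd (size w) & w == path_word (size w)]
  then s (size w) else 1.

(** All non-trivial labels lie on one ray starting at [u], on the levels selected by [bnd].
    Selecting every level gives infinite order, a long finite segment gives a finitary element of
    large order, and the level of [u] alone gives the order of a single label. *)
Definition path_element := portrait path_label.

Lemma path_label_cases v :
  label path_element v = s (level v) \/ label path_element v = 1.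
Proof. by rewrite label_portrait /path_label; case: ifP; [left|right]. Qed.

Lemma path_element_rist : rist u path_element.
Proof.
apply: portrait_rist => w uw; rewrite /path_label ifF //.
apply/negP => /and3P [_ _ /eqP e]; case/negP: uw; rewrite e.
by rewrite /path_word prefix_prefix.
Qed.

Lemma path_element_pow j k (w : vertex d) : bnd (size u) -> vword w = rcons u k ->
  (path_element ^+ j) w = rcons u (perm_nat (s (size u) ^+ j) k) :> seq nat.
Proof.
move=> bu wE; elim: j => [|j IH].
  rewrite !expg0 treeAut1E wE; move: (vertexP w); rewrite wE is_vertex_rcons.
  by move=> /andP [_ kd]; rewrite (perm_nat_ord 1 (Ordinal kd)) perm1.
rewrite expgSr treeAutM portraitE IH portrait_word_rcons -portraitE.
rewrite (rist_fix path_element_rist) /path_label leqnn bu.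
have -> : vword u == path_word (size u) by rewrite /path_word subnn cats0.
rewrite /= expgSr; congr rcons; rewrite {2 3}/perm_nat.
case: insubP => [l kd lE|kd]; first by rewrite perm_nat_ord permM.
by rewrite /perm_nat insubN.
Qed.

Lemma path_element_child v k : is_vertex d (rcons v k) ->
  (size u <= size v)%N -> vword v != path_word (size v) ->
  forall w : vertex d, vword w = rcons v k -> path_element w = rcons (path_element v) k :> seq nat.
Proof.
move=> vk le ne w e; rewrite !portraitE e portrait_word_rcons; congr rcons.
rewrite /path_label (negPf ne) !andbF.
by move: vk; rewrite is_vertex_rcons => /andP [_ kd]; rewrite (perm_nat_ord 1 (Ordinal kd)) perm1.
Qed.

(* The path vertex of depth t moves under the first t powers: between two visits
   of its parent, only the label at the parent acts on its last letter. *)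
Lemma path_element_moves t : (forall k, (k < t)%N -> bnd (size u + k)) ->
  forall j, (0 < j <= t)%N ->
  (path_element ^+ j) (path_vertex (size u + t)) <> path_vertex (size u + t).
Proof.
elim: t => [|t IH] bt j /andP [j0 jt]; first by lia.
move: (IH (fun k kt => bt k (leqW kt))) => {}IH fixj.
set n := (size u + t)%N.
have un : (size u <= n)%N by rewrite leq_addr.
have pn : path_word n.+1 = rcons (path_word n) (i n) by rewrite path_wordS.
have pre : prefix (path_vertex n) (path_vertex (size u + t.+1)).
  by rewrite /= addnS pn prefix_rcons.
have jE : j = t.+1.
  apply/eqP; rewrite eqn_leq jt ltnNge; apply/negP => jt'.
  by apply: (IH j); rewrite ?j0 //; apply: fix_prefix fixj.
have H m : (m <= t)%N -> (path_element ^+ m.+1) (path_vertex n.+1) =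
    rcons ((path_element ^+ m.+1) (path_vertex n)) (s n (i n)) :> seq nat.
  elim: m => [|m IHm] mt.
    rewrite !expg1 !portraitE /= pn portrait_word_rcons; congr rcons.
    rewrite /path_label size_path // un eqxx bt //=.
    by rewrite perm_nat_ord.
  rewrite [_ ^+ _.+2]expgSr !treeAutM.
  move: (IHm (ltnW mt)).
  set a := treeAut_fun (_ ^+ m.+1) (path_vertex n.+1) => aE.
  apply: path_element_child => //.
  - by rewrite -aE vertexP.
  - by rewrite size_treeAut /= size_path.
  - rewrite size_treeAut /= size_path //.
    by apply/negP => /eqP e; apply: (IH m.+1) => //; apply: val_inj.
move: fixj; rewrite jE => /(congr1 val); rewrite /= addnS H // pn.
move=> /rcons_inj [_ /val_inj e].
by have := si (bt t (ltnSn t)); rewrite e eqxx.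
Qed.

Lemma path_element_finitary B : (forall n, bnd n -> (n < B)%N) -> finitary path_element.
Proof.
move=> bB; apply: (@sub_finite_set _ _ [set path_vertex n | n in `I_B]).
  move=> v /= /eqP; rewrite label_portrait /path_label; case: ifP => // /and3P [_ b /eqP e] _.
  by exists (size v); [exact: bB|exact: val_inj].
by apply: finite_image; exact: finite_II.
Qed.

End PathElement.
End TreeAction.

Lemma left_engel_eq1 (gT : groupType) (G : set gT) : G 1 ->
    (forall x, G x -> (forall g, G g -> exists n, engel g x n = 1) -> x = 1) ->
  left_engel G = [set 1].
Proof.
move=> G1 H; apply/seteqP; split=> [x [Gx xE]|x /= ->]; first exact: H.
by split=> // g _; exists 1%N; rewrite /engel /= commg1.
Qed.

(** * Iterated wreath products *)

Section Wreath.
Variables (d : nat -> nat) (hd : forall n, (1 < d n)%N).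
Variable K : forall n, {group 'S_(d n)}.
Implicit Types (f g x : treeAut d) (v : vertex d).

(* [label f v \in K (level v)] in a form that can be transported along
   [level (f v) = level v]. *)
Definition label_in f v n := exists2 s : 'S_(d n), s \in K n &
  forall k (w : vertex d), vword w = rcons v k -> f w = rcons (f v) (perm_nat s k) :> seq nat.

Lemma iterated_wreathP f : iterated_wreath K f <-> forall v, label_in f v (size v).
Proof.
split=> fK v; last first.
  have [s sK H] := fK v; suff -> : label f v = s by [].
  by apply: label_uniq => i; rewrite (H i) // perm_nat_ord.
exists (label f v); first exact: fK.
move=> k w wE; have := vertexP w; rewrite wE is_vertex_rcons => /andP [_ kd].
rewrite (perm_nat_ord _ (Ordinal kd)) -(labelP f) /=; congr (vword (f _)).
exact: val_inj.
Qed.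

Lemma iterated_wreathM f g : iterated_wreath K f -> iterated_wreath K g ->
  iterated_wreath K (f * g).
Proof.
move=> /iterated_wreathP fK /iterated_wreathP gK; apply/iterated_wreathP => v.
have [s sK fs] := fK v; have [t tK gt] := gK (f v); move: t tK gt.
rewrite size_treeAut => t tK gt; pose st : 'S_(d (size v)) := s * t; exists st; first by rewrite groupM.
move=> k w wE; rewrite treeAutM.
rewrite (gt (perm_nat s k)); last exact: fs.
rewrite treeAutM; congr rcons.
have := vertexP w; rewrite wE is_vertex_rcons => /andP [_ kd].
rewrite (perm_nat_ord s (Ordinal kd)) perm_nat_ord.
by rewrite (perm_nat_ord st (Ordinal kd)) permM.
Qed.

Lemma iterated_wreath1 : iterated_wreath K 1.
Proof.
apply/iterated_wreathP => v; exists 1; first exact: group1.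
move=> k w wE; have := vertexP w; rewrite wE is_vertex_rcons => /andP [_ kd].
by rewrite (perm_nat_ord 1 (Ordinal kd)) perm1 treeAut1E.
Qed.

Lemma iterated_wreathX f n : iterated_wreath K f -> iterated_wreath K (f ^+ n).
Proof.
move=> fK; elim: n => [|n IH]; first exact: iterated_wreath1.
by rewrite expgS; apply: iterated_wreathM.
Qed.

Definition label_word f (w : seq nat) : 'S_(d (size w)) :=
  if @idP (is_vertex d w) is ReflectT wd then label f (Vertex wd) else 1.

(** Membership in an iterated wreath product is a condition on each label separately, so erasing the
    labels outside a subtree stays in the group. The result follows [f] below [u] provided that [f]
    fixes [u]. *)
Definition restriction u f :=
  portrait (fun w => if prefix (u : seq nat) w then label_word f w else 1).

Lemma restriction_rist (u : vertex d) f : rist u (restriction u f).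
Proof. by apply: portrait_rist => w /negPf ->. Qed.

Lemma restrictionE (u : vertex d) f : f u = u ->
  forall w : vertex d, prefix u w -> restriction u f w = f w.
Proof.
move=> fu [w wd] /=; elim/last_ind: w wd => [|w k IH] wd uw.
  have -> : Vertex wd = troot d by apply: val_inj.
  by rewrite !treeAut_root.
have wd' : is_vertex d w by move: wd; rewrite is_vertex_rcons => /andP [].
have [uw'|uw'] := boolP (prefix u w); last first.
  suff -> : Vertex wd = u by rewrite fu; apply/rist_fix/restriction_rist.
  have /prefixP [r e] := uw; case/lastP: r e => [|r j].
    by rewrite cats0 => e; apply: val_inj.
  by rewrite -rcons_cat => /rcons_inj [e _]; rewrite e prefix_prefix in uw'.
apply: val_inj; rewrite /= portraitE portrait_word_rcons /= uw'.
have kd : (k < d (size w))%N by move: wd; rewrite is_vertex_rcons => /andP [].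
have -> : label_word f w = label f (Vertex wd').
  rewrite /label_word; case: {-}_ / idP => // wd2.
  by rewrite (bool_irrelevance wd2 wd').
have := labelP f (Ordinal kd : 'I_(d (level (Vertex wd')))).
rewrite -(perm_nat_ord (label f (Vertex wd'))) /= => eq1.
have -> : Vertex wd = child (Ordinal kd : 'I_(d (level (Vertex wd')))) by apply: val_inj.
rewrite eq1 -(IH wd' uw'); congr (rcons _ _).
by rewrite portraitE.
Qed.

Lemma restriction_wreath u f : iterated_wreath K f -> iterated_wreath K (restriction u f).
Proof.
move=> fK v; rewrite label_portrait; case: ifP => _; last exact: group1.
rewrite /label_word; case: {-}_ / idP => [wd|]; last by rewrite vertexP.
exact: (fK (Vertex wd)).
Qed.

Lemma exists_moved n : [transitive K n, on finset.setTfor 'I_(d n) | 'P] ->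
  exists s : 'S_(d n), exists i, s \in K n /\ s i != i.
Proof.
move=> tr; pose i0 := Ordinal (ltnW (hd n)); pose i1 := Ordinal (hd n).
have [s sK e] := atransP2 tr (finset.in_setT i0) (finset.in_setT i1).
exists s, i0; split=> //; apply/eqP => si.
by have := congr1 val (etrans e si).
Qed.

(** Return maps are copied by [restriction], and transitivity supplies on each level a permutation
    that moves a point, from which a ray element of infinite order is built. *)
Lemma wreath_left_engel : (forall n, [transitive K n, on finset.setTfor 'I_(d n) | 'P]) ->
  forall x, iterated_wreath K x ->
    (forall g, iterated_wreath K g -> exists n, engel g x n = 1) -> x = 1.
Proof.
move=> tr; apply: left_engel_rist_trivial => [y k|y u yK yu|u].
- exact: iterated_wreathX.
- exists 1%N, (restriction u y); split=> //; first exact: restriction_wreath.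
    exact: restriction_rist.
  by move=> w uw; rewrite expg1 restrictionE.
pose s n := sval (cid (exists_moved (tr n))).
have [i si] : exists i : forall n, 'I_(d n), forall n, s n \in K n /\ s n (i n) != i n.
  exists (fun n => sval (cid (svalP (cid (exists_moved (tr n)))))) => n.
  exact: (svalP (cid (svalP (cid (exists_moved (tr n)))))).
exists (path_element u s i predT); split=> [v||n n0 gn].
- by case: (path_label_cases u s i predT v) => ->; rewrite ?group1 //; case: (si (level v)).
- exact: path_element_rist.
apply: (@path_element_moves d u s i predT (fun n _ => (si n).2) n (fun _ _ => isT) n).
  by rewrite n0 leqnn.
by rewrite gn.
Qed.

End Wreath.

Lemma iso_morph1 (gT hT : groupType) (G : set gT) (phi : gT -> hT) : is_subgroup G ->
  {in G &, {morph phi : x y / x * y}} -> phi 1 = 1.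
Proof.
move=> [G1 _] phiM; apply: (mulgI (phi 1)).
by rewrite mulg1 -phiM ?mulg1.
Qed.

Lemma iso_engel (gT hT : groupType) (G : set gT) (phi : gT -> hT) : is_subgroup G ->
    {in G &, {morph phi : x y / x * y}} ->
  forall g x n, G g -> G x -> phi (engel g x n) = engel (phi g) (phi x) n.
Proof.
move=> sG phiM g x n Gg Gx.
have phi1 := iso_morph1 sG phiM.
have GV : forall y, G y -> G y^-1.
  by move=> y /mem_set Gy; apply/set_mem; apply: group_closedV sG _ Gy.
have GM : forall y z, G y -> G z -> G (y * z).
  by move=> y z /mem_set Gy /mem_set Gz; apply/set_mem; apply: (group_closedM sG).
have phiV y : G y -> phi y^-1 = (phi y)^-1.
  move=> Gy; apply/esym/mulg1_eq; rewrite -phiM ?mulgV ?inE //; exact: GV.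
have GE : G (engel g x n).
  by elim: n => // n IH; rewrite engelS /commg /conjg; auto 10.
elim: n GE => // n IH _.
have GE : G (engel g x n).
  by elim: n {IH} => // n IH; rewrite engelS /commg /conjg; auto 10.
rewrite !engelS -IH // /commg /conjg.
by rewrite !phiM ?inE ?phiV //; auto 10.
Qed.

Lemma iterated_wreath_product_left_engel (d : nat -> nat) (hd : forall n, (1 < d n)%N)
    (gT : groupType) (G : set gT) :
  is_iterated_wreath_product d G -> left_engel G = [set 1].
Proof.
move=> [sG [K tr [phi phiM [phiG phi_inj phi_surj]]]].
have phi1 := iso_morph1 sG phiM.
have G1 : G 1 by case: sG => + _; rewrite inE.
apply: left_engel_eq1 => // x Gx xE; apply: phi_inj; rewrite ?inE //.
rewrite phi1; apply: (wreath_left_engel hd tr); first exact: phiG.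
move=> _ /phi_surj [g Gg <-]; have [n gn] := xE _ Gg; exists n.
by rewrite -(iso_engel sG phiM) // gn.
Qed.

Lemma setT_iterated_wreath_product d (hd : forall n, (1 < d n)%N) :
  is_iterated_wreath_product d [set: treeAut d].
Proof.
split; first by split=> [|? ? ? ?]; rewrite inE.
exists (fun n => [set: 'S_(d n)]%G) => [n|].
  apply/imsetP; exists (Ordinal (ltnW (hd n))) => //.
  apply/esym/setP => i; rewrite finset.in_setT; apply/orbitP.
  exists (tperm (Ordinal (ltnW (hd n))) i); first by rewrite finset.in_setT.
  exact: tpermL.
exists id => //; split=> // f _; first by move=> v; rewrite finset.in_setT.
Qed.

(** * Finitary automorphisms *)

Section Finitary.
Variables (d : nat -> nat) (hd : forall n, (1 < d n)%N).
Implicit Types (f g x : treeAut d) (v : vertex d).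

Lemma finitary1 : finitary (1 : treeAut d).
Proof.
rewrite /finitary /=; suff -> : [set v | label (1 : treeAut d) v != 1] = set0.
  exact: finite_set0.
apply/seteqP; split=> // v /= /negP []; apply/eqP/label_uniq => i.
by rewrite !treeAut1E perm1.
Qed.

Lemma finitary_rigid f : finitary f -> exists B, forall u w : vertex d, (B <= level u)%N ->
  prefix u w -> f w = f u ++ drop (size u) w :> seq nat.
Proof.
move=> /finite_seqP [s fs]; exists (\max_(v <- s) (level v).+1)%N => u [w wd] Bu /=.
have lab1 v : (level u <= level v)%N -> label f v = 1.
  move=> uv; apply: contrapT => /eqP ne.
  have vs : v \in s by have : [set v | label f v != 1] v by []; rewrite fs.
  have := @leq_bigmax_seq _ s xpredT (fun v => (level v).+1) v vs isT.
  by move=> /leq_trans /(_ Bu) /leq_trans /(_ uv); rewrite ltnn.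
elim/last_ind: w wd => [|w k IH] wd uw.
  have -> : Vertex wd = u by apply: val_inj => /=; case: (vword u) uw.
  by rewrite cats0.
have wd' : is_vertex d w by move: wd; rewrite is_vertex_rcons => /andP [].
have [uw'|uw'] := boolP (prefix u w); last first.
  have -> : Vertex wd = u.
    apply: val_inj => /=; have /prefixP [r e] := uw; case/lastP: r e => [|r j].
      by rewrite cats0.
    by rewrite -rcons_cat => /rcons_inj [e _]; rewrite e prefix_prefix in uw'.
  have /prefixP [r e] := uw; case/lastP: r e => [|r j].
    by rewrite cats0 => ->; rewrite drop_size cats0.
  by rewrite -rcons_cat => /rcons_inj [e _]; rewrite e prefix_prefix in uw'.
have kd : (k < d (size w))%N by move: wd; rewrite is_vertex_rcons => /andP [].
have uwl : (size u <= size w)%N by exact: size_prefix.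
have := labelP f (Ordinal kd : 'I_(d (level (Vertex wd')))).
rewrite lab1 // perm1 /= => e.
have -> : Vertex wd = child (Ordinal kd : 'I_(d (level (Vertex wd')))) by apply: val_inj.
by rewrite e IH //= drop_rcons // rcons_cat.
Qed.

(** Below the finitely many non-trivial labels subtrees are carried rigidly, so return maps are
    trivial and commute with everything supported there. Descendants of a moved vertex are moved,
    whence a suitable [u] on every level from [B] on. *)
Lemma finitary_deep x : finitary x -> x <> 1 ->
  exists B, forall m, (B <= m)%N -> exists u k,
  [/\ size (vword u) = m, x u <> u, (0 < k)%N, (x ^+ k) u = u
    & (forall i, (x ^+ i) u = u -> (k %| i)%N) /\
      forall g, rist u g -> commute g (x ^+ k)].
Proof.
move=> fx x1; have [B xB] := finitary_rigid fx.
have [v xv] : exists v, x v <> v.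
  by apply: contrapT => nx; apply: x1; apply: treeAutP => v; apply: contrapT => xv; apply: nx; exists v.
exists (maxn B (size v)) => m; rewrite geq_max => /andP [Bm vm].
pose u := path_vertex v (fun n => Ordinal (ltnW (hd n))) m.
have um : size u = m by exact: size_path.
have vu : prefix v u by exact: prefix_prefix.
have [k k0 [ku kmin]] := period_exists x u.
exists u, k; split=> //; first by move=> /(fix_prefix vu).
split=> // g gu; apply: (rist_commute gu ku).
have rigid i (w : vertex d) : prefix u w -> (x ^+ i) w = (x ^+ i) u ++ drop (size u) w :> seq nat.
  move=> uw; elim: i => [|i IH].
    by rewrite !expg0; have /prefixP [r ->] := uw; rewrite drop_size_cat.
  rewrite expgSr !treeAutM (@xB ((x ^+ i) u)) ?size_treeAut.
  - by rewrite IH drop_size_cat ?size_treeAut.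
  - by rewrite level_treeAut /level um.
  - by rewrite prefix_treeAut.
have triv (w : vertex d) : prefix u w -> (x ^+ k) w = w.
  by move=> uw; apply: val_inj; rewrite /= rigid // ku; have /prefixP [r ->] := uw; rewrite drop_size_cat.
by move=> w uw; rewrite !triv // rist_prefix.
Qed.

Lemma exists_order r : prime r -> exists s : forall n, 'S_(d n), exists i : forall n, 'I_(d n),
  forall n, (r <= d n)%N -> #[s n] = r /\ s n (i n) != i n.
Proof.
move=> pr.
have H n : exists si : 'S_(d n) * 'I_(d n), (r <= d n)%N -> #[si.1] = r /\ si.1 si.2 != si.2.
  have [rd|rd] := leqP r (d n); last by exists (1, Ordinal (ltnW (hd n))).
  have [s _ sr] : {s : 'S_(d n) | s \in [set: 'S_(d n)]%G & #[s] = r}.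
    by apply: Cauchy => //; rewrite cardsT card_Sn dvdn_fact // prime_gt0 ?rd.
  have [i si] : exists i, s i != i.
    apply: contrapT => ns; have s1 : s = 1.
      by apply/permP => i; rewrite perm1; apply: contrapT => /eqP si; apply: ns; exists i.
    by have := prime_gt1 pr; rewrite -sr s1 order1.
  by exists (s, i).
exists (fun n => (sval (cid (H n))).1), (fun n => (sval (cid (H n))).2) => n.
exact: (svalP (cid (H n))).
Qed.

Lemma finitary_left_engel : infinite_set [set n | (2 < d n)%N] ->
  forall x, finitary x -> (forall g, finitary g -> exists n, engel g x n = 1) -> x = 1.
Proof.
move=> dinf x fx xE; apply: contrapT => x1.
have [B xB] := finitary_deep fx x1.
have [m Bm dm] : exists2 m, (B <= m)%N & (2 < d m)%N.
  apply: contrapT => nm; apply: dinf; apply: sub_finite_set (finite_II B) => m /= dm.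
  by rewrite ltnNge; apply/negP => Bm; apply: nm; exists m.
have [u [k [um xu k0 ku [kmin kc]]]] := xB m Bm.
have k1 : (1 < k)%N by case: k k0 ku {kmin kc} => // -[|//] _; rewrite expg1.
pose q := pdiv k; have pq : prime q by exact: pdiv_prime.
(* A prime other than [q] that still fits on level [m], whose degree is at least 3. *)
pose r := if q == 2%N then 3 else 2%N.
have [pr rq rd] : [/\ prime r, r != q & (r <= d m)%N].
  rewrite /r; case: eqP => [->|/eqP]; first by split.
  by rewrite eq_sym => ->; split=> //; apply: ltnW.
have [s [i si]] := exists_order pr.
have sm n : pred1 m n -> s n (i n) != i n by move=> /eqP ->; case: (si m rd).
pose g := path_element u s i (pred1 m).
have gu : rist u g by exact: path_element_rist.
have [n gn] : exists n, engel g x n = 1.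
  apply: xE; apply: (@path_element_finitary d u s i (pred1 m) m.+1) => n /eqP -> //.
have gq := engel_rist k0 kmin (kc g gu) gu gn (pdiv_dvd k) (prime_gt1 pq).
have sq : s (size u) ^+ (q ^ n) = 1.
  apply/permP => j; apply: val_inj; rewrite perm1 /= -perm_nat_ord.
  have jd : is_vertex d (rcons u j) by rewrite is_vertex_rcons vertexP ltn_ord.
  have := @path_element_pow d u s i (pred1 m) (q ^ n) j (Vertex jd).
  rewrite -/g gq => /(_ (introT eqP um) erefl) /rcons_inj [e].
  by rewrite -e.
have := order_dvdn (s (size u)) (q ^ n); rewrite sq eqxx um; case: (si m rd) => -> _.
rewrite Euclid_dvdX // => /andP [].
by rewrite dvdn_prime2 // (negPf rq).
Qed.

End Finitary.

Lemma p_finitary_bounded_left_engel p (s : 'S_p) : prime p -> is_p_cycle s ->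
  forall x, p_finitary s x ->
  (exists n, forall g, p_finitary s g -> engel g x n = 1) -> x = 1.
Proof.
move=> pr sc x [fx _] [n xE]; apply: contrapT => x1.
have hd m : (1 < adic p m)%N by exact: prime_gt1.
have [B xB] := finitary_deep hd fx x1.
have [u [k [um xu k0 ku [kmin kc]]]] := xB B (leqnn B).
have k1 : (1 < k)%N by case: k k0 ku {kmin kc} => // -[|//] _; rewrite expg1.
pose q := pdiv k; have pq : prime q by exact: pdiv_prime.
pose i0 := Ordinal (prime_gt0 pr).
have si : s i0 != i0.
  apply/eqP => s0; have := sc i0; have -> : porbit s i0 = [set i0]%SET.
    apply/finset.setP => j; rewrite finset.in_set1; apply/porbitP/eqP => [[t ->]|->].
      by elim: t => [|t IH]; rewrite ?perm1 // expgSr permM IH.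
    by exists 0; rewrite perm1.
  move=> /finset.setP /(_ (Ordinal (prime_gt1 pr))).
  by rewrite finset.in_set1 finset.in_setT.
(* The exponent [n] is known before [g] is chosen, so the ray can carry [q ^ n] labels below [u],
   which makes [g ^+ (q ^ n)] non-trivial. *)
pose bnd j := (j < size u + q ^ n)%N.
pose g := path_element (d := adic p) u (fun=> s) (fun=> i0) bnd.
have gu : rist u g by exact: path_element_rist.
have gn : engel g x n = 1.
  apply: xE; split; first by apply: (@path_element_finitary (adic p) u (fun=> s) (fun=> i0) bnd _) => j; exact.
  by move=> v; case: (path_label_cases (d := adic p) u (fun=> s) (fun=> i0) bnd v) => ->; rewrite ?cycle_id ?group1.
have gq := engel_rist k0 kmin (kc g gu) gu gn (pdiv_dvd k) (prime_gt1 pq).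
have mv := @path_element_moves (adic p) u (fun=> s) (fun=> i0) bnd (fun _ _ => si) (q ^ n).
apply: (mv _ (q ^ n)%N); first by move=> j jq; rewrite /bnd ltn_add2l.
  by rewrite leqnn expn_gt0 prime_gt0.
by rewrite -/g gq.
Qed.

(** * Subgroups, their images on levels, and labels on the regular tree *)

Section Subgroup.
Variables (gT : groupType) (G : set gT).
Hypothesis sG : is_subgroup G.

Lemma subgroup1 : G 1.
Proof. by case: sG => + _; rewrite inE. Qed.

Lemma subgroupV x : G x -> G x^-1.
Proof. by move=> /mem_set Gx; apply/set_mem; apply: (group_closedV sG). Qed.

Lemma subgroupM x y : G x -> G y -> G (x * y).
Proof. by move=> /mem_set Gx /mem_set Gy; apply/set_mem; apply: (group_closedM sG). Qed.

Lemma subgroupX x n : G x -> G (x ^+ n).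
Proof.
by move=> Gx; elim: n => [|n IH]; [exact: subgroup1|rewrite expgS; apply: subgroupM].
Qed.

Lemma subgroupJ x y : G x -> G y -> G (x ^ y).
Proof. by move=> Gx Gy; apply: subgroupM; [apply: subgroupV|apply: subgroupM]. Qed.

Lemma subgroupR x y : G x -> G y -> G [~ x, y].
Proof. by move=> Gx Gy; apply: subgroupM; [apply: subgroupV|apply: subgroupJ]. Qed.

End Subgroup.

Lemma is_subgroupI (gT : groupType) (G : set gT) : G 1 -> (forall x, G x -> G x^-1) ->
  (forall x y, G x -> G y -> G (x * y)) -> is_subgroup G.
Proof.
move=> G1 GV GM; split; rewrite ?inE // => x y; rewrite !inE => Gx Gy.
by apply: GM => //; apply: GV.
Qed.

Lemma level_permM d n (f g : treeAut d) :
  level_perm n (f * g) = level_perm n f * level_perm n g.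
Proof. by apply/permP => v; apply: val_inj; rewrite permM !permE /= treeAutM. Qed.

Lemma level_perm1 d n : level_perm n (1 : treeAut d) = 1.
Proof. by apply/permP => v; apply: val_inj; rewrite perm1 permE. Qed.

Lemma level_image_group d (G : set (treeAut d)) n : is_subgroup G ->
  group_set (level_image G n).
Proof.
move=> sG; apply/group_setP; split.
  rewrite finset.inE; apply/asboolP; exists 1; rewrite ?level_perm1 //.
  exact: subgroup1.
move=> s t; rewrite !finset.inE => /asboolP [f Gf ->] /asboolP [g Gg ->].
by apply/asboolP; exists (f * g); rewrite ?level_permM //; apply: subgroupM.
Qed.

Lemma pgroup_elt (gT : finGroupType) (G : {group gT}) p : prime p ->
  (forall x, x \in G -> exists k, x ^+ (p ^ k) = 1) -> p.-group G.
Proof.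
move=> pr H; apply/pgroupP => q pq /(Cauchy pq) [x xG xq].
have [k /eqP] := H x xG; rewrite -order_dvdn xq Euclid_dvdX // dvdn_prime2 // => /andP [/eqP -> _].
by rewrite inE.
Qed.

Section AdicLabels.
Variable m : nat.
Implicit Types (f g : treeAut (adic m)) (v : vertex (adic m)).

Lemma label_adicM f g v :
  label (f * g) v = (label f v : 'S_m) * (label g (f v) : 'S_m) :> 'S_m.
Proof.
apply: (@label_uniq (adic m)) => i; rewrite treeAutM [(f * g) v]treeAutM permM.
rewrite -(labelP g (label f v i : 'I_(adic m (level (f v))))); congr (vword (g _)).
by apply: val_inj; rewrite /= labelP.
Qed.

Lemma label_adic1 v : label (1 : treeAut (adic m)) v = 1.
Proof. by apply: label_uniq => i; rewrite !treeAut1E perm1. Qed.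

Lemma label_adicV f v : label f^-1 (f v) = ((label f v : 'S_m)^-1) :> 'S_m.
Proof.
by apply: (mulgI (label f v : 'S_m)); rewrite -label_adicM mulgV label_adic1 mulgV.
Qed.

Lemma label_adicX f v k : f v = v -> label (f ^+ k) v = (label f v : 'S_m) ^+ k :> 'S_m.
Proof.
move=> fv; elim: k => [|k IH]; first by rewrite label_adic1.
by rewrite !expgS label_adicM fv IH.
Qed.

Lemma adic_wreath_subgroup (K : {group 'S_m}) :
  is_subgroup (iterated_wreath (fun n => K : {group 'S_(adic m n)})).
Proof.
apply: is_subgroupI => [v|f fK v|f g fK gK v]; first by rewrite label_adic1 group1.
- by rewrite -[v](treeAutKV f) label_adicV groupV; exact: (fK (f^-1 v)).
- by rewrite label_adicM groupM; [|exact: (fK v)|exact: (gK (f v))].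
Qed.

End AdicLabels.

Definition rotation m : 'S_m := perm (@ordS_inj m).

Lemma rotationX m k (i : 'I_m) : (rotation m ^+ k)%g i = ((i + k) %% m)%N :> nat.
Proof.
elim: k => [|k IH]; first by rewrite perm1 addn0 modn_small.
by rewrite expgSr permM permE /= IH -addn1 modnDml addn1 addnS.
Qed.

(** * Sylow pro-p subgroups of the p-adic tree *)

Section Sylow.
Variables (p : nat) (pr : prime p).

Lemma rotation_order : #[rotation p] = p.
Proof.
have p0 := prime_gt0 pr.
have : #[rotation p] %| p.
  rewrite order_dvdn; apply/eqP/permP => i; apply: val_inj.
  by rewrite /= rotationX perm1 modnDr modn_small.
move/(prime_nt_dvdP pr); apply; rewrite order_eq1; apply/eqP => e.
have := rotationX 1 (Ordinal p0); rewrite e expg1n perm1 /= add0n modn_small //.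
exact: prime_gt1.
Qed.

Lemma rotation_expp s : s \in <[rotation p]> -> s ^+ p = 1.
Proof.
have := expg_order (rotation p); rewrite rotation_order => e.
by move=> /cycleP [j ->]; rewrite -expgnA mulnC expgnA e expg1n.
Qed.

Lemma rotation_transitive : [transitive <[rotation p]>, on finset.setTfor 'I_p | 'P].
Proof.
apply/imsetP; exists (Ordinal (prime_gt0 pr)) => //.
apply/esym/finset.setP => i; rewrite finset.in_setT; apply/orbitP.
exists (rotation p ^+ i); first exact: mem_cycle.
by apply: val_inj; rewrite /= apermE rotationX /= add0n modn_small.
Qed.

Lemma coprime_fact_prime n : (n < p)%N -> coprime p n`!.
Proof.
elim: n => [|n IH] np; first by rewrite coprimen1.
rewrite factS coprimeMr IH ?(ltnW np) // andbT prime_coprime //.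
by rewrite gtnNdvd.
Qed.

Lemma rotation_Sylow : p.-Sylow([set: 'S_p]%G) <[rotation p]>%G.
Proof.
rewrite pHallE finset.subsetT /= -orderE rotation_order cardsT card_Sn.
case: (p) pr rotation_order coprime_fact_prime => // q prq _ /(_ q (ltnSn q)) cq.
rewrite factS partnM ?fact_gt0 // part_pnat_id ?pnat_id //.
by rewrite part_p'nat ?muln1 // p'natE // -prime_coprime.
Qed.

Definition wreath_rotation : set (treeAut (adic p)) :=
  iterated_wreath (fun n => <[rotation p]>%G : {group 'S_(adic p n)}).

Lemma wreath_rotation_level f n v : wreath_rotation f -> level v = n ->
  (f ^+ (p ^ n)) v = v.
Proof.
move=> fG; have sG := adic_wreath_subgroup <[rotation p]>%G.
elim: n v => [|n IH] [w wd]; rewrite /level /=.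
  by move=> /size0nil w0; subst w; rewrite (_ : Vertex wd = troot _) ?treeAut_root //; apply: val_inj.
case/lastP: w wd => // w k wd; rewrite size_rcons => -[wn].
have [wd' kd] : is_vertex (adic p) w /\ (k < p)%N by move: wd; rewrite is_vertex_rcons => /andP [].
rewrite expnSr expgnA; set h := f ^+ (p ^ n).
have hw : h (Vertex wd') = Vertex wd' by apply: IH.
have -> : Vertex wd = child (Ordinal kd : 'I_(adic p (level (Vertex wd')))) by apply: val_inj.
apply: val_inj; rewrite /= labelP label_adicX //.
have : label h (Vertex wd') \in <[rotation p]> by exact: (subgroupX sG (p ^ n) fG (Vertex wd')).
move=> /rotation_expp ->; rewrite perm1.
by rewrite (treeAut_fixX _ hw).
Qed.

Variable S : set (treeAut (adic p)).
Hypothesis SS : sylow_pro_p p S.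
Let sS : is_subgroup S. Proof. by case: SS. Qed.

Definition stabilizer_labels (v : vertex (adic p)) : {set 'S_p} :=
  finset (fun t : 'S_p => `[< exists f, [/\ S f, f v = v & label f v = t] >]).

Lemma stabilizer_labels_group v : group_set (stabilizer_labels v).
Proof.
apply/group_setP; split.
  rewrite finset.inE; apply/asboolP; exists 1; split=> //; first exact: subgroup1.
  exact: label_adic1.
move=> s t; rewrite !finset.inE => /asboolP [f [Sf fv <-]] /asboolP [g [Sg gv <-]].
apply/asboolP; exists (f * g); split; first exact: subgroupM.
  by rewrite treeAutM fv.
by rewrite label_adicM fv.
Qed.

(** A label at a fixed vertex is part of the action on the next level, where [S] induces a
    p-group. *)
Lemma stabilizer_labels_pgroup v : p.-group (Group (stabilizer_labels_group v)).
Proof.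
apply: pgroup_elt => // t; rewrite finset.inE => /asboolP [f [Sf fv <-]].
pose n := (level v).+1.
have [_ _ /(_ n) /and3P [_ pS _]] := SS.
have : p.-elt (level_perm n f).
  apply: (mem_p_elt (G := Group (level_image_group n sS))) => //.
  by rewrite finset.inE; apply/asboolP; exists f.
move=> /p_natP [k e]; exists k.
have /permP H : level_perm n f ^+ (p ^ k) = 1 by rewrite -e expg_order.
rewrite -label_adicX //; apply: label_uniq => i; rewrite perm1.
rewrite (treeAut_fixX _ fv).
have ln : level (@child (adic p) v i) == n by rewrite /level /= size_rcons.
have := congr1 val (H (LevelVertex ln)); rewrite level_permX perm1 /= => ->.
by [].
Qed.

Lemma stabilizer_labels_conj v : exists s : 'S_p,
  forall t, t \in stabilizer_labels v -> t ^ s \in <[rotation p]>.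
Proof.
have [s _ sub] := Sylow_Jsub rotation_Sylow (finset.subsetT _) (stabilizer_labels_pgroup v).
exists s => t tv; apply: (fintype.subsetP sub); rewrite memJ_conjg.
exact: tv.
Qed.

Let same_orbit v w := `[< exists2 f, S f & f v = w >].

(** [choose] depends only on the extension of a satisfied predicate, so one representative serves a
    whole orbit. *)
Definition orbit_rep v := choose (same_orbit v) v.

Lemma orbit_repP v : exists2 f, S f & f (orbit_rep v) = v.
Proof.
have : same_orbit v (orbit_rep v).
  by apply: chooseP; apply/asboolP; exists 1 => //; exact: subgroup1.
move=> /asboolP [f Sf fv]; exists f^-1; first exact: subgroupV.
by rewrite -fv treeAutVK.
Qed.

Lemma orbit_rep_eq v f : S f -> orbit_rep (f v) = orbit_rep v.
Proof.
move=> Sf; have e : same_orbit (f v) =1 same_orbit v.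
  move=> w; apply/asboolP/asboolP => [[g Sg <-]|[g Sg <-]].
    by exists (f * g); [apply: subgroupM|rewrite treeAutM].
  exists (f^-1 * g); first by apply: subgroupM => //; apply: subgroupV.
  by rewrite treeAutM treeAutVK.
rewrite /orbit_rep (eq_choose e); apply: choose_id.
  by apply/asboolP; exists f.
by apply/asboolP; exists 1 => //; exact: subgroup1.
Qed.

(* Renumbering the descendants of v by this permutation puts the labels of S in
   <rotation>: on orbit representatives it conjugates the labels of the
   stabilizer, and it is transported along a transversal. *)
Definition renumbering_label v : 'S_p :=
  (label (s2val (cid2 (orbit_repP v))) (orbit_rep v) : 'S_p)^-1 *
  sval (cid (stabilizer_labels_conj (orbit_rep v))).

Definition renumbering : treeAut (adic p) :=
  portrait (fun w => if insub w is Some v then renumbering_label v else 1).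

Lemma label_renumbering v : label renumbering v = renumbering_label v.
Proof. by rewrite label_portrait valK. Qed.

Lemma label_conj_renumbering f v : label (f ^ renumbering) (renumbering v) =
  (renumbering_label v)^-1 * (label f v : 'S_p) * renumbering_label (f v) :> 'S_p.
Proof.
by rewrite conjgE !label_adicM label_adicV treeAutVK !label_renumbering !mulgA.
Qed.

Lemma sub_renumbering f : S f -> wreath_rotation (f ^ renumbering).
Proof.
move=> Sf v; rewrite -[v](treeAutKV renumbering); move: (_ v) => {}v.
rewrite label_conj_renumbering /renumbering_label.
case: (cid2 (orbit_repP v)) => /= t St tv.
case: (cid2 (orbit_repP (f v))) => /= t' St'.
rewrite orbit_rep_eq // => tv'.
case: (cid _) => /= s sP.
have lab : (label (t * f * t'^-1) (orbit_rep v) : 'S_p) \in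
    stabilizer_labels (orbit_rep v).
  rewrite finset.inE; apply/asboolP; exists (t * f * t'^-1); split=> //.
    by apply: subgroupM (subgroupV _ _) => //; apply: subgroupM.
  by rewrite !treeAutM tv -tv' treeAutVK.
have := sP _ lab.
suff -> : label (t * f * t'^-1) (orbit_rep v) = (label t (orbit_rep v) : 'S_p) *
   (label f v : 'S_p) * (label t' (orbit_rep v) : 'S_p)^-1 :> 'S_p.
  by rewrite conjgE invMg invgK !mulgA.
by rewrite !label_adicM treeAutM tv -tv' label_adicV.
Qed.

(** On each level the conjugate of the standard group induces a p-group containing the image of [S],
    hence equal to this Sylow subgroup; closedness of [S] lifts the equality from the levels to the
    tree. *)
Lemma sylow_renumbering f : wreath_rotation (f ^ renumbering) -> S f.
Proof.
move=> fG; have [_ closed_S Syl] := SS; apply: closed_S => n.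
pose P := [set f | wreath_rotation (f ^ renumbering)].
have sG := adic_wreath_subgroup <[rotation p]>%G.
have sP : is_subgroup P.
  apply: is_subgroupI => [|x Px|x y Px Py]; rewrite /P /=.
  - by rewrite conj1g; apply: (subgroup1 sG).
  - by rewrite conjVg; apply: (subgroupV sG).
  - by rewrite conjMg; apply: (subgroupM sG).
have pP : p.-group (Group (level_image_group n sP)).
  apply: pgroup_elt => // t; rewrite finset.inE => /asboolP [g Pg ->]; exists n.
  apply/permP => v; apply: val_inj; rewrite level_permX perm1.
  have := @wreath_rotation_level _ n (renumbering (val v)) Pg.
  rewrite level_treeAut (eqP (level_vertexP v)) => /(_ erefl).
  by rewrite -conjXg treeAutJ => /(bij_inj (treeAut_bij _)).
have sub : Group (level_image_group n sS) \subset Group (level_image_group n sP).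
  apply/fintype.subsetP => t; rewrite !finset.inE => /asboolP [g Sg ->].
  by apply/asboolP; exists g => //; apply: sub_renumbering.
have sT : is_subgroup [set: treeAut (adic p)] by apply: is_subgroupI.
have := @sub_pHall _ p (Group (level_image_group n sS)) (Group (level_image_group n sT))
  (Group (level_image_group n sP)) (Syl n) pP sub.
have sub2 : Group (level_image_group n sP) \subset Group (level_image_group n sT).
  apply/fintype.subsetP => t; rewrite !finset.inE => /asboolP [g Sg ->].
  by apply/asboolP; exists g.
move=> /(_ sub2) /= e.
have : level_perm n f \in level_image P n by rewrite finset.inE; apply/asboolP; exists f.
by rewrite e finset.inE => /asboolP [g Sg ->]; exists g.
Qed.

Lemma sylow_iterated_wreath_product : is_iterated_wreath_product (adic p) S.
Proof.
split=> //; exists (fun n => <[rotation p]>%G : {group 'S_(adic p n)}).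
  by move=> n; exact: rotation_transitive.
exists (fun f => f ^ renumbering); first by move=> f g _ _; rewrite conjMg.
split; first exact: sub_renumbering.
  by move=> f g _ _; exact: conjg_inj.
move=> f fG; exists (f ^ renumbering^-1); last by rewrite conjgKV.
by apply: sylow_renumbering; rewrite conjgKV.
Qed.

End Sylow.

(** * Sections of automorphisms of the regular tree *)

Section Sections.
Variable m : nat.
Implicit Types (f g h x y : treeAut (adic m)) (t : 'I_m) (l r : seq 'I_m).

Definition rootperm f : 'S_m := label f (troot (adic m)).

Lemma rootpermP f t v : exists u, f (vcons t v) = vcons (rootperm f t) u.
Proof.
case e: _ / (vertex_adicP (f (vcons t v))) => [|i u].
  by have := level_treeAut f (vcons t v); rewrite e.
exists u; congr vcons; apply: val_inj => /=.
have /= lE := @labelP (adic m) f (troot (adic m)) t.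
have : prefix (f (@child (adic m) (troot (adic m)) t)) (f (vcons t v)).
  by rewrite prefix_treeAut /= eqxx prefix0s.
by rewrite lE treeAut_root e /= => /andP [/eqP /val_inj <-].
Qed.

Definition sec_fun f t (v : vertex (adic m)) : vertex (adic m) :=
  if vuncons (f (vcons t v)) is Some (_, u) then u else v.

Lemma sec_funE f t v : f (vcons t v) = vcons (rootperm f t) (sec_fun f t v).
Proof. by rewrite /sec_fun; have [u ->] := rootpermP f t v; rewrite vuncons_cons. Qed.

Lemma rootpermVK f t : rootperm f^-1 (rootperm f t) = t.
Proof.
have := treeAutVK f (vcons t (troot _)); rewrite !sec_funE => /vcons_inj [-> _] //.
Qed.

Lemma sec_subproof f t : [/\ bijective (sec_fun f t), sec_fun f t (troot _) = troot _
  & forall u v, incident (sec_fun f t u) (sec_fun f t v) = incident u v].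
Proof.
split=> [||u v].
- exists (sec_fun f^-1 (rootperm f t)) => v.
    by have := treeAutVK f (vcons t v); rewrite !sec_funE => /vcons_inj [].
  have := treeAutKV f (vcons (rootperm f t) v).
  by rewrite sec_funE rootpermVK sec_funE => /vcons_inj [].
- apply: level0; have := level_treeAut f (vcons t (troot _)).
  by rewrite sec_funE !level_vcons => -[].
- have := treeAut_incident f (vcons t u) (vcons t v).
  by rewrite !sec_funE !incident_vcons !eqxx.
Qed.

Definition sec f t : treeAut (adic m) :=
  let: And3 b r i := sec_subproof f t in TreeAut b r i.

Lemma secE f t v : f (vcons t v) = vcons (rootperm f t) (sec f t v).
Proof. by rewrite sec_funE /sec; case: sec_subproof. Qed.

Lemma sec_ext f g : rootperm f = rootperm g -> (forall t, sec f t = sec g t) -> f = g.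
Proof.
move=> rE sE; apply: treeAutP => v.
case: (vertex_adicP v) => [|t u]; first by rewrite !treeAut_root.
by rewrite !secE rE sE.
Qed.

Lemma rootperm_uniq f (s : 'S_m) :
  (forall t, exists u, f (vcons t (troot _)) = vcons (s t) u) -> rootperm f = s.
Proof.
move=> fs; apply/permP => t; have [u] := fs t.
by rewrite secE => /vcons_inj [].
Qed.

Lemma rootpermM f g : rootperm (f * g) = rootperm f * rootperm g.
Proof. by rewrite {1}/rootperm label_adicM treeAut_root. Qed.

Lemma rootperm1 : rootperm 1 = 1.
Proof. exact: label_adic1. Qed.

Lemma rootpermV f : rootperm f^-1 = (rootperm f)^-1.
Proof. by apply/esym/mulg1_eq; rewrite -rootpermM mulgV rootperm1. Qed.

Lemma rootpermX f n : rootperm (f ^+ n) = rootperm f ^+ n.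
Proof. by elim: n => [|n IH]; rewrite ?rootperm1 // !expgS rootpermM IH. Qed.

Lemma secM f g t : sec (f * g) t = sec f t * sec g (rootperm f t).
Proof.
apply: treeAutP => v; rewrite treeAutM; have := treeAutM f g (vcons t v).
by rewrite !secE => /vcons_inj [].
Qed.

Lemma sec1 t : sec 1 t = 1.
Proof.
by apply: treeAutP => v; have := secE 1 t v; rewrite !treeAut1E => /vcons_inj [].
Qed.

Lemma secV f t : sec f^-1 t = (sec f ((rootperm f)^-1 t))^-1.
Proof.
apply/esym/mulg1_eq; set t' := (rootperm f)^-1 t.
have -> : t = rootperm f t' by rewrite permKV.
by rewrite -secM mulgV sec1.
Qed.

Lemma rootperm_commr f g : rootperm g = 1 -> rootperm [~ f, g] = 1.
Proof.
by move=> g1; rewrite commgEl conjgE !rootpermM !rootpermV g1 invg1 mulg1 mul1g mulVg.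
Qed.

Lemma sec_fixX f t n : rootperm f t = t -> sec (f ^+ n) t = sec f t ^+ n.
Proof.
move=> ft; elim: n => [|n IH]; first by rewrite sec1.
by rewrite !expgS secM ft IH.
Qed.

Lemma rootperm_wr (g : 'I_m -> treeAut (adic m)) s : rootperm (wr g s) = s.
Proof. by apply: rootperm_uniq => t; exists (g t (troot _)); rewrite wr_vcons. Qed.

Lemma sec_wr (g : 'I_m -> treeAut (adic m)) s t : sec (wr g s) t = g t.
Proof.
by apply: treeAutP => v; have := secE (wr g s) t v; rewrite wr_vcons => /vcons_inj [].
Qed.

(** With a constant alphabet, vertices become words over ['I_m], on which actions and sections are
    structural recursions from the first letter. *)
Definition word_vertex l : vertex (adic m) := foldr (@vcons m) (troot _) l.

Lemma word_vertexE l : word_vertex l = map val l :> seq nat.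
Proof. by elim: l => //= t l ->. Qed.

Lemma word_vertex_inj : injective word_vertex.
Proof.
move=> l r /(congr1 (@vword _)); rewrite !word_vertexE; apply: inj_map; exact: val_inj.
Qed.

Lemma word_vertex_surj v : exists l, v = word_vertex l.
Proof.
case: v; elim=> [|k w IH] wd; first by exists [::]; apply: val_inj.
have := wd; rewrite is_vertex_adic /= => /andP [km].
rewrite -is_vertex_adic => wd'; have [l lE] := IH wd'.
exists (Ordinal km :: l); apply: val_inj => /=.
by rewrite -lE.
Qed.

Fixpoint act f l : seq 'I_m :=
  if l is t :: l' then rootperm f t :: act (sec f t) l' else [::].

Fixpoint secw f l : treeAut (adic m) :=
  if l is t :: l' then secw (sec f t) l' else f.

Lemma act_vertex f l : f (word_vertex l) = word_vertex (act f l).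
Proof. by elim: l f => [|t l IH] f /=; rewrite ?treeAut_root // secE IH. Qed.

Lemma act_ext f g : (forall l, act f l = act g l) -> f = g.
Proof.
move=> fg; apply: treeAutP => v; have [l ->] := word_vertex_surj v.
by rewrite !act_vertex fg.
Qed.

Lemma size_act f l : size (act f l) = size l.
Proof. by elim: l f => //= t l IH f; rewrite IH. Qed.

Lemma act_inj f : injective (act f).
Proof.
move=> l r /(congr1 word_vertex); rewrite -!act_vertex.
by move=> /(bij_inj (treeAut_bij f)) /word_vertex_inj.
Qed.

Lemma actM f g l : act (f * g) l = act g (act f l).
Proof. by apply: word_vertex_inj; rewrite -!act_vertex treeAutM. Qed.

Lemma act1 l : act 1 l = l.
Proof. by apply: word_vertex_inj; rewrite -act_vertex. Qed.

Lemma act_fixX f l n : act f l = l -> act (f ^+ n) l = l.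
Proof. by move=> fl; elim: n => [|n IH]; rewrite ?act1 // expgS actM fl IH. Qed.

Lemma actVK f l : act f^-1 (act f l) = l.
Proof. by rewrite -actM mulgV act1. Qed.

Lemma actKV f l : act f (act f^-1 l) = l.
Proof. by rewrite -actM mulVg act1. Qed.

Lemma act_cat f l r : act f (l ++ r) = act f l ++ act (secw f l) r.
Proof. by elim: l f => //= t l IH f; rewrite IH. Qed.

Lemma secwM f g l : secw (f * g) l = secw f l * secw g (act f l).
Proof. by elim: l f g => //= t l IH f g; rewrite secM IH. Qed.

Lemma secw1 l : secw 1 l = 1.
Proof. by elim: l => //= t l; rewrite sec1. Qed.

Lemma secwV f l : secw f^-1 (act f l) = (secw f l)^-1.
Proof. by apply/esym/mulg1_eq; rewrite -secwM mulgV secw1. Qed.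

Lemma secw_fixX f l n : act f l = l -> secw (f ^+ n) l = secw f l ^+ n.
Proof.
move=> fl; elim: n => [|n IH]; first by rewrite secw1.
by rewrite !expgS secwM fl IH.
Qed.

Lemma secw_fixR f g l : act f l = l -> act g l = l ->
  secw [~ f, g] l = [~ secw f l, secw g l].
Proof.
move=> fl gl; have Vl h : act h l = l -> act h^-1 l = l.
  by move=> hl; rewrite -{1}hl actVK.
have sV h : act h l = l -> secw h^-1 l = (secw h l)^-1.
  by move=> hl; rewrite -{1}hl secwV.
by rewrite commgEl conjgE !secwM ?actM ?Vl ?fl ?gl ?sV // commgEl conjgE.
Qed.

Lemma sec_fixR f g t : rootperm f t = t -> rootperm g t = t ->
  sec [~ f, g] t = [~ sec f t, sec g t].
Proof. by move=> ft gt; apply: (@secw_fixR f g [:: t]); rewrite /= ?ft ?gt. Qed.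

Lemma sec_engel f x t n : rootperm f t = t -> rootperm x t = t ->
  sec (engel f x n) t = engel (sec f t) (sec x t) n.
Proof.
move=> ft xt; suff [] : rootperm (engel f x n) t = t /\
  sec (engel f x n) t = engel (sec f t) (sec x t) n by [].
elim: n => // n [IHt IH]; rewrite !engelS sec_fixR // IH; split=> //.
have Vt (s : 'S_m) : s t = t -> s^-1 t = t by move=> st; rewrite -{1}st permK.
by rewrite commgEl conjgE !rootpermM !permM !rootpermV (Vt _ IHt) (Vt _ xt) IHt xt.
Qed.

Definition at1 t g : treeAut (adic m) := wr (fun i => if i == t then g else 1) 1.

Definition atw l g : treeAut (adic m) := foldr at1 g l.

Lemma rootperm_at1 t g : rootperm (at1 t g) = 1.
Proof. exact: rootperm_wr. Qed.

Lemma sec_at1 t g i : sec (at1 t g) i = if i == t then g else 1.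
Proof. exact: sec_wr. Qed.

Lemma at1M t g h : at1 t (g * h) = at1 t g * at1 t h.
Proof.
apply: sec_ext => [|i]; first by rewrite rootpermM !rootperm_at1 mulg1.
rewrite secM rootperm_at1 perm1 !sec_at1; case: eqP => //; by rewrite mulg1.
Qed.

Lemma at1_1 t : at1 t 1 = 1.
Proof.
apply: sec_ext => [|i]; first by rewrite rootperm_at1 rootperm1.
by rewrite sec_at1 sec1 if_same.
Qed.

Lemma at1V t g : at1 t g^-1 = (at1 t g)^-1.
Proof. by apply/esym/mulg1_eq; rewrite -at1M mulgV at1_1. Qed.

Lemma at1J t g x : at1 t g ^ x = at1 (rootperm x t) (g ^ sec x t).
Proof.
apply: (mulgI x); rewrite conjgE mulgA mulgV mul1g.
apply: sec_ext => [|i]; first by rewrite !rootpermM !rootperm_at1 mulg1 mul1g.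
rewrite !secM rootperm_at1 perm1 !sec_at1 (inj_eq perm_inj).
by case: eqP => [->|_]; rewrite ?mul1g ?mulg1 // conjgE mulgA mulgV mul1g.
Qed.

Lemma atwM l g h : atw l (g * h) = atw l g * atw l h.
Proof. by elim: l => //= t l ->; rewrite at1M. Qed.

Lemma atw1 l : atw l 1 = 1.
Proof. by elim: l => //= t l ->; rewrite at1_1. Qed.

Lemma atwX l g n : atw l (g ^+ n) = atw l g ^+ n.
Proof. by elim: n => [|n IH]; rewrite ?atw1 // !expgS atwM IH. Qed.

Lemma secw_atw l g : secw (atw l g) l = g.
Proof. by elim: l => //= t l IH; rewrite sec_at1 eqxx IH. Qed.

Lemma act_atw l g : act (atw l g) l = l.
Proof. by elim: l => //= t l IH; rewrite rootperm_at1 perm1 sec_at1 eqxx IH. Qed.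

Lemma atw_inj l : injective (atw l).
Proof. by move=> g h /(congr1 (secw^~ l)); rewrite !secw_atw. Qed.

Lemma prefix_word_vertex l r : prefix (word_vertex l) (word_vertex r) = prefix l r.
Proof.
rewrite !word_vertexE; elim: l r => [|t l IH] [|i r] //=.
by rewrite IH.
Qed.

Lemma act_atw_out l g r : ~~ prefix l r -> act (atw l g) r = r.
Proof.
elim: l r => [|t l IH] [|i r] //=; rewrite rootperm_at1 perm1 sec_at1.
case: (eqVneq i t) => [->|ne]; last by rewrite act1.
by rewrite /= => /IH ->.
Qed.

Lemma atw_rist l g : rist (word_vertex l) (atw l g).
Proof.
move=> w; have [r ->] := word_vertex_surj w; rewrite prefix_word_vertex => lr.
by rewrite act_vertex act_atw_out.
Qed.

Lemma atw_commute l g x : act x l = l -> commute g (secw x l) -> commute (atw l g) x.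
Proof.
move=> xl gx; apply: (rist_commute (@atw_rist l g)); first by rewrite act_vertex xl.
move=> w; have [r ->] := word_vertex_surj w; rewrite prefix_word_vertex.
move=> /prefixP [r' ->]; rewrite !act_vertex !(act_cat, act_atw, xl).
by rewrite secw_atw -!actM gx.
Qed.

(** A copy of [g] at [l] commutes with [x ^+ k] as soon as [g] commutes with the return map. *)
Lemma engel_atw_torsion x g l k n : act x l <> l -> (0 < k)%N -> act (x ^+ k) l = l ->
    (forall i, act (x ^+ i) l = l -> (k %| i)%N) -> commute g (secw (x ^+ k) l) ->
  engel (atw l g) x n = 1 -> exists2 j, (0 < j)%N & g ^+ j = 1.
Proof.
move=> xl k0 kl kmin gk gn.
have [|||j j0 gj] := engel_rist_torsion _ k0 _ _ (atw_commute kl gk) (@atw_rist l g) gn.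
- by rewrite act_vertex => /word_vertex_inj.
- by rewrite act_vertex kl.
- by move=> i; rewrite act_vertex => /word_vertex_inj /kmin.
- exists j => //; apply: (@atw_inj l).
  by rewrite atwX gj atw1.
Qed.

End Sections.

(** * Generated subgroups and commutators *)

Section Generated.
Variable gT : groupType.
Implicit Types (A J G : set gT).

Lemma generated_subgroup A : is_subgroup (subgroup_generated A).
Proof.
apply: is_subgroupI => [|x xA|x y xA yA] J [sJ AJ]; first exact: subgroup1.
- by apply: subgroupV => //; apply: xA.
- by apply: subgroupM => //; [apply: xA|apply: yA].
Qed.

Lemma generated_mem A x : A x -> subgroup_generated A x.
Proof. by move=> Ax J [_]; apply. Qed.

Lemma generated_min A J : is_subgroup J -> A `<=` J -> subgroup_generated A `<=` J.
Proof. by move=> sJ AJ x; apply. Qed.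

Lemma generated_ind A (P : gT -> Prop) : P 1 -> (forall x, P x -> P x^-1) ->
    (forall x y, P x -> P y -> P (x * y)) -> (forall x, A x -> P x) ->
  forall x, subgroup_generated A x -> P x.
Proof.
move=> P1 PV PM PA; apply: (@generated_min A P) => //.
exact: (@is_subgroupI _ P).
Qed.

Lemma normal_generated A J : is_subgroup J ->
    (forall j s, J j -> A s -> J (j ^ s)) -> (forall j s, J j -> A s -> J (j ^ s^-1)) ->
  forall j g, J j -> subgroup_generated A g -> J (j ^ g).
Proof.
move=> sJ H HV j g Jj gA; move: j Jj.
suff [] : (forall j, J j -> J (j ^ g)) /\ (forall j, J j -> J (j ^ g^-1)) by [].
elim/generated_ind: g / gA => [|x [Hx HVx]|x y [Hx HVx] [Hy HVy]|s As].
- by split=> j; rewrite ?invg1 conjg1.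
- by split=> // j; rewrite invgK; apply: Hx.
- split=> j Jj; rewrite ?invMg conjgM; first by apply/Hy/Hx.
  by apply/HVx/HVy.
- by split=> j Jj; [apply: H|apply: HV].
Qed.

Lemma commutator_generated A J : is_subgroup J ->
    (forall j g, J j -> subgroup_generated A g -> J (j ^ g)) ->
    (forall s t, A s -> A t -> J [~ s, t]) ->
  forall g h, subgroup_generated A g -> subgroup_generated A h -> J [~ g, h].
Proof.
move=> sJ nJ AJ.
have H c g : subgroup_generated A g -> subgroup_generated A c ->
    (forall s, A s -> J [~ s, c]) -> J [~ g, c].
  move=> gA cA sc.
  suff [] : subgroup_generated A g /\ J [~ g, c] by [].
  have sA := generated_subgroup A.
  elim/generated_ind: g / gA => [|x [xA xJ]|x y [xA xJ] [yA yJ]|s As].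
  - by split; [exact: subgroup1|rewrite comm1g; exact: subgroup1].
  - split; first exact: (subgroupV sA).
    have -> : [~ x^-1, c] = ([~ x, c] ^ x^-1)^-1.
      by rewrite -conjVg invgR !commgEl !conjgE !invgK !mulgA mulgK.
    by apply: subgroupV => //; apply: nJ => //; apply: (subgroupV sA).
  - split; first exact: (subgroupM sA).
    by rewrite commgMl; apply: subgroupM => //; apply: nJ.
  - by split; [exact: generated_mem|exact: sc].
move=> g h gA hA; apply: (H) => // s As.
rewrite -invgR; apply: subgroupV => //; apply: H => //; first exact: generated_mem.
by move=> t At; apply: AJ.
Qed.

Definition derived G := subgroup_generated [set z | exists g h, [/\ G g, G h & z = [~ g, h]]].

Lemma derived_comm G g h : G g -> G h -> derived G [~ g, h].
Proof. by move=> Gg Gh; apply: generated_mem; exists g, h. Qed.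

Lemma derived_subgroup G : is_subgroup (derived G).
Proof. exact: generated_subgroup. Qed.

Lemma derived_min G J : is_subgroup J -> (forall g h, G g -> G h -> J [~ g, h]) ->
  derived G `<=` J.
Proof. by move=> sJ H; apply: generated_min => // _ [g [h [Gg Gh ->]]]; apply: H. Qed.

Lemma derived_sub G : is_subgroup G -> derived G `<=` G.
Proof. by move=> sG; apply: derived_min => // g h; apply: subgroupR. Qed.

Lemma derivedJ G x g : (forall y, G y -> G (y ^ x)) -> derived G g -> derived G (g ^ x).
Proof.
move=> Gx; have sD := derived_subgroup G.
elim/generated_ind: g / => [|y yD|y z yD zD|_ [g [h [Gg Gh ->]]]].
- by rewrite conj1g; exact: (subgroup1 sD).
- by rewrite conjVg; exact: (subgroupV sD).
- by rewrite conjMg; exact: (subgroupM sD).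
- by rewrite conjRg; apply: derived_comm; apply: Gx.
Qed.

End Generated.

(** * The Hanoi Tower group *)

(* A peg indexes both a vertex of the first level and the generator that fixes
   this vertex, which swaps the other two and has itself as section there. *)
Inductive peg := Peg0 | Peg1 | Peg2.

Definition peg_eq (i j : peg) : bool :=
  match i, j with Peg0, Peg0 | Peg1, Peg1 | Peg2, Peg2 => true | _, _ => false end.

Definition peg_swap (i t : peg) : peg :=
  match i, t with
  | Peg0, Peg0 | Peg1, Peg2 | Peg2, Peg1 => Peg0
  | Peg1, Peg1 | Peg0, Peg2 | Peg2, Peg0 => Peg1
  | Peg2, Peg2 | Peg0, Peg1 | Peg1, Peg0 => Peg2
  end.

Definition peg_ord (i : peg) : 'I_3 :=
  match i with Peg0 => @Ordinal 3 0 isT | Peg1 => @Ordinal 3 1 isT | Peg2 => @Ordinal 3 2 isT end.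

Definition hanoi_gen (i : peg) : treeAut (adic 3) :=
  match i with Peg0 => hanoi_c | Peg1 => hanoi_b | Peg2 => hanoi_a end.

Lemma peg_ordP (t : 'I_3) : exists i, t = peg_ord i.
Proof.
by case: t => -[|[|[|//]]] lt3; [exists Peg0|exists Peg1|exists Peg2]; apply: val_inj.
Qed.

Lemma rootperm_gen i t : rootperm (hanoi_gen i) (peg_ord t) = peg_ord (peg_swap i t).
Proof.
case: hanoiE => aE bE cE; case: i; rewrite /hanoi_gen.
- by rewrite cE rootperm_wr; case: t; rewrite /= ?tpermL ?tpermR ?tpermD.
- by rewrite bE rootperm_wr; case: t; rewrite /= ?tpermL ?tpermR ?tpermD.
- by rewrite aE rootperm_wr; case: t; rewrite /= ?tpermL ?tpermR ?tpermD.
Qed.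

Lemma sec_gen i t : sec (hanoi_gen i) (peg_ord t) = if peg_eq i t then hanoi_gen i else 1.
Proof.
case: hanoiE => aE bE cE; case: i; rewrite /hanoi_gen.
- by rewrite {1}cE sec_wr; case: t.
- by rewrite {1}bE sec_wr; case: t.
- by rewrite {1}aE sec_wr; case: t.
Qed.

Lemma peg_eqP i j : peg_eq i j -> i = j. Proof. by case: i; case: j. Qed.

Lemma hanoi_genK i : hanoi_gen i * hanoi_gen i = 1.
Proof.
apply: act_ext => l; rewrite act1 actM; elim: l => //= t l IH.
have [j ->] := peg_ordP t; rewrite !rootperm_gen !sec_gen; congr (_ :: _).
  by case: i {IH}; case: j.
case: (boolP (peg_eq i j)) => [/peg_eqP ij|ne].
  subst j; have -> : peg_swap i i = i by case: i {IH}.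
  by have -> : peg_eq i i by case: i {IH}.
have -> : peg_eq i (peg_swap i j) = false by case: i j ne {IH} => -[].
by rewrite !act1.
Qed.

Lemma hanoi_genV i : (hanoi_gen i)^-1 = hanoi_gen i.
Proof. exact/mulg1_eq/hanoi_genK. Qed.

Definition eval (w : seq peg) : treeAut (adic 3) :=
  foldr (fun i g => hanoi_gen i * g) 1 w.

Lemma eval_cat w w' : eval (w ++ w') = eval w * eval w'.
Proof. by elim: w => [|i w IH] /=; rewrite ?mul1g // IH mulgA. Qed.

(** Symbolic counterparts of [rootperm] and [sec]: together with [reduce] they let identities of the
    group be checked by computation. *)
Fixpoint word_act (w : seq peg) (t : peg) : peg :=
  if w is i :: w' then word_act w' (peg_swap i t) else t.

Fixpoint word_sec (w : seq peg) (t : peg) : seq peg :=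
  if w is i :: w' then (if peg_eq i t then [:: i] else [::]) ++ word_sec w' (peg_swap i t)
  else [::].

Definition push i (w : seq peg) : seq peg :=
  if w is j :: w' then if peg_eq i j then w' else i :: w else [:: i].

Definition reduce w := foldr push [::] w.

Lemma eval_reduce w : eval (reduce w) = eval w.
Proof.
elim: w => //= i w <-; case: (reduce w) => //= j w'.
case: (boolP (peg_eq i j)) => [/peg_eqP ->|//].
by rewrite mulgA hanoi_genK mul1g.
Qed.

Lemma rootperm_eval w t : rootperm (eval w) (peg_ord t) = peg_ord (word_act w t).
Proof.
elim: w t => [|i w IH] t /=; first by rewrite rootperm1 perm1.
by rewrite rootpermM permM rootperm_gen IH.
Qed.

Lemma sec_eval w t : sec (eval w) (peg_ord t) = eval (word_sec w t).
Proof.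
elim: w t => [|i w IH] t /=; first by rewrite sec1.
by rewrite secM rootperm_gen IH sec_gen eval_cat; case: ifP => _ /=; rewrite ?mulg1.
Qed.

Lemma eval_at1 w w' : (forall t, word_act w t = t) ->
    reduce (word_sec w Peg0) = reduce w' -> reduce (word_sec w Peg1) = [::] ->
    reduce (word_sec w Peg2) = [::] ->
  eval w = at1 (peg_ord Peg0) (eval w').
Proof.
move=> aE s0 s1 s2; apply: sec_ext => [|t].
  by apply/permP => t; have [i ->] := peg_ordP t; rewrite rootperm_at1 perm1 rootperm_eval aE.
have [i ->] := peg_ordP t; rewrite sec_eval sec_at1 -eval_reduce.
by case: i; rewrite ?s0 ?s1 ?s2 ?eval_reduce.
Qed.

Lemma evalV w : (eval w)^-1 = eval (rev w).
Proof.
elim: w => [|i w IH]; first by rewrite invg1.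
by rewrite rev_cons -cats1 eval_cat -IH /= mulg1 invMg hanoi_genV.
Qed.

Lemma eval_comm w w' : [~ eval w, eval w'] = eval (rev w ++ rev w' ++ w ++ w').
Proof. by rewrite commgEl conjgE !evalV -!eval_cat. Qed.

Lemma gen_comm i j : [~ hanoi_gen i, hanoi_gen j] = eval [:: i; j; i; j].
Proof. by have := eval_comm [:: i] [:: j]; rewrite /= !mulg1. Qed.

Section HanoiGroup.

Let a := Peg2. Let b := Peg1. Let c := Peg0.

Lemma hanoi_subgroup : is_subgroup hanoi.
Proof. exact: generated_subgroup. Qed.
Let sH := hanoi_subgroup.

Lemma hanoi_gen_mem i : hanoi (hanoi_gen i).
Proof. by apply: generated_mem; case: i => /=; [right|left; right|left; left]. Qed.

Lemma hanoi_ind (P : treeAut (adic 3) -> Prop) : P 1 -> (forall x, P x -> P x^-1) ->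
    (forall x y, P x -> P y -> P (x * y)) -> (forall i, P (hanoi_gen i)) ->
  forall x, hanoi x -> P x.
Proof.
move=> P1 PV PM Pg; apply: generated_ind => // x [[]|] ->.
- exact: (Pg Peg2).
- exact: (Pg Peg1).
- exact: (Pg Peg0).
Qed.

Lemma hanoi_eval w : hanoi (eval w).
Proof.
elim: w => [|i w IH] /=; first exact: (subgroup1 sH).
by apply: (subgroupM sH) => //; apply: hanoi_gen_mem.
Qed.

Lemma hanoi_sec x t : hanoi x -> hanoi (sec x t).
Proof.
move=> Hx; elim/hanoi_ind: x / Hx t => [t|x IH t|x y IHx IHy t|i t].
- by rewrite sec1; exact: (subgroup1 sH).
- by rewrite secV; exact: (subgroupV sH).
- by rewrite secM; exact: (subgroupM sH).
- have [j ->] := peg_ordP t; rewrite sec_gen; case: ifP => _; last exact: (subgroup1 sH).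
  exact: hanoi_gen_mem.
Qed.

Let D := derived hanoi.
Let sD : is_subgroup D. Proof. exact: derived_subgroup. Qed.

Let DJ x g : hanoi x -> D g -> D (g ^ x).
Proof. by move=> Hx; apply: derivedJ => y Hy; apply: (subgroupJ sH). Qed.

Lemma hanoi_square x : hanoi x -> D (x ^+ 2).
Proof.
move=> Hx; suff [] : hanoi x /\ D (x ^+ 2) by [].
elim/hanoi_ind: x / Hx => [|x [Hx Dx]|x y [Hx Dx] [Hy Dy]|i].
- by split; [exact: (subgroup1 sH)|rewrite expg1n; exact: (subgroup1 sD)].
- by split; [exact: (subgroupV sH)|rewrite expVgn; exact: (subgroupV sD)].
- split; first exact: (subgroupM sH).
  have -> : (x * y) ^+ 2 = x ^+ 2 * [~ x, y^-1] * y ^+ 2.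
    by rewrite !expg2 commgEl conjgE invgK !mulgA mulgK mulgVK.
  apply: (subgroupM sD) => //; apply: (subgroupM sD) => //.
  by apply: derived_comm => //; apply: (subgroupV sH).
- by split; [exact: hanoi_gen_mem|rewrite expg2 hanoi_genK; exact: (subgroup1 sD)].
Qed.

(** The elements whose copy at the first vertex lies in [D] form a subgroup normalized by the
    generators, because each generator is the section of an element fixing that vertex. It remains
    to copy three commutators of generators; explicit words do it, which lie in [D] as squares or
    products of commutators. *)
Lemma derived_hanoi_at_peg0 g : D g -> D (at1 (peg_ord Peg0) g).
Proof.
set t0 := peg_ord Peg0.
pose J := [set g | D (at1 t0 g)].
have sJ : is_subgroup J.
  apply: is_subgroupI => [|x Jx|x y Jx Jy]; rewrite /J /=.
  - by rewrite at1_1; exact: (subgroup1 sD).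
  - by rewrite at1V; exact: (subgroupV sD).
  - by rewrite at1M; exact: (subgroupM sD).
have stab i : exists2 x, hanoi x & rootperm x t0 = t0 /\ sec x t0 = hanoi_gen i.
  pose w := if i is Peg0 then [:: c] else if i is Peg1 then [:: a; b; a] else [:: b; a; b].
  exists (eval w); first exact: hanoi_eval.
  rewrite /t0 rootperm_eval sec_eval -[eval (word_sec _ _)]eval_reduce /w.
  by case: i {w} => /=; rewrite mulg1.
have JJ j i : J j -> J (j ^ hanoi_gen i).
  move=> Jj; have [x Hx [xt xs]] := stab i.
  by rewrite /J /= -xs -[t0 in at1 t0]xt -at1J; apply: DJ.
have comm_word w w' : D (eval w) -> (forall t, word_act w t = t) ->
    reduce (word_sec w Peg0) = reduce w' -> reduce (word_sec w Peg1) = [::] ->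
    reduce (word_sec w Peg2) = [::] -> J (eval w').
  by move=> Dw w1 w2 w3 w4; rewrite /J /= -(eval_at1 w1 w2 w3 w4).
have Jbc : J [~ hanoi_gen b, hanoi_gen c].
  rewrite gen_comm; apply: (comm_word [:: a; b; a; c; a; b; a; c]) => //; last by case.
  have -> : eval [:: a; b; a; c; a; b; a; c] = eval [:: a; b; a; c] ^+ 2 by rewrite expg2 -eval_cat.
  by apply: hanoi_square; apply: hanoi_eval.
have Jac : J [~ hanoi_gen a, hanoi_gen c].
  rewrite gen_comm; apply: (comm_word [:: b; a; b; c; b; a; b; c]) => //; last by case.
  have -> : eval [:: b; a; b; c; b; a; b; c] = eval [:: b; a; b; c] ^+ 2 by rewrite expg2 -eval_cat.
  by apply: hanoi_square; apply: hanoi_eval.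
have Jba : J [~ hanoi_gen b, hanoi_gen a].
  rewrite gen_comm; apply: (comm_word [:: a; b; c; a; c; b; c; a; c; a]) => //; last by case.
  have -> : eval [:: a; b; c; a; c; b; c; a; c; a] =
      [~ eval [:: a], eval [:: c; b]] * [~ eval [:: c], eval [:: a]].
    by rewrite !eval_comm -eval_cat.
  by apply: (subgroupM sD); apply: derived_comm; apply: hanoi_eval.
have flip i j : J [~ hanoi_gen i, hanoi_gen j] -> J [~ hanoi_gen j, hanoi_gen i].
  by move=> Jij; rewrite -invgR; apply: (subgroupV sJ).
have Jgen i j : J [~ hanoi_gen i, hanoi_gen j].
  move: Jbc Jac Jba flip; generalize hanoi_gen => h Jbc Jac Jba flip.
  have J1 := subgroup1 sJ.
  by case: i; case: j; rewrite ?commgg; auto.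
have genP s : [set hanoi_a; hanoi_b; hanoi_c] s -> exists i, s = hanoi_gen i.
  by move=> [[]|] ->; [exists Peg2|exists Peg1|exists Peg0].
move=> Dg; apply: (derived_min sJ) Dg; apply: commutator_generated => //.
- move=> j y Jj; apply: (normal_generated sJ) Jj => {}j s Jj /genP [i ->].
    exact: JJ.
  by rewrite hanoi_genV; exact: JJ.
- by move=> s t /genP [i ->] /genP [j ->].
Qed.

Lemma derived_hanoi_at l g : D g -> D (atw l g).
Proof.
move=> Dg; elim: l => //= t l; move: (atw l g) => {g Dg l} g Dg.
(* Conjugation by an element with trivial section at the first vertex moves the copy unchanged to
   [t]. *)
have : exists2 x, hanoi x & rootperm x (peg_ord Peg0) = t /\ sec x (peg_ord Peg0) = 1.
  have [i ->] := peg_ordP t.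
  exists (eval (if i is Peg1 then [:: a] else if i is Peg2 then [:: b] else [::])).
    exact: hanoi_eval.
  by rewrite rootperm_eval sec_eval; case: i.
move=> [x Hx [<- x1]]; have := at1J (peg_ord Peg0) g x; rewrite x1 conjg1 => <-.
by apply: DJ => //; apply: derived_hanoi_at_peg0.
Qed.

(** Descent on [n]: the product acts on the first level as a 3-cycle, so 3 divides [n], and a
    section of its cube is conjugate to the product itself. *)
Lemma hanoi_ab_order n : (0 < n)%N -> eval [:: a; b] ^+ n <> 1.
Proof.
set g := eval _; elim/ltn_ind: n => n IH n0 gn.
have X k : g ^+ k = eval (flatten (nseq k [:: a; b])).
  by elim: k => //= k IHk; rewrite expgS IHk /g /= mulg1 !mulgA.
have g3 k : rootperm (g ^+ (3 * k)) = 1.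
  rewrite expgnA rootpermX; suff -> : rootperm (g ^+ 3) = 1 by rewrite expg1n.
  by apply/permP => t; have [i ->] := peg_ordP t; rewrite X rootperm_eval perm1; case: i.
have n3 : n = (3 * (n %/ 3))%N.
  have := divn_eq n 3; rewrite mulnC.
  have := congr1 (fun f => rootperm f (peg_ord Peg0)) gn.
  rewrite {1}(divn_eq n 3) mulnC expgnDr rootpermM permM g3 perm1 rootperm1 perm1 X rootperm_eval.
  by case: (n %% 3)%N (ltn_pmod n (isT : 0 < 3)%N) => [|[|[|]]] //=; rewrite addn0.
apply: (IH (n %/ 3)%N); [by lia|by lia|].
have gE : sec (g ^+ 3) (peg_ord Peg0) = g ^ eval [:: a].
  by rewrite X sec_eval conjgE evalV -!eval_cat -[LHS]eval_reduce -[RHS]eval_reduce.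
have r3 : rootperm (g ^+ 3) (peg_ord Peg0) = peg_ord Peg0.
  by rewrite (g3 1%N) perm1.
have : sec (g ^+ n) (peg_ord Peg0) = 1 by rewrite gn sec1.
rewrite {1}n3 expgnA (sec_fixX _ r3) gE -conjXg => /eqP.
by rewrite conjg_eq1 => /eqP.
Qed.

Lemma hanoi_left_engel : left_engel hanoi = [set 1].
Proof.
apply: left_engel_eq1; first exact: (subgroup1 sH).
apply: left_engel_rist_trivial => [y k|y u Hy|u].
- exact: (subgroupX sH).
- have [l ->] := word_vertex_surj u; rewrite act_vertex => /word_vertex_inj yl.
  have Hz : hanoi (secw y l).
    by elim: l y {yl} Hy => //= t l IH y Hy; apply: IH; apply: hanoi_sec.
  (* The square of the return map lies in the derived subgroup, whose elements can be copied at any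
     vertex. *)
  exists 2, (atw l (secw y l ^+ 2)); split=> //.
  + by apply: (derived_sub sH); apply: derived_hanoi_at; apply: hanoi_square.
  + exact: atw_rist.
  + move=> w; have [r ->] := word_vertex_surj w; rewrite prefix_word_vertex => /prefixP [r' ->].
    by rewrite !act_vertex !act_cat act_atw secw_atw (act_fixX _ yl) (secw_fixX _ yl).
- have [l ->] := word_vertex_surj u; exists (atw l (eval [:: a; b] ^+ 2)); split.
  + by apply: (derived_sub sH); apply: derived_hanoi_at; apply: hanoi_square; apply: hanoi_eval.
  + exact: atw_rist.
  + move=> n n0; rewrite -atwX -(atw1 l) => /atw_inj; rewrite -expgnA.
    by apply: hanoi_ab_order; rewrite muln_gt0.
Qed.

End HanoiGroup.

(** * Multi-GGS groups *)

Section Rotating.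
Variables (p : nat) (pr : prime p).
Implicit Types (f g x : treeAut (adic p)) (i j t : 'F_p).

Lemma Fp_lt t : (t < p)%N.
Proof. by rewrite -[X in (_ < X)%N](Fp_cast pr). Qed.

(* The components of the GGS generators are indexed cyclically by [1, ..., p = 0],
   whereas the vertices of the first level are numbered from 0. *)
Definition vtx t : 'I_p := Ordinal (Fp_lt (t - 1)%R).

Definition idx (k : 'I_p) : 'F_p := (k%:R + 1)%R.

Lemma Fp_natK t : ((t : nat)%:R = t)%R.
Proof. by apply: val_inj; rewrite [LHS](val_Fp_nat pr) modn_small // Fp_lt. Qed.

Lemma vtxK : cancel vtx idx.
Proof. by move=> t; rewrite /idx Fp_natK GRing.subrK. Qed.

Lemma idxK : cancel idx vtx.
Proof.
move=> k; apply: val_inj; change (nat_of_ord (idx k - 1)%R = k).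
by rewrite /idx GRing.addrK (val_Fp_nat pr) modn_small.
Qed.

Lemma vtx_inj : injective vtx. Proof. exact: can_inj vtxK. Qed.

Lemma vtx_surj k : exists t, k = vtx t.
Proof. by exists (idx k); rewrite idxK. Qed.

Definition rotates_by f i := forall t, rootperm f (vtx t) = vtx (t + i)%R.
Definition lab f : 'F_p := idx (rootperm f (vtx 0%R)).
Definition rotating f := rotates_by f (lab f).

Lemma rotates_by_lab f i : rotates_by f i -> lab f = i.
Proof. by move=> fi; rewrite /lab fi vtxK GRing.add0r. Qed.

Lemma rotates_byP f i : rotates_by f i -> rotating f.
Proof. by move=> fi; rewrite /rotating (rotates_by_lab fi). Qed.

Lemma rotates_byM f g i j : rotates_by f i -> rotates_by g j -> rotates_by (f * g) (i + j)%R.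
Proof. by move=> fi gj t; rewrite rootpermM permM fi gj GRing.addrA. Qed.

Lemma rotates_by1 : rotates_by 1 0%R.
Proof. by move=> t; rewrite rootperm1 perm1 GRing.addr0. Qed.

Lemma rotates_byV f i : rotates_by f i -> rotates_by f^-1 (- i)%R.
Proof.
move=> fi t; rewrite rootpermV; apply: (@perm_inj _ (rootperm f)).
by rewrite permKV fi GRing.subrK.
Qed.

Lemma labM f g : rotating f -> rotating g -> lab (f * g) = (lab f + lab g)%R.
Proof. by move=> ff gg; apply/rotates_by_lab/rotates_byM. Qed.

Lemma lab1 : lab 1 = 0%R. Proof. exact/rotates_by_lab/rotates_by1. Qed.

Lemma rotatingX f n : rotating f -> rotates_by (f ^+ n) (lab f *+ n)%R.
Proof.
move=> ff; elim: n => [|n IH]; first exact: rotates_by1.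
by rewrite expgS GRing.mulrS; apply: rotates_byM.
Qed.

Lemma lab_eq0 f : rotating f -> lab f = 0%R -> rootperm f = 1.
Proof.
move=> ff f0; apply/permP => k; have [t ->] := vtx_surj k.
by rewrite ff f0 GRing.addr0 perm1.
Qed.

Definition all_rotating f := forall l, rotating (secw f l).

Lemma all_rotating_root f : all_rotating f -> rotating f.
Proof. by move=> /(_ [::]). Qed.

Lemma all_rotating_sec f k : all_rotating f -> all_rotating (sec f k).
Proof. by move=> fr l; have := fr (k :: l). Qed.

Lemma all_rotatingM f g : all_rotating f -> all_rotating g -> all_rotating (f * g).
Proof. by move=> fr gr l; rewrite secwM; apply: rotates_byP (rotates_byM (fr _) (gr _)). Qed.

Lemma all_rotating1 : all_rotating 1.
Proof. by move=> l; rewrite secw1; apply: rotates_byP rotates_by1. Qed.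

Lemma all_rotatingV f : all_rotating f -> all_rotating f^-1.
Proof.
move=> fr l; rewrite -[l](actKV f) secwV; exact: rotates_byP (rotates_byV (fr _)).
Qed.

Lemma all_rotating_subgroup : is_subgroup all_rotating.
Proof.
apply: is_subgroupI; [exact: all_rotating1|exact: all_rotatingV|exact: all_rotatingM].
Qed.

(** The coordinate of level [n] in the abelianization of the standard Sylow pro-p subgroup: the
    exponents of the labels of that level are added. *)
Fixpoint labsum n f : 'F_p :=
  if n is n'.+1 then (\sum_(t : 'F_p) labsum n' (sec f (vtx t)))%R else lab f.

Lemma labsumM n f g : all_rotating f -> all_rotating g ->
  labsum n (f * g) = (labsum n f + labsum n g)%R.
Proof.
elim: n f g => [|n IH] f g fr gr /=; first by apply: labM; apply: all_rotating_root.
rewrite [X in (_ + X)%R](reindex_inj (GRing.addIr (lab f))) /= -big_split /=.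
apply: eq_bigr => t _; rewrite secM (all_rotating_root fr).
by apply: IH; apply: all_rotating_sec.
Qed.

Lemma labsum1 n : labsum n 1 = 0%R.
Proof.
by elim: n => [|n IH] /=; [exact: lab1|apply: big1 => t _; rewrite sec1].
Qed.

Lemma labsumV n f : all_rotating f -> labsum n f^-1 = (- labsum n f)%R.
Proof.
move=> fr; apply/eqP; rewrite -GRing.addr_eq0 -labsumM //; last exact: all_rotatingV.
by rewrite mulVg labsum1.
Qed.

Lemma labsumJ n f g : all_rotating f -> all_rotating g -> labsum n (f ^ g) = labsum n f.
Proof.
move=> fr gr; rewrite conjgE !labsumM ?labsumV //; first ring.
- exact: all_rotatingV.
- exact: all_rotatingM.
Qed.

Lemma sec_pow_prod x n t : rotating x ->
  sec (x ^+ n) (vtx t) = \prod_(0 <= k < n) sec x (vtx (t + lab x *+ k)%R).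
Proof.
move=> xr; elim: n => [|n IH]; first by rewrite big_nil sec1.
rewrite expgSr secM IH big_nat_recr //=; congr (_ * sec x _).
exact: rotatingX.
Qed.

Lemma reindex_orbit (R : nmodType) (F : 'F_p -> R) (i t : 'F_p) : i != 0%R ->
  (\sum_(0 <= k < p) F (t + i *+ k) = \sum_j F j)%R.
Proof.
move=> i0.
have inj : injective (fun k : 'F_p => t + i * k)%R.
  by move=> k k' /GRing.addrI /(GRing.mulfI i0).
rewrite (reindex_inj inj) /= big_mkord.
rewrite (reindex (fun k : 'F_p => Ordinal (Fp_lt k))) /=.
  by apply: eq_bigr => k _; rewrite -GRing.mulr_natr Fp_natK.
exists (fun k : 'I_p => (k : nat)%:R%R) => k _.
  by rewrite /= Fp_natK.
by apply: val_inj; rewrite [LHS](val_Fp_nat pr) modn_small.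
Qed.

(** As [lab x] is non-zero, the cycle of length p through the first level collects each section of
    [x] exactly once. *)
Lemma labsum_secp x n t : all_rotating x -> lab x != 0%R ->
  labsum n (sec (x ^+ p) (vtx t)) = labsum n.+1 x.
Proof.
move=> xr x0; rewrite (sec_pow_prod _ _ (all_rotating_root xr)).
apply: etrans _ (reindex_orbit (fun k => labsum n (sec x (vtx k))) t x0).
suff H m : all_rotating (\prod_(0 <= k < m) sec x (vtx (t + lab x *+ k))%R) /\
    labsum n (\prod_(0 <= k < m) sec x (vtx (t + lab x *+ k))%R) =
    (\sum_(0 <= k < m) labsum n (sec x (vtx (t + lab x *+ k))))%R by case: (H p).
elim: m => [|m [IHr IH]].
  by rewrite !big_nil; split; [exact: all_rotating1|exact: labsum1].
have sr := all_rotating_sec (vtx (t + lab x *+ m)%R) xr.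
rewrite !big_nat_recr //=; split; first exact: all_rotatingM.
by rewrite labsumM // IH.
Qed.

Lemma rootperm_Xp x t : all_rotating x -> rootperm (x ^+ p) (vtx t) = vtx t.
Proof.
move=> xr; rewrite rotatingX; last exact: all_rotating_root.
by rewrite -GRing.mulr_natr pchar_Fp_0 // GRing.mulr0 GRing.addr0.
Qed.

End Rotating.

Lemma sec_commr m (f x : treeAut (adic m)) k : rootperm x = 1 ->
  sec [~ f, x] (rootperm f k) = (sec x k)^-1 ^ sec f k * sec x (rootperm f k).
Proof.
move=> x1; rewrite commgEr secM !conjgE !secM !secV !rootpermM !rootpermV x1 invg1.
by rewrite !permM !perm1 !permK.
Qed.

(** * Generators of multi-GGS groups and right Engel elements *)

Section GGS.
Variables (p : nat) (pr : prime p).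
Implicit Types (f g x : treeAut (adic p)) (i j s t : 'F_p) (e : 'rV['F_p]_p.-1).

Local Notation a := (GGS_a p).
Local Notation b := (@GGS_b p).
Local Notation vtx := (vtx pr).
Local Notation rotates_by := (rotates_by pr).
Local Notation rotating := (rotating pr).
Local Notation all_rotating := (all_rotating pr).
Local Notation lab := (lab pr).

Lemma sec_a k : sec a k = 1. Proof. exact: sec_wr. Qed.

Lemma rotates_a : rotates_by a 1%R.
Proof.
move=> t; rewrite rootperm_wr permE; apply: val_inj.
change (((nat_of_ord (t - 1)%R).+1 %% p)%N = nat_of_ord (t + 1 - 1)%R).
by rewrite -(val_Fp_nat pr) -GRing.natr1 (Fp_natK pr) GRing.subrK GRing.addrK.
Qed.

Lemma rootperm_aX n t : rootperm (a ^+ n) (vtx t) = vtx (t + n%:R)%R.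
Proof.
rewrite rotatingX; last exact: rotates_byP rotates_a.
by rewrite (rotates_by_lab rotates_a).
Qed.

Lemma sec_aX n k : sec (a ^+ n) k = 1.
Proof.
elim: n k => [|n IH] k; first by rewrite sec1.
by rewrite expgS secM sec_a IH mul1g.
Qed.

Lemma aX_eq n m : (n%:R = m%:R :> 'F_p)%R -> a ^+ n = a ^+ m.
Proof.
move=> nm; apply: sec_ext => [|k]; last by rewrite !sec_aX.
by apply/permP => k; have [t ->] := vtx_surj pr k; rewrite !rootperm_aX nm.
Qed.

Definition powa t : treeAut (adic p) := a ^+ (t : nat).

Lemma powaE n : a ^+ n = powa n%:R%R.
Proof. by apply: aX_eq; rewrite (Fp_natK pr). Qed.

Lemma powaD s t : powa (s + t)%R = powa s * powa t.
Proof. by rewrite /powa -expgnDr; apply: aX_eq; rewrite GRing.natrD !(Fp_natK pr). Qed.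

Lemma powa0 : powa 0%R = 1. Proof. by []. Qed.

Lemma powaN t : powa (- t)%R = (powa t)^-1.
Proof. by apply/esym/mulg1_eq; rewrite -powaD GRing.subrr powa0. Qed.

Lemma rotates_powa s : rotates_by (powa s) s.
Proof. by move=> t; rewrite rootperm_aX (Fp_natK pr). Qed.

Lemma sec_powa s k : sec (powa s) k = 1. Proof. exact: sec_aX. Qed.

(* The coordinate e_t of the vector e, with the convention e_0 = 0. *)
Definition coord e t : 'F_p :=
  if insub (val (vtx t)) is Some k then e ord0 (k : 'I_p.-1) else 0%R.

Lemma vtx0 : val (vtx 0%R) = p.-1.
Proof.
have lt := Fp_lt pr (0 - 1)%R; apply/eqP; rewrite /= eqn_leq -ltnS prednK ?prime_gt0 // lt /=.
have : ((nat_of_ord (0 - 1 : 'F_p)%R).+1 %% p = 0)%N.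
  by rewrite -(val_Fp_nat pr) -GRing.natr1 (Fp_natK pr) GRing.subrK.
by move=> /eqP /dvdn_leq -/(_ isT) le; rewrite -ltnS prednK ?prime_gt0.
Qed.

Lemma vtx_last t : (val (vtx t) < p.-1)%N = (t != 0%R).
Proof.
have := ltn_ord (vtx t); rewrite -[X in (_ < X)%N -> _](prednK (prime_gt0 pr)) ltnS leq_eqVlt.
case: (eqVneq t 0%R) => [->|t0]; first by rewrite vtx0 ltnn.
by case: eqP => //= e _; case/eqP: t0; apply: (@vtx_inj p pr); apply: val_inj; rewrite vtx0.
Qed.

Lemma coord0 e : coord e 0%R = 0%R.
Proof. by rewrite /coord insubF // vtx_last eqxx. Qed.

Lemma coordD e e' t : coord (e + e')%R t = (coord e t + coord e' t)%R.
Proof. by rewrite /coord; case: (insub _) => [k|]; rewrite ?mxE ?GRing.addr0. Qed.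

Lemma coordZ c e t : coord (c *: e)%R t = (c * coord e t)%R.
Proof. by rewrite /coord; case: (insub _) => [k|]; rewrite ?mxE ?GRing.mulr0. Qed.

Lemma coord_neq0 e : (e != 0)%R -> exists t, coord e t != 0%R.
Proof.
move=> e0; apply: contrapT => ne; case/eqP: e0; apply/rowP => k; rewrite mxE.
have kp : (k < p)%N by apply: leq_trans (ltn_ord k) (leq_pred p).
have := ne; apply: contra_notP => /eqP ek; exists (idx (Ordinal kp)).
rewrite /coord idxK /=; case: insubP => [k' _ kk'|]; last by rewrite ltn_ord.
by have -> : k' = k by exact: val_inj.
Qed.

Lemma rootperm_b e : rootperm (b e) = 1.
Proof. by rewrite GGS_bE rootperm_wr. Qed.

Lemma sec_b e t : sec (b e) (vtx t) = if t == 0%R then b e else powa (coord e t).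
Proof.
rewrite {1}GGS_bE sec_wr /coord; case: eqVneq => [->|t0].
  by rewrite insubF // vtx_last eqxx.
have kt : (val (vtx t) < p.-1)%N by rewrite vtx_last.
by rewrite (insubT (fun k => (k < p.-1)%N) kt).
Qed.

Lemma rotates_b e : rotates_by (b e) 0%R.
Proof. by move=> t; rewrite rootperm_b perm1 GRing.addr0. Qed.

(** The product solves the recursion that defines the left-hand side, and the solution is unique. *)
Lemma bD e e' : b (e + e')%R = b e * b e'.
Proof.
apply/esym/rec_aut_unique; apply: sec_ext => [|k].
  by rewrite rootpermM !rootperm_b rootperm_wr mulg1.
have [t ->] := vtx_surj pr k.
rewrite secM rootperm_b perm1 !sec_b sec_wr; case: eqVneq => [->|t0].
  by rewrite insubF // vtx_last eqxx.
have kt : (val (vtx t) < p.-1)%N by rewrite vtx_last.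
rewrite (insubT (fun k => (k < p.-1)%N) kt) /= -powaD -coordD.
by rewrite /coord (insubT (fun k => (k < p.-1)%N) kt).
Qed.

Lemma b0 : b 0%R = 1.
Proof. by apply: (mulgI (b 0%R)); rewrite -bD GRing.addr0 mulg1. Qed.

Lemma bN e : b (- e)%R = (b e)^-1.
Proof. by apply/esym/mulg1_eq; rewrite -bD GRing.subrr b0. Qed.

Lemma bX e n : b e ^+ n = b (e *+ n)%R.
Proof. by elim: n => [|n IH]; rewrite ?b0 // expgS IH GRing.mulrS bD. Qed.

Lemma bXp e : b e ^+ p = 1.
Proof.
rewrite bX -GRing.scaler_nat pchar_Fp_0 // GRing.scale0r; exact: b0.
Qed.

Lemma sec_bJ e s t : sec (b e ^ powa s) (vtx t) = sec (b e) (vtx (t - s)%R).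
Proof.
by rewrite conjgE !secM -powaN rotates_powa !sec_powa mul1g mulg1.
Qed.

Lemma rootperm_bJ e g : rootperm (b e ^ g) = 1.
Proof. by rewrite conjgE !rootpermM rootpermV rootperm_b mul1g mulVg. Qed.

Lemma all_rotating_a : all_rotating a.
Proof.
case=> [|k l]; first exact: rotates_byP rotates_a.
by rewrite /= sec_a secw1; apply: rotates_byP (rotates_by1 pr).
Qed.

Lemma all_rotating_powa t : all_rotating (powa t).
Proof. exact: (subgroupX (all_rotating_subgroup pr) _ all_rotating_a). Qed.

Lemma all_rotating_b e : all_rotating (b e).
Proof.
elim=> [|k l IH] /=; first exact: rotates_byP (rotates_b e).
have [t ->] := vtx_surj pr k; rewrite sec_b; case: ifP => // _.
exact: all_rotating_powa.
Qed.

Lemma lab_powa s : lab (powa s) = s. Proof. exact/rotates_by_lab/rotates_powa. Qed.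
Lemma lab_b e : lab (b e) = 0%R. Proof. exact/rotates_by_lab/rotates_b. Qed.

(* The section of [~ f, b e] at the vertex where b_e has section b_e is again an
   automorphism with label j times b_e, so the argument can be iterated. *)
Lemma engel_b_neq1 e f n : all_rotating f -> lab f != 0%R ->
  coord e (- lab f)%R = (- lab f)%R -> engel f (b e) n <> 1.
Proof.
elim: n f => [|n IH] f fr f0 ef.
  by move=> f1; rewrite /engel /= in f1; rewrite f1 lab1 eqxx in f0.
have f_rot := all_rotating_root fr.
have vE : vtx 0%R = rootperm f (vtx (- lab f)%R) by rewrite f_rot GRing.addNr.
set f' := sec [~ f, b e] (vtx 0%R).
have f'E : f' = powa (lab f) ^ sec f (vtx (- lab f)%R) * b e.
  rewrite /f' vE sec_commr ?rootperm_b // -vE !sec_b eqxx GRing.oppr_eq0 (negPf f0) ef.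
  by rewrite -powaN GRing.opprK.
have hr := all_rotating_sec (vtx (- lab f)%R) fr.
have jr : all_rotating (powa (lab f) ^ sec f (vtx (- lab f)%R)).
  exact: (subgroupJ (all_rotating_subgroup pr) (all_rotating_powa _) hr).
have f'r : all_rotating f' by rewrite f'E; apply: all_rotatingM jr (all_rotating_b e).
have lf' : lab f' = lab f.
  rewrite f'E (labM (all_rotating_root jr) (all_rotating_root (all_rotating_b e))) lab_b.
  rewrite GRing.addr0; have := labsumJ 0 (all_rotating_powa (lab f)) hr; rewrite /= => ->.
  exact: lab_powa.
rewrite engelSr => /(congr1 (fun g => sec g (vtx 0%R))); rewrite sec1.
have r1 : rootperm [~ f, b e] = 1 by rewrite rootperm_commr // rootperm_b.
rewrite sec_engel ?r1 ?rootperm_b ?perm1 // sec_b eqxx.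
by apply: IH; rewrite ?lf'.
Qed.

Section Group.
Variable E : {vspace 'rV['F_p]_p.-1}.
Local Notation G := (multi_GGS E).

Lemma GGS_subgroup : is_subgroup G. Proof. exact: generated_subgroup. Qed.
Local Notation sG := GGS_subgroup.

Lemma GGS_mem_a : G a. Proof. by apply: generated_mem; left. Qed.
Lemma GGS_mem_powa t : G (powa t). Proof. exact: (subgroupX sG _ GGS_mem_a). Qed.
Lemma GGS_mem_b e : e \in E -> G (b e).
Proof. by move=> eE; apply: generated_mem; right; exists e. Qed.

Lemma GGS_ind (P : treeAut (adic p) -> Prop) : P 1 -> (forall x, P x -> P x^-1) ->
    (forall x y, P x -> P y -> P (x * y)) -> P a -> (forall e, e \in E -> P (b e)) ->
  forall x, G x -> P x.
Proof.
by move=> P1 PV PM Pa Pb; apply: generated_ind => // x [->|[e eE <-]] //; apply: Pb.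
Qed.

Lemma GGS_all_rotating x : G x -> all_rotating x.
Proof.
move=> Gx; have sr := all_rotating_subgroup pr.
elim/GGS_ind: x / Gx => [|y|y z||e _].
- exact: (subgroup1 sr).
- exact: (subgroupV sr).
- exact: (subgroupM sr).
- exact: all_rotating_a.
- exact: all_rotating_b.
Qed.

Lemma GGS_sec x k : G x -> G (sec x k).
Proof.
move=> Gx; elim/GGS_ind: x / Gx k => [|y IH|y z IHy IHz||e eE] k.
- by rewrite sec1; exact: (subgroup1 sG).
- by rewrite secV; exact: (subgroupV sG).
- by rewrite secM; exact: (subgroupM sG).
- by rewrite sec_a; exact: (subgroup1 sG).
- have [t ->] := vtx_surj pr k; rewrite sec_b; case: ifP => _; first exact: GGS_mem_b.
  exact: GGS_mem_powa.
Qed.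

Lemma GGS_secw x l : G x -> G (secw x l).
Proof. by elim: l x => //= k l IH x Gx; apply: IH; apply: GGS_sec. Qed.

Hypothesis E0 : E != 0%VS.

Lemma exists_scaled e t s : e \in E -> coord e t != 0%R ->
  exists2 e', e' \in E & forall u, coord e' u = (s / coord e t * coord e u)%R.
Proof.
move=> eE et; exists (s / coord e t *: e)%R; first exact: memvZ.
by move=> u; rewrite coordZ.
Qed.

Lemma exists_coord : exists e t, e \in E /\ coord e t != 0%R.
Proof.
have [t et] := @coord_neq0 (vpick E) ltac:(by rewrite vpick0).
by exists (vpick E), t; rewrite memv_pick.
Qed.

(** Conjugation by powers of [a] brings any component of [b e] to the vertex [t]: either [b e]
    itself or, after scaling [e], the generator [a]. *)
Lemma GGS_fractal g t : G g -> exists2 x, G x & rootperm x = 1 /\ sec x (vtx t) = g.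
Proof.
move=> Gg; elim/GGS_ind: g / Gg => [|y [x Gx [x1 <-]]|y z [x Gx [x1 <-]] [x' Gx' [x1' <-]]||e eE].
- by exists 1; [exact: (subgroup1 sG)|rewrite rootperm1 sec1].
- exists x^-1; first exact: (subgroupV sG).
  by rewrite rootpermV secV x1 invg1 perm1.
- exists (x * x'); first exact: (subgroupM sG).
  by rewrite rootpermM secM x1 x1' perm1 mulg1.
- have [e [s [eE es]]] := exists_coord; have [e' e'E e'P] := exists_scaled 1%R eE es.
  exists (b e' ^ powa (t - s)%R).
    exact: (subgroupJ sG (GGS_mem_b e'E) (GGS_mem_powa _)).
  rewrite rootperm_bJ sec_bJ GRing.opprB GRing.addrC GRing.subrK sec_b e'P.
  have s0 : s != 0%R by apply: contraNneq es => ->; rewrite coord0.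
  by rewrite (negPf s0) GRing.mulfVK // [RHS]powaE.
- exists (b e ^ powa t); first exact: (subgroupJ sG (GGS_mem_b eE) (GGS_mem_powa _)).
  by rewrite rootperm_bJ sec_bJ GRing.subrr sec_b eqxx.
Qed.

(** If the coordinate of [e] at [- j] is non-zero, a scaled [b e] works at once. Otherwise let [u]
    be the last multiple of [j], in the order of the multipliers, with non-zero coordinate: some [x]
    gives [[~ g, x]] a section at 0 with label [- u] and times [b e'], to which the first case
    applies. *)
Lemma not_right_engel_root g : G g -> lab g != 0%R ->
  exists2 x, G x & forall n, engel g x n <> 1.
Proof.
move=> Gg g0; have gr := GGS_all_rotating Gg; set j := lab g in g0 *.
have [e [s [eE es]]] := exists_coord.
pose P m := (m < p)%N && (coord e (j *+ m)%R != 0%R).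
have exP : exists m, P m.
  exists (nat_of_ord (s / j)%R); rewrite /P Fp_lt // -GRing.mulr_natr (Fp_natK pr) //.
  by rewrite GRing.mulrC GRing.divfK.
have maxP m : P m -> (m <= p)%N by case/andP => /ltnW.
case: (ex_maxnP exP maxP) => m /andP [mp em] mmax.
set u := (j *+ m)%R in em.
have u0 : u != 0%R by apply: contraNneq em => ->; rewrite coord0.
have [e' e'E e'P] := exists_scaled u eE em.
have e'u : coord e' u = u by rewrite e'P GRing.mulfVK.
have j1 : (- j = j *+ p.-1)%R.
  apply/eqP; rewrite eq_sym -GRing.addr_eq0 -GRing.mulrSr prednK ?prime_gt0 //.
  by rewrite -GRing.mulr_natr pchar_Fp_0 // GRing.mulr0.
have [mE|mE] := eqVneq m p.-1.
  exists (b e'); first exact: GGS_mem_b.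
  by move=> n; apply: engel_b_neq1; rewrite -/j // j1 -mE.
have mp1 : (m.+1 < p)%N by move: mE mp; have := prime_gt0 pr; lia.
have zero k : (m < k < p)%N -> coord e' (j *+ k)%R = 0%R.
  move=> /andP [mk kp]; rewrite e'P; case: (eqVneq (coord e (j *+ k)%R) 0%R) => [->|ek].
    by rewrite GRing.mulr0.
  by have := mmax k; rewrite /P kp ek => /(_ isT); rewrite leqNgt mk.
set v := (j *+ m.+1)%R.
have v0 : v != 0%R.
  rewrite /v -GRing.mulr_natr GRing.mulf_neq0 //; apply/eqP => /(congr1 val).
  by rewrite [LHS](val_Fp_nat pr) modn_small.
(* Since [v] is [u + j], the second factor contributes its coordinate [u] at the vertex [- j]; the
   other contributions of coordinates at 0 and at [- j] come from multiples of [j] beyond [u] and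
   vanish. *)
pose x := b e' * b e' ^ powa (- v)%R.
have Gx : G x.
  apply: (subgroupM sG (GGS_mem_b e'E)).
  exact: (subgroupJ sG (GGS_mem_b e'E) (GGS_mem_powa _)).
have x1 : rootperm x = 1 by rewrite rootpermM rootperm_bJ rootperm_b mulg1.
have x_sec t : sec x (vtx t) = sec (b e') (vtx t) * sec (b e') (vtx (t + v)%R).
  by rewrite secM rootperm_b perm1 sec_bJ GRing.opprK.
have s0 : sec x (vtx 0%R) = b e'.
  by rewrite x_sec !sec_b eqxx GRing.add0r (negPf v0) zero ?leqnn ?mp1 // powa0 mulg1.
have sj : sec x (vtx (- j)%R) = powa u.
  have -> : u = (- j + v)%R by rewrite /v GRing.mulrS GRing.addKr.
  rewrite x_sec !sec_b GRing.oppr_eq0 (negPf g0).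
  rewrite j1 zero; last by move: mE mp; have := prime_gt0 pr; lia.
  rewrite powa0 mul1g -j1; have -> : (- j + v = u)%R by rewrite /v GRing.mulrS GRing.addKr.
  by rewrite (negPf u0) e'u.
clearbody x; exists x => // -[|n].
  by rewrite /engel /= => g1; rewrite /j g1 lab1 eqxx in g0.
rewrite engelSr => /(congr1 (fun h => sec h (vtx 0%R))); rewrite sec1.
have r1 : rootperm [~ g, x] = 1 by rewrite rootperm_commr.
rewrite sec_engel ?r1 ?x1 ?perm1 // s0.
have hr := all_rotating_sec (vtx (- j)%R) gr.
have jr : all_rotating (powa (- u)%R ^ sec g (vtx (- j)%R)).
  exact: (subgroupJ (all_rotating_subgroup pr) (all_rotating_powa _) hr).
have vE : vtx 0%R = rootperm g (vtx (- j)%R) by rewrite (all_rotating_root gr) GRing.addNr.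
have sE : sec [~ g, x] (vtx 0%R) = powa (- u)%R ^ sec g (vtx (- j)%R) * b e'.
  by rewrite vE sec_commr // -vE s0 sj powaN.
have lE : lab (sec [~ g, x] (vtx 0%R)) = (- u)%R.
  rewrite sE (labM (all_rotating_root jr) (all_rotating_root (all_rotating_b e'))) lab_b.
  rewrite GRing.addr0; have := labsumJ 0 (all_rotating_powa (- u)%R) hr; rewrite /= => ->.
  exact: lab_powa.
apply: engel_b_neq1; rewrite ?lE ?GRing.oppr_eq0 ?GRing.opprK //.
by rewrite sE; apply: all_rotatingM jr (all_rotating_b e').
Qed.

(** Along a moved word, the section just before the first moved letter has a non-zero label; [P] is
    any property that survives the descent. *)
Lemma GGS_nontrivial_section (P : set (treeAut (adic p))) :
    (forall x k, G x -> P x -> rootperm x = 1 -> P (sec x k)) ->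
  forall x, G x -> P x -> x <> 1 -> exists y, [/\ G y, P y & lab y != 0%R].
Proof.
move=> Psec x Gx Px x1; have [l xl] : exists l, act x l <> l.
  by apply: contrapT => nx; apply: x1; apply: act_ext => l; rewrite act1; apply: contrapT => xl; apply: nx; exists l.
elim: l x Gx Px xl {x1} => // k l IH x Gx Px /= xl.
have [x0|x0] := eqVneq (lab x) 0%R; last by exists x.
have r1 := lab_eq0 (all_rotating_root (GGS_all_rotating Gx)) x0.
apply: (IH (sec x k)); [exact: GGS_sec|exact: Psec|].
by move=> e; apply: xl; rewrite r1 perm1 e.
Qed.

Lemma GGS_right_engel : right_engel G = [set 1].
Proof.
apply/seteqP; split=> [g [Gg gE]|g /= ->]; last first.
  split=> [|x _]; first exact: (subgroup1 sG).
  by exists 0.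
apply: contrapT => g1.
have [] := @GGS_nontrivial_section [set h | forall x, G x -> exists n, engel h x n = 1] _ g Gg gE g1.
  move=> x k Gx xE x1 y Gy; have [t tk] := vtx_surj pr k.
  have [z Gz [z1 <-]] := GGS_fractal t Gy; have [n xn] := xE z Gz.
  exists n; rewrite tk -sec_engel ?x1 ?z1 ?perm1 // xn; exact: sec1.
move=> h [Gh hE h0]; have [x Gx xE] := not_right_engel_root Gh h0.
by have [n /xE] := hE x Gx.
Qed.

End Group.
End GGS.

(** * Contraction of multi-GGS groups, return maps and periodicity *)

Section Length.
Variables (p : nat) (pr : prime p).
Variable E : {vspace 'rV['F_p]_p.-1}.
Implicit Types (f g x : treeAut (adic p)) (i j s t : 'F_p) (e : 'rV['F_p]_p.-1).

Local Notation a := (GGS_a p).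
Local Notation b := (@GGS_b p).
Local Notation vtx := (vtx pr).
Local Notation rotating := (rotating pr).
Local Notation all_rotating := (all_rotating pr).
Local Notation lab := (lab pr).
Local Notation labsum := (labsum pr).
Local Notation G := (multi_GGS E).
Local Notation sG := (GGS_subgroup E).

(** Only the letters [b e] are counted, as the sections of [a] are trivial. The word need not be
    minimal. *)
Inductive b_length : nat -> treeAut (adic p) -> Prop :=
| b_length1 : b_length 0 1
| b_length_a L g : b_length L g -> b_length L (g * a)
| b_length_b L g e : e \in E -> b_length L g -> b_length L.+1 (g * b e).

Lemma b_lengthM L g L' g' : b_length L g -> b_length L' g' -> b_length (L + L') (g * g').
Proof.
move=> gL; elim=> [|{}L' h _ IH|{}L' h e eE _ IH]; first by rewrite addn0 mulg1.
- by rewrite mulgA; apply: b_length_a.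
- by rewrite mulgA addnS; apply: b_length_b.
Qed.

Lemma b_length_powa t : b_length 0 (powa t).
Proof.
rewrite /powa; elim: (nat_of_ord t) => [|n IH]; first exact: b_length1.
by rewrite expgSr; apply: b_length_a.
Qed.

Lemma b_length_be e : e \in E -> b_length 1 (b e).
Proof. by move=> eE; rewrite -[b e]mul1g; apply: b_length_b => //; exact: b_length1. Qed.

Lemma b_lengthV L g : b_length L g -> b_length L g^-1.
Proof.
elim=> [|{}L h _ IH|{}L h e eE _ IH]; first by rewrite invg1; exact: b_length1.
- rewrite invMg; have -> : a^-1 = powa (- 1)%R by rewrite (powaN pr).
  by rewrite -[L]add0n; apply: b_lengthM => //; exact: b_length_powa.
- rewrite invMg -(bN pr) -add1n; apply: b_lengthM => //.
  by apply: b_length_be; rewrite GRing.rpredN.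
Qed.

Lemma GGS_b_length x : G x -> exists L, b_length L x.
Proof.
move=> Gx; elim/GGS_ind: x / Gx => [|y [L yL]|y z [L yL] [L' zL']||e eE].
- by exists 0%N; exact: b_length1.
- by exists L; apply: b_lengthV.
- by exists (L + L')%N; apply: b_lengthM.
- by exists 0%N; rewrite -[a]mul1g; apply: b_length_a; exact: b_length1.
- by exists 1%N; apply: b_length_be.
Qed.

Lemma b_length_GGS L x : b_length L x -> G x.
Proof.
elim=> [|{}L g _ IH|{}L g e eE _ IH]; first exact: (subgroup1 sG).
- by apply: (subgroupM sG) => //; exact: GGS_mem_a.
- by apply: (subgroupM sG) => //; exact: GGS_mem_b.
Qed.

Lemma b_length0 x : b_length 0 x -> exists t, x = powa t.
Proof.
suff H L y : b_length L y -> L = 0%N -> exists t, y = powa t by move/H; exact.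
elim=> [|{}L g _ IH|//]; first by exists 0%R; rewrite powa0.
by move=> /IH [t ->]; exists (t + 1)%R; rewrite (powaD pr) -(powaE pr 1).
Qed.

(** Each letter [b e] passes on a [b e] to the section at exactly one vertex and powers of [a] to
    the others, so the length is distributed among the sections. *)
Lemma b_length_sec L x : b_length L x -> exists f : 'F_p -> nat,
  (\sum_t f t = L)%N /\ forall t, b_length (f t) (sec x (vtx t)).
Proof.
elim=> [|{}L g gL [f [fL fs]]|{}L g e eE gL [f [fL fs]]].
- exists (fun=> 0%N); split; first exact: big1.
  by move=> t; rewrite sec1; exact: b_length1.
- by exists f; split=> // t; rewrite secM sec_a mulg1.
- have gr := all_rotating_root (GGS_all_rotating pr (b_length_GGS gL)).
  exists (fun t => f t + (t == - lab g)%R)%N; split.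
    rewrite big_split /= fL (bigD1 (- lab g)%R) //= eqxx big1 ?addn1 //.
    by move=> t /negPf ->.
  move=> t; rewrite secM gr sec_b GRing.addr_eq0; apply: b_lengthM => //.
  by case: ifP => _; [exact: b_length_be|exact: b_length_powa].
Qed.

Lemma b_length_secp L x t : b_length L x -> lab x != 0%R ->
  b_length L (sec (x ^+ p) (vtx t)).
Proof.
move=> xL x0; have xr := all_rotating_root (GGS_all_rotating pr (b_length_GGS xL)).
have [f [fL fs]] := b_length_sec xL.
rewrite sec_pow_prod // -fL -(reindex_orbit pr (f : 'F_p -> nat) t x0).
suff H m : b_length (\sum_(0 <= k < m) f (t + lab x *+ k)%R)
  (\prod_(0 <= k < m) sec x (vtx (t + lab x *+ k)%R)) by exact: H.
elim: m => [|m IH]; first by rewrite !big_nil; exact: b_length1.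
by rewrite !big_nat_recr //=; apply: b_lengthM.
Qed.

Lemma exists_shorter L x : (0 < L)%N -> b_length L x ->
  exists t L', (L' < L)%N /\ b_length L' (sec x (vtx t)).
Proof.
move=> L0 xL; have [f [fL fs]] := b_length_sec xL.
suff [t ft] : exists t, (f t < L)%N by exists t, (f t).
apply: contrapT => nt; have fge t : (L <= f t)%N.
  by rewrite leqNgt; apply/negP => ft; apply: nt; exists t.
have : (\sum_(t : 'F_p) L <= L)%N by rewrite -{2}fL; apply: leq_sum.
rewrite sum_nat_const card_Fp // leqNgt -{1}[L]mul1n ltn_pmul2r //.
by rewrite prime_gt1.
Qed.

(* For x in G the sums of the labels are the same on all the levels n > 0, so the last
   alternative makes the section act as an odometer. *)
Definition good_return x := exists l k, [/\ (0 < k)%N, act (x ^+ k) l = l,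
  forall m, act (x ^+ m) l = l -> (k %| m)%N &
  secw (x ^+ k) l = 1 \/
    lab (secw (x ^+ k) l) != 0%R /\ labsum 1 (secw (x ^+ k) l) != 0%R].

Lemma good_return_sec x k : rootperm x = 1 -> good_return (sec x k) -> good_return x.
Proof.
move=> x1 [l [n [n0 nl nmin nz]]]; exists (k :: l), n.
have xk : rootperm x k = k by rewrite x1 perm1.
split=> // [|i /=|] /=; rewrite ?rootpermX ?x1 ?expg1n ?perm1 sec_fixX // ?nl //.
by case=> /nmin.
Qed.

Lemma fixed_pow_root x (i : nat) t : all_rotating x -> lab x != 0%R ->
  rootperm (x ^+ i) (vtx t) = vtx t -> (p %| i)%N.
Proof.
move=> xr x0; rewrite (rotatingX _ (all_rotating_root xr)) => /(@vtx_inj p pr) /eqP.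
rewrite -[X in _ == X]GRing.addr0 (inj_eq (GRing.addrI _)) -GRing.mulr_natr.
rewrite GRing.mulf_eq0 (negPf x0) /= => /eqP i0.
by rewrite /dvdn -(val_Fp_nat pr) i0.
Qed.

Lemma good_return_secp x t : all_rotating x -> lab x != 0%R ->
  good_return (sec (x ^+ p) (vtx t)) -> good_return x.
Proof.
move=> xr x0 [l [n [n0 nl nmin nz]]]; exists (vtx t :: l), (p * n)%N.
have xp := rootperm_Xp t xr.
have p0 := prime_gt0 pr.
have sE m : sec (x ^+ (p * m)) (vtx t) = sec (x ^+ p) (vtx t) ^+ m.
  by rewrite expgnA (sec_fixX _ xp).
have rE m : rootperm (x ^+ (p * m)) (vtx t) = vtx t.
  by rewrite expgnA; have := @act_fixX p (x ^+ p) [:: vtx t] m; rewrite /= xp => /(_ erefl) [].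
split=> [|||]; rewrite ?muln_gt0 ?p0 //=; rewrite ?rE ?sE ?nl //.
move=> i [it il]; have /dvdnP [j ij] := fixed_pow_root xr x0 it.
move: il; rewrite ij (mulnC j p) sE => /nmin nj; exact: dvdn_mul.
Qed.

(** Induction on the length. With label 0 some section is strictly shorter. With non-zero label and
    zero label sum on level 1, the section of the p-th power is no longer than [x] and has label 0,
    so the former case applies to it. Otherwise the empty word already serves. *)
Lemma GGS_good_return x : G x -> good_return x.
Proof.
move=> Gx; have [L xL] := GGS_b_length Gx; elim/ltn_ind: L x xL {Gx} => L IH x xL.
have step y : b_length L y -> lab y = 0%R -> good_return y.
  move=> yL y0; have yr := GGS_all_rotating pr (b_length_GGS yL).
  have y1 := lab_eq0 (all_rotating_root yr) y0.
  have [L0|L0] := posnP L.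
    move: yL y0; rewrite L0 => /b_length0 [t ->]; rewrite lab_powa => ->.
    exists [::], 1%N; split=> //; by left.
  have [t [L' [L'L tL']]] := exists_shorter L0 yL.
  exact: good_return_sec y1 (IH L' L'L _ tL').
have [x0|x0] := eqVneq (lab x) 0%R; first exact: step.
have xr := GGS_all_rotating pr (b_length_GGS xL).
have [x1|x1] := eqVneq (labsum 1 x) 0%R; last first.
  by exists [::], 1%N; split=> //; right.
apply: (good_return_secp (t := 0%R) xr x0); apply: step; first exact: b_length_secp.
exact: etrans (@labsum_secp p pr x 0 0%R xr x0) x1.
Qed.

Definition torsion g := exists2 n, (0 < n)%N & g ^+ n = 1.

Lemma torsion_sections x : rootperm x = 1 -> (forall t, torsion (sec x (vtx t))) -> torsion x.
Proof.
move=> x1 xt; pose n t := s2val (cid2 (xt t)).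
have n0 t : (0 < n t)%N by rewrite /n; case: cid2.
exists (\prod_t n t)%N; first by rewrite prodn_gt0.
apply: sec_ext => [|k]; first by rewrite rootpermX x1 expg1n rootperm1.
have [t ->] := vtx_surj pr k; rewrite sec_fixX ?x1 ?perm1 // sec1.
rewrite (bigD1 t) //= expgnA; have -> : sec x (vtx t) ^+ n t = 1 by rewrite /n; case: cid2.
by rewrite expg1n.
Qed.

(** A section keeps the full length only if every letter [b e] contributes at [t]; the powers of [a]
    between these letters then cancel and the letters merge into one. *)
Lemma b_length_special L x : b_length L x -> forall t, exists2 L', b_length L' (sec x (vtx t)) &
  (L' < L)%N \/ L' = L /\ exists e s, e \in E /\ x = powa (- t)%R * b e * powa s.
Proof.
elim=> [t|{}L g gL IH t|{}L g e eE gL IH t].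
- exists 0%N; first by rewrite sec1; exact: b_length1.
  right; split=> //; exists 0%R, t; split; first exact: mem0v.
  by rewrite (b0 pr) mulg1 -(powaD pr) GRing.addNr powa0.
- have [L' gL' H] := IH t; exists L'; first by rewrite secM sec_a mulg1.
  case: H => [|[-> [e [s [eE ->]]]]]; [by left|right; split=> //].
  exists e, (s + 1)%R; split=> //; by rewrite (powaD pr) [powa 1%R](_ : _ = a) ?mulgA // (powaE pr).
- have gr := all_rotating_root (GGS_all_rotating pr (b_length_GGS gL)).
  have [L' gL' H] := IH t; rewrite secM gr sec_b; case: eqVneq => [t0|t0].
    exists L'.+1; first exact: b_length_b.
    case: H => [lt|[-> [e' [s [e'E gE]]]]]; [by left|right; split=> //].
    exists (e' + e)%R, 0%R; split; first exact: memvD.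
    have lg : lab g = (- t + s)%R.
      rewrite gE; apply: rotates_by_lab; apply: rotates_byM (rotates_powa pr s).
      rewrite -[X in rotates_by pr _ X]GRing.addr0.
      exact: rotates_byM (rotates_powa pr _) (rotates_b pr e').
    have s0 : s = 0%R by move: t0; rewrite lg GRing.addrA GRing.subrr GRing.add0r.
    by rewrite gE s0 powa0 !mulg1 (bD pr) mulgA.
  exists L'; first by rewrite -[L']addn0; apply: b_lengthM => //; exact: b_length_powa.
  by left; case: H => [/leqW|[->]].
Qed.

Definition weight e : 'F_p := (\sum_t coord pr e t)%R.

Lemma labsum_powa n t : labsum n.+1 (powa t) = 0%R.
Proof. by rewrite /=; apply: big1 => k _; rewrite sec_powa labsum1. Qed.

Lemma labsum_b n e : labsum n.+1 (b e) = weight e.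
Proof.
elim: n => [|n IH].
  rewrite /weight /=; apply: eq_bigr => t _; rewrite sec_b; case: eqVneq => [->|_].
    by rewrite coord0 lab_b.
  exact: lab_powa.
rewrite -IH [LHS]/= (bigD1 0%R) //= sec_b eqxx -/(labsum n.+1 (b e)).
rewrite [X in (_ + X)%R]big1 ?GRing.addr0 // => t t0.
by rewrite sec_b (negPf t0); exact: labsum_powa.
Qed.

Lemma GGS_labsum n x : G x -> labsum n.+1 x = labsum 1 x.
Proof.
move=> Gx; suff [] : G x /\ labsum n.+1 x = labsum 1 x by [].
elim/GGS_ind: x / Gx => [|y [Gy IH]|y z [Gy IHy] [Gz IHz]||e eE].
- by split; [exact: (subgroup1 sG)|rewrite !labsum1].
- split; first exact: (subgroupV sG).
  by rewrite !labsumV ?IH //; apply: (GGS_all_rotating pr Gy).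
- split; first exact: (subgroupM sG).
  by rewrite !labsumM ?IHy ?IHz //; apply: (@GGS_all_rotating p pr E).
- split; first exact: GGS_mem_a.
  by rewrite -[a]/(powa 1%R) !labsum_powa.
- by split; [exact: GGS_mem_b|rewrite !labsum_b].
Qed.

(** Vanishing weights make all label sums on level 1 vanish, so p-th powers of elements with
    non-zero label have sections with label 0. Elements with label 0 have strictly shorter sections,
    except the conjugates of some [b e], whose p-th power is trivial. Contrapositively, a
    non-periodic group has a vector of non-zero weight. *)
Lemma GGS_periodic : (forall e, e \in E -> weight e = 0%R) -> periodic G.
Proof.
move=> w0 x Gx; have [L xL] := GGS_b_length Gx; elim/ltn_ind: L x xL {Gx} => L IH x xL.
have z1 y : G y -> labsum 1 y = 0%R.
  move=> Gy; suff [] : all_rotating y /\ labsum 1 y = 0%R by [].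
  elim/GGS_ind: y / Gy => [|y [yr IHy]|y z [yr IHy] [zr IHz]||e eE].
  - by split; [exact: all_rotating1|rewrite labsum1].
  - by split; [exact: all_rotatingV|rewrite labsumV // IHy GRing.oppr0].
  - by split; [exact: all_rotatingM|rewrite labsumM // IHy IHz GRing.addr0].
  - by split; [exact: all_rotating_a|rewrite -[a]/(powa 1%R) labsum_powa].
  - by split; [exact: all_rotating_b|rewrite labsum_b w0].
have step y : b_length L y -> lab y = 0%R -> torsion y.
  move=> yL y0; have yr := GGS_all_rotating pr (b_length_GGS yL).
  have y1 := lab_eq0 (all_rotating_root yr) y0.
  have [[t [e [s [eE yE]]]]|ns] := pselect (exists t e s, e \in E /\ y = powa (- t)%R * b e * powa s).
    have st : s = t.
      move: y0; rewrite yE.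
      have -> : lab (powa (- t)%R * b e * powa s) = (- t + s)%R.
        apply: rotates_by_lab; apply: rotates_byM (rotates_powa pr s).
        rewrite -[X in rotates_by pr _ X]GRing.addr0.
        exact: rotates_byM (rotates_powa pr _) (rotates_b pr e).
      by rewrite GRing.addrC => /eqP; rewrite GRing.subr_eq0 => /eqP.
    exists p; first exact: prime_gt0.
    have -> : y = b e ^ powa t by rewrite yE st conjgE (powaN pr) mulgA.
    by rewrite -conjXg (bXp pr) conj1g.
  apply: torsion_sections => // t; have [L' tL' [L'L|[_ sp]]] := b_length_special yL t.
    by have [n n0 tn] := IH _ L'L _ tL'; exists n.
  by case: ns; exists t.
have [x0|x0] := eqVneq (lab x) 0%R.
  by have [n n0 xn] := step x xL x0; exists n.
have xr := GGS_all_rotating pr (b_length_GGS xL).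
have [n n0 xn] : torsion (x ^+ p).
  apply: torsion_sections => [|t].
    by apply/permP => k; have [t ->] := vtx_surj pr k; rewrite perm1 (rootperm_Xp t xr).
  apply: step; first exact: b_length_secp.
  exact: etrans (@labsum_secp p pr x 0 t xr x0) (z1 x (b_length_GGS xL)).
exists (p * n)%N; first by rewrite muln_gt0 prime_gt0.
by rewrite expgnA.
Qed.

End Length.

Lemma act_take m (f : treeAut (adic m)) n l : act f (take n l) = take n (act f l).
Proof.
have [le|/ltnW le] := leqP (size l) n; first by rewrite !take_oversize // size_act.
by rewrite -{2}(cat_take_drop n l) act_cat take_size_cat // size_act size_takel.
Qed.

(** Lifting the exponent: each p-th power raises the valuation by exactly one. *)
Lemma exp1D_prime p n s : prime p -> odd p -> (0 < s)%N -> (p ^ s %| n)%N -> ~~ (p ^ s.+1 %| n)%N ->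
  forall k, exists2 n', ((1 + n) ^ (p ^ k) = 1 + n')%N &
    (p ^ (s + k) %| n')%N && ~~ (p ^ (s + k).+1 %| n')%N.
Proof.
move=> pr podd s0 sn sn1; elim=> [|k [n' n'E /andP [skn skn1]]].
  by exists n; rewrite ?expn1 // addn0 sn sn1.
have p3 : (2 < p)%N by rewrite odd_prime_gt2.
rewrite expnSr expnM n'E addnS; set r := (s + k)%N in skn skn1 *.
have r0 : (0 < r)%N by rewrite /r addn_gt0 s0.
(* The binomial terms from [i = 2] on are divisible by p^(r + 2): for [i < p] the binomial
   coefficient gives the missing factor, and for [i = p] the inequality r p >= r + 2 comes from [p]
   being at least 3. *)
pose S := (\sum_(2 <= i < p.+1) 'C(p, i) * (1 ^ (p - i) * n' ^ i))%N.
have pS : (p ^ r.+2 %| S)%N.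
  rewrite /S big_nat; apply: dvdn_sum => i /andP [i2]; rewrite ltnS leq_eqVlt exp1n mul1n.
  have rX j : (p ^ (r * j) %| n' ^ j)%N by rewrite expnM dvdn_exp2r.
  move=> /orP [/eqP ->|ip].
    rewrite binn mul1n; apply: dvdn_trans (rX p); apply: dvdn_exp2l.
    by apply: leq_trans (_ : r * 3 <= _)%N; [lia|rewrite leq_mul2l p3 orbT].
  rewrite expnS; apply: dvdn_mul.
    by apply: prime_dvd_bin => //; rewrite ip (ltnW i2).
  apply: dvdn_trans (rX i); apply: dvdn_exp2l.
  by apply: leq_trans (_ : r * 2 <= _)%N; [lia|rewrite leq_mul2l i2 orbT].
exists (p * n' + S)%N.
  rewrite expnDn -(big_mkord xpredT (fun i => 'C(p, i) * (1 ^ (p - i) * n' ^ i))%N).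
  by rewrite big_ltn // big_ltn ?ltnS ?prime_gt0 // bin0 bin1 !exp1n !mul1n expn0 expn1.
rewrite dvdn_addl; last by apply: dvdn_trans pS; apply: dvdn_exp2l.
rewrite [(p ^ r.+1)%N]expnS dvdn_pmul2l ?prime_gt0 // skn /=.
by rewrite dvdn_addl // expnS dvdn_pmul2l ?prime_gt0.
Qed.

(** * Automorphisms with boundedly many non-trivial sections on each level *)

Section BoundedActivity.
Variable m : nat.
Implicit Types (f g h x : treeAut (adic m)) (l r : seq 'I_m).

Definition bounded_activity f := exists C, forall M, exists2 c : seq (seq 'I_m),
  (size c <= C)%N & forall l, size l = M -> secw f l <> 1 -> l \in c.

Lemma bounded_activityM f g : bounded_activity f -> bounded_activity g ->
  bounded_activity (f * g).
Proof.
move=> [C fC] [D gD]; exists (C + D)%N => M.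
have [c cC cP] := fC M; have [c' cD cP'] := gD M.
exists (c ++ map (act f^-1) c'); first by rewrite size_cat size_map leq_add.
move=> l lM fgl; rewrite mem_cat; apply/orP.
have [fl|fl] := pselect (secw f l = 1); last by left; apply: cP.
right; rewrite -[l](actVK f) map_f //; apply: cP'; first by rewrite size_act.
by move=> gl; apply: fgl; rewrite secwM fl gl mulg1.
Qed.

Lemma bounded_activityV f : bounded_activity f -> bounded_activity f^-1.
Proof.
move=> [C fC]; exists C => M; have [c cC cP] := fC M.
exists (map (act f) c); first by rewrite size_map.
move=> l lM fl; rewrite -[l](actKV f) map_f //; apply: cP; first by rewrite size_act.
by move=> e; apply: fl; rewrite -[l](actKV f) secwV e invg1.
Qed.

Lemma bounded_activity1 : bounded_activity 1.
Proof. by exists 0%N => M; exists [::] => // l _; rewrite secw1. Qed.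

Lemma bounded_activityX f n : bounded_activity f -> bounded_activity (f ^+ n).
Proof.
move=> fb; elim: n => [|n IH]; first exact: bounded_activity1.
by rewrite expgS; apply: bounded_activityM.
Qed.

End BoundedActivity.

(** * Odometers, their centralizers and commutators *)

Section Odometer.
Variables (p : nat) (pr : prime p).
Implicit Types (f g h x : treeAut (adic p)) (l r : seq 'I_p).

Local Notation vtx := (vtx pr).
Local Notation rotating := (rotating pr).
Local Notation all_rotating := (all_rotating pr).
Local Notation lab := (lab pr).
Local Notation labsum := (labsum pr).

(** Non-zero label sums make the element a single cycle on every level, that is, translation by 1 on
    the boundary identified with Z_p. *)
Definition odometer x := all_rotating x /\ forall n, labsum n x != 0%R.

Lemma odometer_sec x t : odometer x -> odometer (sec (x ^+ p) (vtx t)).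
Proof.
move=> [xr x0]; split=> [|n].
  by apply: all_rotating_sec; apply: (subgroupX (all_rotating_subgroup pr)).
have lx0 : lab x != 0%R := x0 0%N.
by rewrite labsum_secp //; exact: (x0 n.+1).
Qed.

Lemma odometer_period x (n : nat) l : odometer x ->
  act (x ^+ n) l = l <-> (p ^ size l %| n)%N.
Proof.
elim: l x n => [|k l IH] x n xo; first by rewrite /= dvd1n.
have [t ->] := vtx_surj pr k; have [xr x0] := xo.
have xp := rootperm_Xp t xr.
have sE m : sec (x ^+ (p * m)) (vtx t) = sec (x ^+ p) (vtx t) ^+ m.
  by rewrite expgnA (sec_fixX _ xp).
have rE m : rootperm (x ^+ (p * m)) (vtx t) = vtx t.
  by rewrite expgnA; have := @act_fixX p (x ^+ p) [:: vtx t] m; rewrite /= xp => /(_ erefl) [].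
rewrite /= expnS; split=> [[nt nl]|/dvdnP [j ->]].
  have /dvdnP [j nj] := fixed_pow_root xr (x0 0%N) nt.
  move: nl; rewrite nj (mulnC j p) sE => /IH jl.
  by rewrite dvdn_pmul2l ?prime_gt0 // jl //; exact: odometer_sec.
rewrite mulnCA rE sE; congr cons.
by apply/(IH _ _ (odometer_sec t xo)); exact: dvdn_mull.
Qed.

Lemma odometer_transitive x l r : odometer x -> size l = size r ->
  exists n : nat, act (x ^+ n) l = r.
Proof.
move e: (size l) => N; elim: N l r x e => [|N IH] l r x lN xo rN.
  by exists 0%N; rewrite (size0nil lN) (size0nil (esym rN)).
case: l lN => // k l [lN]; case: r rN => // k' r [rN].
have [t ->] := vtx_surj pr k; have [t' ->] := vtx_surj pr k'; have [xr x0] := xo.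
have lx0 : lab x != 0%R by apply: (x0 0%N).
pose j : nat := ((t' - t) / lab x)%R.
have rj : rootperm (x ^+ j) (vtx t) = vtx t'.
  rewrite (rotatingX _ (all_rotating_root xr)) -GRing.mulr_natr (Fp_natK pr).
  by rewrite GRing.mulrCA GRing.divff // GRing.mulr1 GRing.addrC GRing.subrK.
have [m mE] : exists m, act (sec (x ^+ p) (vtx t') ^+ m) (act (sec (x ^+ j) (vtx t)) l) = r.
  by apply: IH rN; [rewrite size_act|exact: odometer_sec].
exists (j + p * m)%N; have xp := rootperm_Xp t' xr.
rewrite /= expgnDr rootpermM permM rj secM rj actM expgnA (sec_fixX _ xp) mE; congr cons.
by have := @act_fixX p (x ^+ p) [:: vtx t'] m; rewrite /= xp => /(_ erefl) [].
Qed.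

(** A transitive cyclic group is its own centralizer. The exponent depends on the level: these are
    the approximations of a p-adic integer. *)
Lemma odometer_centralizer x f N : odometer x -> commute f x ->
  exists n : nat, forall l, size l = N -> act f l = act (x ^+ n) l.
Proof.
move=> xo fx; pose l0 := nseq N (vtx 0%R).
have [n nE] := odometer_transitive xo (esym (size_act f l0)).
exists n => l lN; have [|j <-] := @odometer_transitive x l0 l xo; first by rewrite size_nseq.
by rewrite -!actM -(commuteX j fx) -expgnDr addnC expgnDr !actM nE.
Qed.

Lemma all_rotating_level f l : all_rotating f -> act (f ^+ (p ^ size l)) l = l.
Proof.
elim: l f => //= k l IH f fr; have [t ->] := vtx_surj pr k.
have fp := rootperm_Xp t fr; rewrite expnS expgnA (sec_fixX _ fp); congr cons.
  by have := @act_fixX p (f ^+ p) [:: vtx t] (p ^ size l); rewrite /= fp => /(_ erefl) [].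
by apply: IH; apply: all_rotating_sec; apply: (subgroupX (all_rotating_subgroup pr)).
Qed.

Section Commutator.
Hypothesis podd : odd p.
Variables (x h f : treeAut (adic p)) (s : nat).
Hypothesis xo : odometer x.
Hypothesis hr : all_rotating h.
Hypothesis xhE : x ^ h = x * f.
Hypothesis fx : commute f x.
Hypothesis s0 : (0 < s)%N.
Hypothesis f_fix : forall l, (size l <= s)%N -> act f l = l.
Hypothesis f_move : exists2 l, size l = s.+1 & act f l <> l.

(** On level [N] the automorphism [f] is translation by [n]; being trivial on level [s] but not on
    the next one, it has [n] of valuation [s]. *)
Let level_exponent N : (s <= N)%N -> exists n : nat,
  [/\ forall l, size l = N -> act f l = act (x ^+ n) l,
      (p ^ s %| n)%N & (s < N)%N -> ~~ (p ^ s.+1 %| n)%N].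
Proof.
move=> sN; have [n nE] := odometer_centralizer N xo fx; exists n; split=> // [|sN'].
  pose l := nseq N (vtx 0%R).
  have lN : size (take s l) = s by rewrite size_takel // size_nseq.
  rewrite -lN; apply/(odometer_period n (take s l) xo).
  by rewrite act_take -nE ?size_nseq // -act_take f_fix // lN.
apply/negP; have [l ls fl] := f_move; rewrite -ls => /(odometer_period n l xo) nl.
apply: fl; pose r := l ++ nseq (N - s.+1) (vtx 0%R).
have rN : size r = N by rewrite size_cat size_nseq ls subnKC.
have -> : l = take (size l) r by rewrite take_size_cat.
by rewrite act_take nE // -act_take take_size_cat.
Qed.

(** This is the affine map t |-> (1 + n) t + c on level [N], in the coordinate given by [x]. *)
Let act_h N n : (forall l, size l = N -> act f l = act (x ^+ n) l) ->
  forall l t, size l = N -> act h (act (x ^+ t) l) = act (x ^+ (t * (1 + n))) (act h l).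
Proof.
move=> nE l t lN.
have xfE r : size r = N -> act (x * f) r = act (x ^+ (1 + n)) r.
  by move=> rN; rewrite actM nE ?size_act // -actM -expgS.
have fxt r : size r = N -> act ((x * f) ^+ t) r = act (x ^+ (t * (1 + n))) r.
  move=> rN; elim: t => [|t IH]; first by rewrite mul0n.
  by rewrite expgSr actM IH xfE ?size_act // -actM -expgnDr mulSn addnC.
rewrite -fxt ?size_act // -xhE -actM -conjXg -actM.
by rewrite conjgE mulgA mulgV mul1g.
Qed.

Let act_hX N n : (forall l, size l = N -> act f l = act (x ^+ n) l) ->
  forall i l t, size l = N ->
  act (h ^+ i) (act (x ^+ t) l) = act (x ^+ (t * (1 + n) ^ i)) (act (h ^+ i) l).
Proof.
move=> nE i l t lN; elim: i => [|i IH]; first by rewrite !expg0 !act1 muln1.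
by rewrite expgSr !actM IH (act_h nE) ?size_act // expnSr mulnA.
Qed.

(** A fixed point on level [M] amounts to t n + c = 0 modulo p^M. As [h] fixes [l0], p^s divides
    [c], and [n] is p^s times a unit. *)
Let fixed_vertex l0 : size l0 = s -> act h l0 = l0 ->
  forall M, (s <= M)%N -> exists2 v, size v = M & act h v = v.
Proof.
move=> l0s hl0 M sM; have [n [nE sn sn1]] := level_exponent sM.
pose w := l0 ++ nseq (M - s) (vtx 0%R).
have wM : size w = M by rewrite size_cat size_nseq l0s subnKC.
have w0 : take s w = l0 by rewrite -l0s take_size_cat.
have [c cE] := odometer_transitive xo (esym (size_act h w)).
have sc : (p ^ s %| c)%N.
  rewrite -l0s; apply/(odometer_period c l0 xo).
  by rewrite -w0 act_take cE -act_take w0.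
have [t tE] : exists t, (p ^ M %| t * n + c)%N.
  have [MS|sM'] := leqP M s.
    have -> : M = s by apply/eqP; rewrite eqn_leq MS sM.
    by exists 0%N; rewrite mul0n.
  have {}sn1 := sn1 sM'.
  have /dvdnP [n' n'E] := sn; have /dvdnP [c' c'E] := sc.
  have cop : coprime n' (p ^ (M - s)).
    rewrite coprime_sym coprimeXl // prime_coprime //; apply: contra sn1 => pn'.
    by rewrite n'E expnSr mulnC; exact: dvdn_mul.
  have n'0 : (0 < n')%N.
    by rewrite lt0n; apply: contra sn1 => /eqP n'0; rewrite n'E n'0 mul0n dvdn0.
  case: (egcdnP (p ^ (M - s)) n'0) => km kn kE _.
  rewrite (eqP cop) in kE.
  have q0 : (0 < p ^ (M - s))%N by rewrite expn_gt0 prime_gt0.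
  (* [Q] stands for -1 modulo p^(M - s), so that [km * (c' * Q)] represents - c' / n' without
     subtraction. *)
  pose Q := (p ^ (M - s)).-1; have qE : (p ^ (M - s) = Q.+1)%N by rewrite prednK.
  rewrite qE in kE; exists (km * (c' * Q))%N.
  have -> : (km * (c' * Q) * n + c = Q.+1 * p ^ s * (kn * (c' * Q) + c'))%N.
    rewrite n'E c'E; transitivity ((km * n') * (c' * Q) * p ^ s + c' * p ^ s)%N; first ring.
    by rewrite kE; ring.
  by rewrite -qE -expnD subnK // dvdn_mulr.
exists (act (x ^+ t) w); first by rewrite size_act.
rewrite (act_h nE) // -cE -actM -expgnDr.
have -> : (c + t * (1 + n) = t + (t * n + c))%N by ring.
rewrite expgnDr actM; apply/(odometer_period _ _ xo).
by rewrite size_act wM.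
Qed.

(* The section of h at u conjugates the odometer [secw (x ^+ p ^ size u) u] to a proper
   power of it, so it cannot permute the vertices of a lower level rigidly. *)
Let active_below u M : (s <= M)%N -> (size u <= M)%N -> act h u = u ->
  exists r, size (u ++ r) = M /\ secw h (u ++ r) <> 1.
Proof.
move=> sM uM hu; apply: contrapT => na.
have rigid i r : size (u ++ r) = M -> secw (h ^+ i) (u ++ r) = 1.
  elim: i r => [|i IH] r rM; first exact: secw1.
  rewrite expgS secwM act_cat hu IH ?mulg1; last first.
    by rewrite -rM !size_cat size_act.
  by apply: contrapT => ne; apply: na; exists r.
(* One more than the valuation of p^(size u) ((1 + n)^(p^M) - 1), a translation that would have to
   be trivial on level [N]. *)
pose N := (size u + (s + M)).+1.
have sN : (s < N)%N by rewrite /N; lia.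
have [n [nE sn /(_ sN) sn1]] := level_exponent (ltnW sN).
have hfix l : size l = N -> prefix u l -> act (h ^+ (p ^ M)) l = l.
  move=> lN /prefixP [r lE].
  have lM : size (take M l) = M by rewrite size_takel // lN /N; lia.
  have uE : take M l = u ++ take (M - size u) r.
    by rewrite lE take_cat ltnNge uM.
  have hT := all_rotating_level (take M l) hr; rewrite lM in hT.
  have sT : secw (h ^+ (p ^ M)) (take M l) = 1 by rewrite uE rigid // -uE.
  by rewrite -{1}(cat_take_drop M l) act_cat hT sT act1 cat_take_drop.
pose w := u ++ nseq (N - size u) (vtx 0%R).
have wN : size w = N by rewrite size_cat size_nseq subnKC // /N; lia.
have xu : act (x ^+ (p ^ size u)) u = u by apply/(odometer_period _ _ xo).
have := act_hX nE (p ^ M) (p ^ size u) wN.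
rewrite (hfix w) ?prefix_prefix // hfix; last first.
- by rewrite act_cat xu prefix_prefix.
- by rewrite size_act.
have [n' -> /andP [_ nn']] := exp1D_prime pr podd s0 sn sn1 M.
rewrite mulnDr muln1 expgnDr actM => /esym /(odometer_period _ _ xo).
rewrite size_act wN /N -addnS expnD dvdn_pmul2l ?expn_gt0 ?prime_gt0 //.
by rewrite (negPf nn').
Qed.

(** Translates by p^(m - s) of the fixed vertex of level [m] are again fixed, as p^m divides p^(m -
    s) n; below each of them [h] is active. *)
Let unbounded v M : (s <= M)%N -> size v = M -> act h v = v ->
  exists F : nat -> seq 'I_p, forall m, (s <= m <= M)%N ->
    [/\ size (F m) = M, secw h (F m) <> 1 &
        take m (F m) = act (x ^+ (p ^ (m - s))) (take m v)].
Proof.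
move=> sM vM hv.
have H m : exists r, (s <= m <= M)%N -> [/\ size r = M, secw h r <> 1 &
        take m r = act (x ^+ (p ^ (m - s))) (take m v)].
  have [/andP [sm mM]|] := boolP (s <= m <= M)%N; last by exists [::].
  pose u := act (x ^+ (p ^ (m - s))) (take m v).
  have um : size u = m by rewrite size_act size_takel // vM.
  have hu : act h u = u.
    have [n [nE sn _]] := level_exponent sm.
    have hv' : act h (take m v) = take m v by rewrite act_take hv.
    rewrite /u (act_h nE) ?size_takel ?vM // hv'.
    rewrite mulnDr muln1 expgnDr !actM; apply/(odometer_period _ _ xo).
    rewrite !size_act size_takel ?vM // -{1}(subnK sm) expnD; exact: dvdn_mul.
  have [|r [rM ra]] := @active_below u M sM _ hu; first by rewrite um.
  exists (u ++ r) => _; split=> //.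
  by rewrite take_size_cat.
have [F FP] := choice H.
by exists F => m; apply: FP.
Qed.

(** The translate for [m] agrees with the fixed vertex down to level [m - s] and leaves it on the
    next level. *)
Let unbounded_inj v M F : size v = M ->
    (forall m, (s <= m <= M)%N -> take m (F m) = act (x ^+ (p ^ (m - s))) (take m v)) ->
  {in [pred m | s <= m <= M] &, injective (F : nat -> seq 'I_p)}%N.
Proof.
move=> vM FE.
have lt m m' : (s <= m)%N -> (m < m')%N -> (m' <= M)%N -> F m <> F m'.
  move=> sm mm' m'M /(congr1 (take (m - s).+1)).
  have mM : (m <= M)%N by lia.
  have sm' : (s <= m' <= M)%N by lia.
  have lM : ((m - s).+1 <= M)%N by lia.
  have -> : take (m - s).+1 (F m) = take (m - s).+1 (take m (F m)).
    by rewrite take_takel //; lia.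
  have -> : take (m - s).+1 (F m') = take (m - s).+1 (take m' (F m')).
    by rewrite take_takel //; lia.
  rewrite !FE ?sm // -!act_take !take_takel; [|lia|lia].
  rewrite [RHS](proj2 (odometer_period _ _ xo)); last first.
    by rewrite size_takel ?vM //; apply: dvdn_exp2l; lia.
  move=> /(odometer_period _ _ xo); rewrite size_takel ?vM //.
  by rewrite dvdn_Pexp2l ?prime_gt1 // ltnn.
move=> m m'; rewrite !inE => /andP [sm mM] /andP [sm' m'M] e.
by case: (ltngtP m m') => // [mm'|mm']; [case: (lt m m')|case: (lt m' m)].
Qed.

(** The levels from [s] to [s + D] give [D + 1] active vertices, one more than the bound allows. *)
Lemma bounded_fixed_absurd l0 : bounded_activity h -> size l0 = s -> act h l0 = l0 -> False.
Proof.
move=> [D hD] l0s hl0; pose M := (s + D)%N.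
have sM : (s <= M)%N by rewrite leq_addr.
have [v vM hv] := fixed_vertex l0s hl0 sM.
have [F FP] := unbounded sM vM hv.
have [c cD cP] := hD M.
have F_inj : {in [pred m | s <= m <= M] &, injective F}%N.
  by apply: (unbounded_inj vM) => m /FP [].
have uF : uniq (map F (iota s D.+1)).
  rewrite map_inj_in_uniq ?iota_uniq // => m m'.
  rewrite !mem_iota addnS !ltnS => ? ?; exact: F_inj.
have subF : {subset map F (iota s D.+1) <= c}.
  move=> l /mapP [m]; rewrite mem_iota addnS ltnS => mM ->.
  by have [lM la _] := FP m mM; apply: cP.
have := uniq_leq_size uF subF; rewrite size_map size_iota => /leq_trans /(_ cD).
by rewrite ltnn.
Qed.

End Commutator.

(* If f <> 1 then h acts on the boundary, identified with Z_p by x, as t |-> eta t + c,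
   with eta <> 1. Composing with a power of x it gets infinitely many pairwise disjoint
   invariant subtrees, on which it has to be active. *)
Theorem odometer_commutator x h : odd p -> odometer x -> all_rotating h ->
    bounded_activity x -> bounded_activity h -> commute [~ h, x] x ->
  [~ h, x] = 1.
Proof.
move=> podd xo hr xb hb fx; apply: contrapT => f1.
have [xr _] := xo.
have sR := all_rotating_subgroup pr.
set f := [~ h, x] in fx f1.
have fr : all_rotating f by apply: (subgroupR sR).
have ex : exists n, `[< exists2 l, size l = n & act f l <> l >].
  have [l fl] : exists l, act f l <> l.
    apply: contrapT => nl; apply: f1; apply: act_ext => l.
    by rewrite act1; apply: contrapT => fl; apply: nl; exists l.
  by exists (size l); apply/asboolP; exists l.
case: (ex_minnP ex) => -[|s] /asboolP [l ls fl] fmin.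
  by apply: fl; rewrite (size0nil ls).
have f_fix r : (size r <= s)%N -> act f r = r.
  move=> rs; apply: contrapT => fr'; have := fmin (size r).
  by rewrite leqNgt ltnS rs => H; have : false by apply: H; apply/asboolP; exists r.
(* A commutator has label 0, so [f] is trivial on the first level and [s] is positive, as the
   valuation argument requires. *)
have lf0 : lab f = 0%R.
  have := labsumM 0 (all_rotatingM (all_rotatingV hr) (all_rotatingV xr)) (all_rotatingM hr xr).
  have -> : h^-1 * x^-1 * (h * x) = f by rewrite /f commgEl conjgE !mulgA.
  rewrite /= => ->; have := labsumM 0 hr xr; have := labsumM 0 (all_rotatingV hr) (all_rotatingV xr).
  rewrite /= => -> ->; have := labsumV 0 hr; have := labsumV 0 xr; rewrite /= => -> ->; ring.
have s0 : (0 < s)%N.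
  case: s ls f_fix {fmin} => // ls _; case: fl; case: l ls => [|k [|//]] //= _.
  by rewrite (lab_eq0 (all_rotating_root fr) lf0) perm1.
pose l0 := take s l; have l0s : size l0 = s by rewrite size_takel // ls.
(* Multiplying [h] by a power of [x] makes [l0] fixed and leaves the commutator unchanged. *)
have [c cE] := odometer_transitive xo (size_act h l0).
pose g := h * x ^+ c.
have gf : [~ g, x] = f.
  rewrite commgMl (_ : [~ x ^+ c, x] = 1) ?mulg1; last first.
    by apply/eqP/commgP/commute_sym/commuteX.
  by apply/conjg_fixP/commgP/commuteX.
have gr : all_rotating g by apply: (subgroupM sR) => //; apply: (subgroupX sR).
have gb : bounded_activity g by apply: bounded_activityM => //; apply: bounded_activityX.
have xg : x ^ g = x * f^-1.
  by rewrite -gf invgR commgEl mulgA mulgV mul1g.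
have fVfix r : act f^-1 r = r <-> act f r = r.
  by split=> [e|e]; rewrite -{1}e ?actKV ?actVK.
apply: (@bounded_fixed_absurd podd x g f^-1 s xo gr xg _ s0 _ _ l0) => //.
- by apply/commute_sym/commuteV/commute_sym.
- by move=> r rs; apply/fVfix/f_fix.
- by exists l => // /fVfix.
- by rewrite actM cE.
Qed.

(** On each level [f] is a translation, and Z_p is torsion-free. *)
Lemma odometer_centralizer_torsion x f n : odometer x -> commute f x -> (0 < n)%N ->
  f ^+ n = 1 -> f = 1.
Proof.
move=> xo fx n0 fn; apply: act_ext => l; rewrite act1.
(* The [n] extra levels absorb the valuation of [n], which is less than [n]. *)
pose N := (size l + n)%N.
have [m mE] := odometer_centralizer N xo fx.
have fnE k : forall r, size r = N -> act (f ^+ k) r = act (x ^+ (m * k)) r.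
  elim: k => [|k IH] r rN; first by rewrite muln0.
  by rewrite expgSr actM IH // mE ?size_act // -actM -expgnDr mulnSr.
pose w := l ++ nseq n (vtx 0%R).
have wN : size w = N by rewrite size_cat size_nseq.
have mn : (p ^ N %| m * n)%N.
  by rewrite -wN; apply/(odometer_period _ _ xo); rewrite -fnE // fn act1.
have ml : (p ^ size l %| m)%N.
  have [->|m0] := posnP m; first exact: dvdn0.
  rewrite pfactor_dvdn // leqNgt; apply/negP => lt.
  move: mn; rewrite pfactor_dvdn ?muln_gt0 ?m0 // lognM // => le.
  have : (logn p n < n)%N by apply: ltn_logl.
  by rewrite /N in le; lia.
have -> : l = take (size l) w by rewrite take_size_cat.
rewrite act_take mE // -act_take take_size_cat //.
exact/(odometer_period _ _ xo).
Qed.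

End Odometer.

(** * Branching over the second derived subgroup and left Engel elements of multi-GGS groups *)

Lemma sec_conj m (h x : treeAut (adic m)) k : rootperm h = 1 ->
  sec (h ^ x) (rootperm x k) = sec h k ^ sec x k.
Proof.
by move=> h1; rewrite !conjgE !secM secV !rootpermV !permK !h1 perm1.
Qed.

Section BranchGGS.
Variables (p : nat) (pr : prime p) (podd : odd p).
Variable E : {vspace 'rV['F_p]_p.-1}.
Hypothesis E0 : E != 0%VS.
Implicit Types (f g h x y : treeAut (adic p)) (s t u : 'F_p) (e : 'rV['F_p]_p.-1).

Local Notation a := (GGS_a p).
Local Notation b := (@GGS_b p).
Local Notation vtx := (vtx pr).
Local Notation all_rotating := (all_rotating pr).
Local Notation lab := (lab pr).
Local Notation labsum := (labsum pr).
Local Notation coord := (coord pr).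
Local Notation G := (multi_GGS E).
Local Notation sG := (GGS_subgroup E).
Local Notation D1 := (derived G).
Local Notation D2 := (derived D1).

Lemma GGS_bounded_activity x : G x -> bounded_activity x.
Proof.
have apow t : bounded_activity (powa (p := p) t).
  exists 1%N => M; exists [:: [::]] => // -[|k l] //= _.
  by rewrite sec_powa secw1.
move=> Gx; elim/GGS_ind: x / Gx => [|y yb|y z yb zb||e eE].
- exact: bounded_activity1.
- exact: bounded_activityV.
- exact: bounded_activityM.
- exact: (apow 1%R).
exists p.+1 => M.
suff [c [cS c1 cP]] : exists c : seq (seq 'I_p), [/\ (size c <= p.+1)%N,
    (M = 0%N -> (size c <= 1)%N) & forall l, size l = M -> secw (b e) l <> 1 -> l \in c].
  by exists c.
elim: M => [|M [c [cS c1 cP]]].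
  by exists [:: [::]]; split=> // -[|? ?].
(* Only the section at 0 stays active below its root; the words added on level 1 cover the powers of
   [a]. *)
exists (map (cons (vtx 0%R)) c ++ if M == 0%N then [seq [:: k] | k <- enum 'I_p] else [::]).
split=> // [|[|k l] //= [lM]].
  rewrite size_cat size_map; case: eqP => [/c1 c2|_]; last by rewrite addn0.
  by rewrite size_map size_enum_ord addnC -addn1 leq_add2l.
have [t ->] := vtx_surj pr k; rewrite sec_b mem_cat; case: eqVneq => [->|t0] H.
  by rewrite map_f // cP.
case: l lM H => [<-|k' l _] /=; last by rewrite sec_powa secw1.
by move=> _; apply/orP; right; apply: map_f; rewrite mem_enum.
Qed.

Lemma D1_G x : D1 x -> G x. Proof. exact: derived_sub sG _. Qed.
Let sD1 : is_subgroup D1. Proof. exact: derived_subgroup. Qed.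
Let sD2 : is_subgroup D2. Proof. exact: derived_subgroup. Qed.
Lemma D2_G x : D2 x -> G x. Proof. by move=> /(derived_sub sD1) /D1_G. Qed.
Let D1J x g : G x -> D1 g -> D1 (g ^ x).
Proof. by move=> Gx; apply: derivedJ => y Gy; apply: (subgroupJ sG). Qed.

(** Two elements of [D1] whose supports share only the subtree at [t] have a commutator concentrated
    there; the second vertex [j] is the price for realizing a prescribed section at [t]. *)
Definition section_group t j : set (treeAut (adic p)) :=
  [set h | exists X, [/\ D1 X, rootperm X = 1, sec X (vtx t) = h &
     forall u, u != t -> u != j -> sec X (vtx u) = 1]].

Lemma section_group_subgroup t j : is_subgroup (section_group t j).
Proof.
apply: is_subgroupI => [|x [X [DX X1 <- XE]]|x y [X [DX X1 <- XE]] [Y [DY Y1 <- YE]]].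
- by exists 1; split=> [||| u _ _]; rewrite ?rootperm1 ?sec1 //; exact: (subgroup1 sD1).
- exists X^-1; split=> [||| u ut uj]; rewrite ?rootpermV ?secV ?X1 ?invg1 ?perm1 //.
    exact: (subgroupV sD1).
  by rewrite XE ?invg1.
- exists (X * Y); split=> [||| u ut uj]; rewrite ?rootpermM ?secM ?X1 ?Y1 ?mulg1 ?perm1 //.
    exact: (subgroupM sD1).
  by rewrite XE // YE // mulg1.
Qed.

Lemma section_groupJ t j g h : section_group t j h -> G g -> section_group t j (h ^ g).
Proof.
move=> [X [DX X1 <- XE]] Gg; have [z Gz [z1 <-]] := GGS_fractal pr E0 t Gg.
exists (X ^ z); split=> [||| u ut uj].
- exact: D1J.
- by rewrite conjgE !rootpermM rootpermV X1 z1 invg1 !mulg1.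
- by have := sec_conj z (vtx t) X1; rewrite z1 perm1.
- by have := sec_conj z (vtx u) X1; rewrite z1 perm1 XE // conj1g.
Qed.

Lemma section_group_derived t j : (forall e, e \in E -> section_group t j [~ b e, a]) ->
  D1 `<=` section_group t j.
Proof.
move=> ba; have sJ := section_group_subgroup t j.
apply: derived_min => //; apply: commutator_generated => //.
  by move=> h g Jh Gg; apply: section_groupJ.
move=> _ _ [->|[e /= eE <-]] [->|[e' /= e'E <-]].
- by rewrite commgg; exact: (subgroup1 sJ).
- by rewrite -invgR; apply: (subgroupV sJ); apply: ba.
- exact: ba.
- have -> : [~ b e, b e'] = 1.
    by apply/eqP/commgP; rewrite /commute -!(bD pr) GRing.addrC.
  exact: (subgroup1 sJ).
Qed.

(** Moving the self-reproducing components of two generators to [t] and [t - d], with coordinate [d]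
    of the second scaled to 1, gives the commutator with [a] at [t]; away from both vertices the
    sections are powers of [a] and commute. *)
Lemma section_group_coord t e d : e \in E -> coord e d != 0%R ->
  D1 `<=` section_group t (t - d)%R.
Proof.
move=> eE ed; apply: section_group_derived => e' e'E.
have [f fE fP] := exists_scaled 1%R eE ed.
have d0 : d != 0%R by apply: contraNneq ed => ->; rewrite coord0.
exists [~ b e' ^ powa t, b f ^ powa (t - d)%R]; split=> [||| u ut uj].
- apply: derived_comm; apply: (subgroupJ sG); (exact: GGS_mem_powa || exact: GGS_mem_b).
- by rewrite rootperm_commr // rootperm_bJ.
- rewrite sec_fixR ?rootperm_bJ ?perm1 // !sec_bJ GRing.subrr GRing.opprB GRing.addrC GRing.subrK.
  by rewrite !sec_b eqxx (negPf d0) fP GRing.mulfVK // -(powaE pr 1).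
- rewrite sec_fixR ?rootperm_bJ ?perm1 // !sec_bJ !sec_b !GRing.subr_eq0 (negPf ut) (negPf uj).
  by apply/eqP/commgP; rewrite /commute -!(powaD pr) GRing.addrC.
Qed.

(** The section of the first generator at [t - d] is governed by its coordinate [- d], which
    vanishes since [- d] differs from [d] for odd [p]. The commutator is thus concentrated at [t],
    and [j] is arbitrary. *)
Lemma section_group_single t j e d : e \in E -> coord e d != 0%R ->
    (forall e1 u, e1 \in E -> u != d -> coord e1 u = 0%R) ->
  D1 `<=` section_group t j.
Proof.
move=> eE ed single; apply: section_group_derived => e' e'E.
have [f fE fP] := exists_scaled 1%R eE ed.
have d0 : d != 0%R by apply: contraNneq ed => ->; rewrite coord0.
have dd : (- d)%R != d.
  rewrite eq_sym -GRing.addr_eq0 -GRing.mulr2n -GRing.mulr_natr GRing.mulf_neq0 //.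
  apply/eqP => /(congr1 val); rewrite [LHS](val_Fp_nat pr) modn_small //.
  exact: odd_prime_gt2.
exists [~ b e' ^ powa t, b f ^ powa (t - d)%R]; split=> [||| u ut _].
- apply: derived_comm; apply: (subgroupJ sG); (exact: GGS_mem_powa || exact: GGS_mem_b).
- by rewrite rootperm_commr // rootperm_bJ.
- rewrite sec_fixR ?rootperm_bJ ?perm1 // !sec_bJ GRing.subrr GRing.opprB GRing.addrC GRing.subrK.
  by rewrite !sec_b eqxx (negPf d0) fP GRing.mulfVK // -(powaE pr 1).
- rewrite sec_fixR ?rootperm_bJ ?perm1 // !sec_bJ !sec_b !GRing.subr_eq0 (negPf ut).
  case: eqVneq => [->|uj].
    have -> : (t - d - t = - d)%R by ring.
    by rewrite single // powa0 comm1g.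
  by apply/eqP/commgP; rewrite /commute -!(powaD pr) GRing.addrC.
Qed.

Lemma section_group_pair t : exists j m, [/\ j != m, D1 `<=` section_group t j
  & D1 `<=` section_group t m].
Proof.
have [e [d [eE ed]]] := exists_coord pr E0.
have [[f [d' [fE dd' fd']]]|ns] :=
    pselect (exists e1 d', [/\ e1 \in E, d' != d & coord e1 d' != 0%R]).
  exists (t - d)%R, (t - d')%R; split.
  - by rewrite (inj_eq (GRing.addrI t)) (inj_eq GRing.oppr_inj) eq_sym.
  - exact: (@section_group_coord t e d eE ed).
  - exact: (@section_group_coord t f d' fE fd').
have single e1 u : e1 \in E -> u != d -> coord e1 u = 0%R.
  by move=> e1E ud; apply: contrapT => /eqP eu; apply: ns; exists e1, u.
exists 0%R, 1%R; split; [by rewrite eq_sym GRing.oner_neq0| |].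
- exact: (@section_group_single t 0%R e d eE ed single).
- exact: (@section_group_single t 1%R e d eE ed single).
Qed.

(** Two elements of [D1] are lifted with different second vertices, so that away from [t] one of the
    two sections is always trivial. *)
Lemma derived2_at1 k g : D2 g -> D2 (at1 k g).
Proof.
have [t ->] := vtx_surj pr k.
pose J := [set h | D2 (at1 (vtx t) h)].
have sJ : is_subgroup J.
  apply: is_subgroupI => [|x Jx|x y Jx Jy]; rewrite /J /=.
  - by rewrite at1_1; exact: (subgroup1 sD2).
  - by rewrite at1V; exact: (subgroupV sD2).
  - by rewrite at1M; exact: (subgroupM sD2).
apply: (derived_min sJ) => x y /= Dx Dy; rewrite /J /=.
have [j [m [jm /(_ _ Dx) [X [DX X1 <- XE]] /(_ _ Dy) [Y [DY Y1 <- YE]]]]] := section_group_pair t.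
suff <- : [~ X, Y] = at1 (vtx t) [~ sec X (vtx t), sec Y (vtx t)] by exact: derived_comm.
apply: sec_ext => [|i].
  by rewrite rootperm_at1 rootperm_commr.
have [u ->] := vtx_surj pr i; rewrite sec_at1 sec_fixR ?X1 ?Y1 ?perm1 //.
rewrite (inj_eq (@vtx_inj p pr)); case: eqVneq => [-> //|ut].
have [uj|uj] := eqVneq u j; last by rewrite XE // comm1g.
by rewrite YE ?commg1 // uj.
Qed.

Lemma derived2_atw l g : D2 g -> D2 (atw l g).
Proof. by move=> Dg; elim: l => //= k l IH; apply: derived2_at1. Qed.

Lemma GGS_odometer x : G x -> lab x != 0%R -> labsum 1 x != 0%R -> odometer pr x.
Proof.
move=> Gx x0 x1; split; first exact: GGS_all_rotating Gx.
by case=> // n; rewrite (GGS_labsum pr n Gx).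
Qed.

Lemma odometer_order x n : odometer pr x -> (0 < n)%N -> x ^+ n <> 1.
Proof.
move=> xo n0 xn; have := odometer_period n (nseq n (vtx 0%R)) xo.
rewrite xn act1 size_nseq => -[/(_ erefl) /(dvdn_leq n0)].
by rewrite leqNgt ltn_expl ?prime_gt1.
Qed.

(** The sums of the coordinates at [s] and [- s] add up to twice the weight, which is non-zero as
    [p] is odd. *)
Lemma exists_symmetric_coord e : weight pr e != 0%R ->
  exists s, (coord e s + coord e (- s) != 0 /\ coord e (- s) != 0)%R.
Proof.
move=> we.
have [s es] : exists s, (coord e s + coord e (- s) != 0)%R.
  apply: contrapT => ns; case/eqP: we; apply/eqP.
  have : (weight pr e + weight pr e = 0)%R.
    rewrite {2}/weight (reindex_inj GRing.oppr_inj) /= /weight -big_split /=.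
    by apply: big1 => s _; apply: contrapT => /eqP es; apply: ns; exists s.
  rewrite -GRing.mulr2n -GRing.mulr_natr => /eqP; rewrite GRing.mulf_eq0 => /orP [//|].
  move=> /eqP /(congr1 val); rewrite [LHS](val_Fp_nat pr) modn_small //.
  exact: odd_prime_gt2.
have [es0|] := eqVneq (coord e (- s)%R) 0%R; last by exists s.
exists (- s)%R; rewrite GRing.opprK GRing.addrC es; split=> //.
by move: es; rewrite es0 GRing.addr0.
Qed.

(** The section of [[~ H, O]] at 0 is [[~ h, o]], whose section [w] at [s] has label - (e_s +
    e_(-s)) and twice the weight of [e] as label sum on level 1: an odometer. The vector [e'] is
    scaled so that the section [o] of [O] carries the vertex 0 to [s]. *)
Lemma derived2_infinite_order e : e \in E -> weight pr e != 0%R ->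
  exists2 v, D2 v & forall n, (0 < n)%N -> v ^+ n <> 1.
Proof.
move=> eE we; have [s [ess es]] := exists_symmetric_coord we.
have s0 : s != 0%R by apply: contraNneq es => ->; rewrite GRing.oppr0 coord0.
have [e' e'E e'P] := exists_scaled (- s)%R eE es.
have comm_sec e1 u : sec [~ powa s, b e1] (vtx u) =
    (sec (b e1) (vtx (u - s)%R))^-1 * sec (b e1) (vtx u).
  have := @sec_commr p (powa s) (b e1) (vtx (u - s)%R) (rootperm_b e1).
  by rewrite (rotates_powa pr) GRing.subrK sec_powa conjg1.
have comm_root e1 : rootperm [~ powa s, b e1] = 1.
  by rewrite rootperm_commr // rootperm_b.
have comm_D1 e1 : e1 \in E -> D1 [~ powa s, b e1].
  by move=> e1E; apply: derived_comm; [exact: GGS_mem_powa|exact: GGS_mem_b].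
set h := [~ powa s, b e]; set O := [~ powa s, b e'].
have [j [_ [_ /(_ h (comm_D1 _ eE)) [H [DH H1 Hh _]] _]]] := section_group_pair 0%R.
pose o := powa s * b e'.
have Oo : sec O (vtx 0%R) = o.
  rewrite comm_sec GRing.sub0r !sec_b eqxx GRing.oppr_eq0 (negPf s0) e'P GRing.mulfVK //.
  by rewrite -(powaN pr) GRing.opprK.
have os : rootperm o (vtx 0%R) = vtx s.
  by rewrite rootpermM permM rootperm_b perm1 (rotates_powa pr) GRing.add0r.
have hG : G h by apply: D1_G; apply: comm_D1.
have oG : G o by apply: (subgroupM sG); [exact: GGS_mem_powa|exact: GGS_mem_b].
pose w := sec [~ h, o] (vtx s).
have wE : w = (powa (coord e s))^-1 * b e *
    ((powa (coord e (- s)%R))^-1 * b e) ^ sec o (vtx 0%R).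
  rewrite /w commgEl secM rootpermV comm_root invg1 perm1 secV comm_root invg1 perm1.
  rewrite -{2}os sec_conj; last exact: comm_root.
  rewrite !comm_sec GRing.subrr GRing.sub0r !sec_b eqxx GRing.oppr_eq0 (negPf s0).
  by rewrite invMg invgK.
have aR := all_rotating_powa pr; have bR := all_rotating_b pr.
have sR := all_rotating_subgroup pr.
have oR : all_rotating (sec o (vtx 0%R)).
  by apply: all_rotating_sec; apply: (GGS_all_rotating pr oG).
have wsum n : labsum n w = (labsum n (b e) + labsum n (b e) -
    labsum n (powa (coord e s)) - labsum n (powa (coord e (- s)%R)))%R.
  rewrite wE; have cR : all_rotating ((powa (coord e (- s)%R))^-1 * b e).
    by apply: (subgroupM sR) => //; apply: (subgroupV sR).
  have dR : all_rotating ((powa (coord e s))^-1 * b e).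
    by apply: (subgroupM sR) => //; apply: (subgroupV sR).
  rewrite labsumM //; last exact: (subgroupJ sR).
  rewrite labsumJ // !labsumM ?labsumV //; first ring.
  - exact: (subgroupV sR).
  - exact: (subgroupV sR).
have wo : odometer pr w.
  apply: GGS_odometer.
  - by apply: (GGS_sec pr); apply: (subgroupR sG).
  - have := wsum 0%N; rewrite /= => ->; rewrite lab_b !lab_powa GRing.addr0 GRing.sub0r.
    by rewrite -GRing.opprD GRing.oppr_eq0.
  - rewrite wsum !labsum_b !labsum_powa !GRing.subr0 -GRing.mulr2n -GRing.mulr_natr.
    rewrite GRing.mulf_neq0 //; apply/eqP => /(congr1 val).
    by rewrite [LHS](val_Fp_nat pr) modn_small // odd_prime_gt2.
exists [~ H, O]; first by apply: derived_comm => //; apply: comm_D1.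
move=> n n0 vn; apply: (@odometer_order w n wo n0).
have y1 : rootperm [~ h, o] = 1.
  rewrite -invgR rootpermV rootperm_commr ?invg1 //; exact: comm_root.
have v1 : rootperm [~ H, O] = 1.
  by apply: rootperm_commr; exact: comm_root.
have vE : sec [~ H, O] (vtx 0%R) = [~ h, o].
  by rewrite sec_fixR ?H1 ?comm_root ?perm1 // Hh Oo.
rewrite /w -sec_fixX ?y1 ?perm1 // -vE -sec_fixX ?v1 ?perm1 // vn.
by rewrite !sec1.
Qed.

Lemma no_left_engel e : e \in E -> weight pr e != 0%R -> forall x, G x ->
  (forall g, G g -> exists n, engel g x n = 1) -> x = 1.
Proof.
move=> eE we x Gx xE; apply: contrapT => x1.
have [v0 Dv0 v0inf] := derived2_infinite_order eE we.
(* Elements of [D2] can be copied at every vertex, so the Engel condition restricted to them passes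
   to sections. *)
have [] := @GGS_nontrivial_section p pr E
  [set y | forall v, D2 v -> exists n, engel v y n = 1] _ x Gx _ x1.
- move=> y k Gy yE y1 v Dv; have [n yn] := yE _ (derived2_at1 k Dv).
  exists n; have := @sec_engel p (at1 k v) y k n.
  by rewrite rootperm_at1 y1 perm1 yn sec1 sec_at1 eqxx => ->.
- by move=> v Dv; apply: xE; apply: D2_G.
move=> y [Gy yE y0] {x x1 Gx xE}.
have yr := all_rotating_root (GGS_all_rotating pr Gy).
have [l [k [k0 kl kmin kz]]] := GGS_good_return pr Gy.
case: kz => [z1|[z0 zs]].
  have yl : act y l <> l.
    case: l kl kmin z1 => [_ kmin z1|i l _ _ _ /= [yi _]].
      have k1 : k = 1%N by apply/eqP; rewrite -dvdn1 kmin.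
      by move: z1 y0; rewrite k1 /= expg1 => ->; rewrite lab1 eqxx.
    have [t it] := vtx_surj pr i; move: yi; rewrite it yr => /(@vtx_inj p pr) /eqP.
    by rewrite -[X in _ == X]GRing.addr0 (inj_eq (GRing.addrI t)) (negPf y0).
  have [n yn] := yE _ (derived2_atw l Dv0).
  have [|j j0 v0j] := engel_atw_torsion yl k0 kl kmin _ yn.
    by rewrite z1; exact: commute1.
  by apply: (v0inf j).
set z := secw (y ^+ k) l in z0 zs.
have Gz : G z by apply: (GGS_secw pr); apply: (subgroupX sG).
have zo : odometer pr z by apply: GGS_odometer.
(* Concentrated at one vertex of the first level, [v] cannot commute with the odometer [z], which
   moves that vertex. *)
pose v := at1 (vtx 0%R) v0; have Dv : D2 v by apply: derived2_at1.
pose g := atw l v; have Dg : D2 g by apply: derived2_atw.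
(* Elements supported on the subtrees at the orbit of [l] and fixing their roots; the iterated
   commutators stay in it, so their sections at [l] can be compared with [z]. *)
pose T : set (treeAut (adic p)) := [set f | [/\ G f,
  forall i : nat, act f (act (y ^+ i) l) = act (y ^+ i) l &
  forall r, (forall i : nat, ~~ prefix (act (y ^+ i) l) r) -> act f r = r]].
have TM f f' : T f -> T f' -> T (f * f').
  move=> [Gf fl fr] [Gf' fl' fr']; split=> [|i|r rP]; first exact: (subgroupM sG).
    by rewrite actM fl fl'.
  by rewrite actM fr // fr'.
have TV f : T f -> T f^-1.
  move=> [Gf fl fr]; split=> [|i|r rP]; first exact: (subgroupV sG).
    by rewrite -{1}(fl i) actVK.
  by rewrite -{1}(fr r rP) actVK.
have yV (i : nat) : act y (act (y ^+ (i + k.-1)) l) = act (y ^+ i) l.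
  by rewrite -actM -expgSr -addnS prednK // addnC expgnDr actM kl.
have prefix_act f r r' : prefix (act f r) (act f r') = prefix r r'.
  by rewrite !prefixE size_act -act_take; apply/eqP/eqP => [/act_inj|->].
have TJ f : T f -> T (f ^ y).
  move=> [Gf fl fr]; split=> [|i|r rP]; first exact: (subgroupJ sG).
    by rewrite -yV conjgE !actM actVK fl.
  rewrite conjgE !actM fr ?actKV // => i; have := rP i.+1.
  by rewrite expgSr actM -{1}[r](actKV y) prefix_act.
have Tg : T g.
  split=> [|i|r /(_ 0%N)]; [exact: D2_G| |by rewrite act1; exact: act_atw_out].
  have [->|ne] := pselect (act (y ^+ i) l = l); first exact: act_atw.
  apply: act_atw_out; apply/negP => /prefix_eq_size H.
  by apply: ne; rewrite -H ?size_act.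
have TE n : T (engel g y n).
  by elim: n => // n IH; rewrite engelS commgEl; apply: TM; [apply: TV|apply: TJ].
have yob : bounded_activity z by apply: GGS_bounded_activity.
(* At [l], [[~ secw h l, z] = secw f l ^+ k] commutes with [z], hence is trivial, and then
   [secw f l] is trivial as a torsion element centralizing an odometer. Commutation of [f] with [y]
   spreads this over the orbit of [l]. *)
have step n : engel g y n.+2 = 1 -> engel g y n.+1 = 1.
  move=> e2; set h := engel g y n; set f := engel g y n.+1.
  have fE : f = [~ h, y] by [].
  have fy : commute f y by apply/commgP/eqP.
  have [Gh hl _] := TE n; have [Gf fl fr] := TE n.+1; rewrite -/h in Gh hl; rewrite -/f in Gf fl fr.
  have hl0 : act h l = l by have := hl 0%N; rewrite act1.
  have fl0 : act f l = l by have := fl 0%N; rewrite act1.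
  have hk : [~ h, y ^+ k] = f ^+ k by apply: commgXr_commute.
  have hzE : [~ secw h l, z] = secw f l ^+ k.
    by rewrite -secw_fixR // hk secw_fixX.
  have fz : commute (secw f l) z.
    have := congr1 (fun f => secw f l) (commuteX k fy : f * y ^+ k = y ^+ k * f).
    by rewrite !secwM fl0 kl.
  have fk : secw f l ^+ k = 1.
    rewrite -hzE; apply: (odometer_commutator podd zo) => //.
    - by apply: (GGS_all_rotating pr (E := E)); apply: (GGS_secw pr).
    - by apply: GGS_bounded_activity; apply: (GGS_secw pr).
    - by rewrite hzE; apply/commute_sym/commuteX/commute_sym.
  have f1 := odometer_centralizer_torsion zo fz k0 fk.
  apply: act_ext => r; rewrite act1.
  have [[i ir]|ni] := pselect (exists i : nat, prefix (act (y ^+ i) l) r); last first.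
    by apply: fr => i; apply/negP => ir; apply: ni; exists i.
  move: ir; rewrite -[r](actKV (y ^+ i)) prefix_act => /prefixP [r' ->].
  by rewrite -actM -(commuteX i fy) actM act_cat fl0 f1 act1.
have Engel1 n : engel g y n.+1 = 1 -> engel g y 1 = 1.
  by elim: n => // n IH /step.
have [n gn] := yE _ Dg.
have gy : commute g y.
  apply/commgP/eqP; case: n gn => [gn|n /Engel1 //].
  by rewrite /engel /= in gn; rewrite gn comm1g.
have vz : commute v z.
  have := congr1 (fun f => secw f l) (commuteX k gy : g * y ^+ k = y ^+ k * g).
  by rewrite !secwM act_atw kl secw_atw.
have vzJ : v ^ z = v by apply/conjg_fixP/commgP.
apply: (v0inf 1%N) => //; rewrite expg1.
have := congr1 (fun f => sec f (vtx 0%R)) vzJ.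
rewrite /v at1J !sec_at1 eqxx ifF //.
rewrite (all_rotating_root zo.1) (inj_eq (@vtx_inj p pr)) eq_sym GRing.add0r.
exact/negbTE.
Qed.

Lemma GGS_left_engel : ~ periodic G -> left_engel G = [set 1].
Proof.
move=> np; have [e [eE we]] : exists e, e \in E /\ weight pr e != 0%R.
  apply: contrapT => ne; apply: np; apply: (@GGS_periodic p pr E) => e eE.
  by apply: contrapT => /eqP we; apply: ne; exists e.
apply: left_engel_eq1; first exact: (subgroup1 sG).
exact: no_left_engel eE we.
Qed.

End BranchGGS.

Unset Implicit Arguments.

Theorem corollaryD (d : nat -> nat) (hd : forall n, (1 < d n)%N) :
  [/\ [/\ forall (gT : groupType) (G : set gT),
            is_iterated_wreath_product d G -> left_engel G = [set 1],
          is_iterated_wreath_product d [set: treeAut d] /\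
            left_engel [set: treeAut d] = [set 1]
        & forall p : nat, prime p -> forall S : set (treeAut (adic p)),
            sylow_pro_p p S ->
            is_iterated_wreath_product (adic p) S /\ left_engel S = [set 1]],
      (infinite_set [set n | (2 < d n)%N] ->
         left_engel (@finitary d) = [set 1]) /\
      (forall (p : nat) (s : 'S_p), prime p -> is_p_cycle s ->
         bounded_left_engel (p_finitary s) = [set 1]),
      left_engel hanoi = [set 1]
    & forall (p : nat) (E : {vspace 'rV['F_p]_p.-1}),
        prime p -> odd p -> E != 0%VS ->
        right_engel (multi_GGS E) = [set 1] /\
        (~ periodic (multi_GGS E) -> left_engel (multi_GGS E) = [set 1])].
Proof.
split; [split|split|exact: hanoi_left_engel|].
- exact: iterated_wreath_product_left_engel.
- have wT := setT_iterated_wreath_product hd; split=> //.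
  exact: iterated_wreath_product_left_engel wT.
- move=> p pr S /(sylow_iterated_wreath_product pr) wS; split=> //.
  by apply: iterated_wreath_product_left_engel wS => n; exact: prime_gt1.
- move=> dinf; apply: left_engel_eq1; first exact: finitary1.
  exact: finitary_left_engel.
- move=> p s pr sc.
  have F1 : p_finitary s 1 by split; [exact: finitary1|move=> v; rewrite label_adic1 group1].
  apply/seteqP; split=> [x [Fx xE]|x /= ->].
    exact: (p_finitary_bounded_left_engel pr sc Fx xE).
  by split=> //; exists 1%N => g _; rewrite /engel /= commg1.
- move=> p E pr podd E0; split; first exact: GGS_right_engel.
  exact: GGS_left_engel.
Qed.
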